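(* Let $D>0$ be the solution to $D^{2\alpha+2}=\sum_{j=1}^m(n_j^2\varepsilon_j^2)\wedge(n_jD)$ and assume that $\delta_j<\left(n_j^{1/2}\varepsilon_j^2(D\vee1)^{-1}\right)^{1+\kappa}$ for some $\kappa>0$ and all $j\in[m]$. Then $$\inf_{\hat f\in\mathcal M(\boldsymbol\varepsilon,\boldsymbol\delta)}\ \sup_{f\in\mathcal B^{\alpha,R}_{p,q}}\mathbb E_f\|\hat f-f\|_2^2\gtrsim D^{-2\alpha}\wedge1.$$
   Context: Data. There are $m$ servers; server $j$ holds $n_j$ observations $Z^{(j)}=(Z^{(j)}_i)_{i=1}^{n_j}$, $Z_i^{(j)}=(Y_i^{(j)},X_i^{(j)})\in\mathcal Z=\mathbb R\times[0,1]$. All $N=\sum_{j=1}^m n_j$ observations are i.i.d. from $P_f$, under which $X_i^{(j)}\sim U[0,1]$, $Y_i^{(j)}=f(X_i^{(j)})+\xi_i^{(j)}$, with $\xi_i^{(j)}\sim N(0,1)$ independent of $X_i^{(j)}$. Privacy. Server $j$ outputs a randomized transcript $T^{(j)}$ in a standard Borel space $(\mathcal T,\mathscr T)$, drawn from a conditional law $\mathbb P(\cdot\mid Z^{(j)})$ depending only on $Z^{(j)}$ (no interaction between servers). It is $(\varepsilon_j,\delta_j)$-differentially private if $\mathbb P(T^{(j)}\in A\mid Z^{(j)}=z)\le e^{\varepsilon_j}\mathbb P(T^{(j)}\in A\mid Z^{(j)}=z')+\delta_j$ for all $A\in\mathscr T$ and all $z,z'\in\mathcal Z^{n_j}$ differing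 in at most one of their $n_j$ entries. Here $0<\varepsilon_j\le C_\varepsilon$ for a fixed constant $C_\varepsilon>0$, and $(\boldsymbol\varepsilon,\boldsymbol\delta)=\{(\varepsilon_j,\delta_j)\}_{j=1}^m$. $\mathcal M(\boldsymbol\varepsilon,\boldsymbol\delta)$ is the class of distributed estimation protocols: transcript mechanisms, with $T^{(j)}$ being $(\varepsilon_j,\delta_j)$-differentially private for each $j$, together with an estimator $\hat f$ which is a (function-valued) function of $T=(T^{(1)},\dots,T^{(m)})$. $\mathbb E_f$ is expectation under the joint law of data and transcripts when data are drawn from $P_f$. Function class. $p\ge2$, $q\ge1$, $\alpha-1/p>1/2$, and $R>0$ is a constant. Let $\{\psi_{lk}\}$, $l\ge l_0$, be a Cohen–Daubechies–Vial compactly supported $A$-regular orthonormal wavelet basis of $L_2[0,1]$ with $A>\alpha$ (level $l_0$ denotes the father wavelets; levels $l>l_0$ contain $2^l$ wavelets, $k=0,\dots,2^l-1$), and $f_{lk}=\langle f,\psi_{lk}\rangle$. Then $\|f\|_{\mathcal B^\alpha_{p,q}}=\big(\sum_{l\ge l_0}(2^{l(\alpha+1/2-1/p)}\|(f_{lk})_k\|_p)^q\big)^{1/q}$ (supremum over $l$ if $q=\infty$), and $\mathcal B^{\alpha,R}_{p,q}=\{f\in L_2[0,1]:\|f\|_{\mathcal B^\alpha_{p,q}}\le R\}$. Asymptotics. Statements are asymptotic in $m$, the $n_j$ and $(\boldsymbol\varepsilon,\boldsymbol\delta)$, with $N\to\infty$. $a\gtrsim b$ means $b\le Ca$ for a constant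 $C>0$ not depending on $m,n_j,\varepsilon_j,\delta_j$ (it may depend on the fixed quantities, such as $\alpha,p,q,R,\kappa,C_\varepsilon$ and the wavelet basis). $a\wedge b=\min(a,b)$, $a\vee b=\max(a,b)$, $[m]=\{1,\dots,m\}$. *)

(* Defs.v *)
From HB Require Import structures.
From mathcomp Require Import all_boot all_order all_algebra.
From mathcomp Require Import all_classical all_reals all_analysis.
From mathcomp Require Import measurable_realfun.

Set Implicit Arguments.
Unset Strict Implicit.
Unset Printing Implicit Defensive.

Import Order.TTheory GRing.Theory Num.Theory.
Import numFieldNormedType.Exports.

Local Open Scope classical_set_scope.
Local Open Scope ring_scope.

Section cons_tuple.
Context d (T : measurableType d) (n : nat).

Definition cons_tuple (x : T * n.-tuple T) : n.+1.-tuple T :=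
  [the n.+1.-tuple T of x.1 :: x.2].

Lemma measurable_cons_tuple : measurable_fun [set: T * n.-tuple T] cons_tuple.
Proof. exact: measurable_cons measurable_fst measurable_snd. Qed.

HB.instance Definition _ :=
  isMeasurableFun.Build _ _ _ _ cons_tuple measurable_cons_tuple.

End cons_tuple.

(* Q ord0 \x ... \x Q ord_max on the product sigma-algebra of n.-tuple T. *)
Fixpoint tuple_prob (R : realType) d (T : measurableType d) (n : nat) :
    ('I_n -> probability T R) -> probability (n.-tuple T) R :=
  match n with
  | 0 => fun=> \d_([tuple] : 0.-tuple T)
  | n'.+1 => fun Q => distribution
      (Q ord0 \x @tuple_prob R d T n' (fun i => Q (lift ord0 i)))%E
      (@cons_tuple d T n' : {mfun (T * n'.-tuple T)%type >-> n'.+1.-tuple T})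
  end.

Section kernel_law.
Context (R : realType) d d' (X : measurableType d) (Y : measurableType d').
Variables (K : R.-pker X ~> Y) (x : X).

(* K x, as an element of probability Y R *)
Definition kernel_law : set Y -> \bar R := K x.

HB.instance Definition _ := Measure.copy kernel_law (K x).

Let kernel_law_setT : kernel_law [set: Y] = 1%E.
Proof. exact: prob_kernel. Qed.

HB.instance Definition _ :=
  Measure_isProbability.Build _ _ R kernel_law kernel_law_setT.

End kernel_law.

(* An observation is a pair (Y, X). The sample space is the subset
   in_sample_space; its complement has probability 0 under every obs_law f. *)
Definition obs (R : realType) := (measurableTypeR R * measurableTypeR R)%type.

Definition in_sample_space (R : realType) (z : obs R) : bool := 0 <= z.2 <= 1.

Section regression_model.
Context (R : realType) (f : {mfun measurableTypeR R >-> measurableTypeR R}).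

Definition mk_obs (w : measurableTypeR R * measurableTypeR R) : obs R :=
  (f w.1 + w.2, w.1).

Lemma measurable_mk_obs :
  measurable_fun [set: measurableTypeR R * measurableTypeR R] mk_obs.
Proof.
apply: measurable_fun_pair; last first.
  exact: measurable_fst.
apply: measurable_funD; last exact: measurable_snd.
by apply: (measurableT_comp (f := f)) => //; exact: measurable_fst.
Qed.

HB.instance Definition _ :=
  isMeasurableFun.Build _ _ _ _ mk_obs measurable_mk_obs.

Definition obs_law : probability (obs R) R :=
  distribution (uniform_prob (@ltr01 R) \x normal_prob 0 1)%E mk_obs.

Definition data_law (N : nat) : probability (N.-tuple (obs R)) R :=
  tuple_prob (fun=> obs_law).

End regression_model.

Definition sqnormL2 (R : realType) (g : R -> R) : \bar R :=
  (\int[lebesgue_measure]_(x in `[0%R, 1%R]) ((g x) ^+ 2)%:E)%E.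

Definition dotL2 (R : realType) (f g : R -> R) : R :=
  \int[lebesgue_measure]_(x in `[0%R, 1%R]) (f x * g x).

(* Raw data of a CDV construction with N = cdv_N vanishing moments: the 2N-tap
   Daubechies filter, the father and mother wavelets of the line, and the N
   boundary scaling functions and wavelets at each end of the interval, the
   right ones being reflected to the half-line [0, +oo[ (the values of
   boundary functions on ]-oo, 0[ are irrelevant). *)
Record cdv_system (R : realType) := CdvSystem {
  cdv_N : nat;
  cdv_filter : 'I_(2 * cdv_N) -> R;
  cdv_phi : R -> R;
  cdv_psi : R -> R;
  cdv_phi_left : 'I_cdv_N -> R -> R;
  cdv_phi_right : 'I_cdv_N -> R -> R;
  cdv_psi_left : 'I_cdv_N -> R -> R;
  cdv_psi_right : 'I_cdv_N -> R -> R
}.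

(* The k-th function (k < 2 ^ j) of scale j: N left boundary functions, then
   2 ^ j - 2N translates of g, then N right boundary functions. *)
Definition cdv_level (R : realType) (N : nat) (g : R -> R)
    (gl gr : 'I_N -> R -> R) (j k : nat) (x : R) : R :=
  let s := Num.sqrt (2 ^+ j) in
  if insub k is Some i then s * gl i (2 ^+ j * x)
  else if insub (2 ^ j - k.+1)%N is Some i then s * gr i (2 ^+ j * (1 - x))
  else s * g (2 ^+ j * x - k%:R).

Definition cdv_scaling (R : realType) (W : cdv_system R) (j k : nat) : R -> R :=
  cdv_level (cdv_phi W) (@cdv_phi_left _ W) (@cdv_phi_right _ W) j k.

Definition cdv_detail (R : realType) (W : cdv_system R) (j k : nat) : R -> R :=
  cdv_level (cdv_psi W) (@cdv_psi_left _ W) (@cdv_psi_right _ W) j k.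

(* The family psi_{lk}: for l > l0 the wavelets of scale l; the father
   wavelets stored at level l0 are the scaling functions of scale l0 + 1, which
   is the scale complementary to the details of scales l0 + 1, l0 + 2, ... *)
Definition cdv_wavelet (R : realType) (W : cdv_system R) (l0 l k : nat) :
    R -> R :=
  if l == l0 then cdv_scaling W l0.+1 k else cdv_detail W l k.

Definition level_size (l0 l : nat) : nat :=
  if l == l0 then (2 ^ l0.+1)%N else (2 ^ l)%N.

Definition classC (R : realType) (A : nat) (g : R -> R) : Prop :=
  (forall i x, (i < A)%N -> derivable (derive1n i g) x 1) /\
  continuous (derive1n A g).

(* phi and psi form a Daubechies pair with N vanishing moments; the index i of
   the filter stands for the shift i - (N - 1), ranging over -N+1, ..., N. *)
Definition daubechies_pair (R : realType) (N : nat) (h : 'I_(2 * N) -> R)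
    (phi psi : R -> R) : Prop :=
  [/\ forall x, ~~ (- N%:R + 1 <= x <= N%:R) -> phi x = 0 /\ psi x = 0,
      forall x, phi x = \sum_(i < 2 * N)
        Num.sqrt 2 * h i * phi (2 * x - i%:R + N%:R - 1),
      forall x, psi x = \sum_(i < 2 * N)
        (-1) ^+ (i + N + 1) * Num.sqrt 2 * h (rev_ord i) *
        phi (2 * x - i%:R + N%:R - 1),
      \int[lebesgue_measure]_x phi x = 1 /\
        (forall k : int, \int[lebesgue_measure]_x (phi x * phi (x - k%:~R)) =
                         (k == 0)%:R) &
      forall r, (r < N)%N -> \int[lebesgue_measure]_x (x ^+ r * psi x) = 0].

Section cdv_basis.
Context (R : realType) (A l0 : nat) (W : cdv_system R).

Definition cdv_boundary_support : Prop :=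
  forall (i : 'I_(cdv_N W)) x, (2 * cdv_N W)%:R - 1 < x ->
    [/\ cdv_phi_left i x = 0, cdv_phi_right i x = 0,
        cdv_psi_left i x = 0 & cdv_psi_right i x = 0].

(* C^A on the line; for a boundary function this is C^A on [0, +oo[ up to the
   endpoint. *)
Definition cdv_smooth : Prop :=
  [/\ classC A (cdv_phi W), classC A (cdv_psi W) &
      forall i : 'I_(cdv_N W),
      [/\ classC A (cdv_phi_left i), classC A (cdv_phi_right i),
          classC A (cdv_psi_left i) & classC A (cdv_psi_right i)]].

Definition cdv_vanishing_moments : Prop :=
  forall j k r, (l0 < j)%N -> (k < 2 ^ j)%N -> (r < cdv_N W)%N ->
    dotL2 (fun x => x ^+ r) (cdv_detail W j k) = 0.

Definition cdv_multiresolution : Prop :=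
  forall (g : nat -> nat -> R -> R), g = cdv_scaling W \/ g = cdv_detail W ->
  forall j k, (l0 < j)%N -> (k < 2 ^ j)%N ->
    exists c : nat -> R, forall x, 0 <= x <= 1 ->
      g j k x = \sum_(i < 2 ^ j.+1) c i * cdv_scaling W j.+1 i x.

Definition cdv_orthonormal : Prop :=
  forall l k l' k', (l0 <= l)%N -> (k < level_size l0 l)%N ->
    (l0 <= l')%N -> (k' < level_size l0 l')%N ->
    dotL2 (cdv_wavelet W l0 l k) (cdv_wavelet W l0 l' k') =
    ((l == l') && (k == k'))%:R.

Definition cdv_complete : Prop :=
  forall f : {mfun measurableTypeR R >-> measurableTypeR R},
    (sqnormL2 f < +oo)%E ->
    (forall l k, (l0 <= l)%N -> (k < level_size l0 l)%N ->
      dotL2 f (cdv_wavelet W l0 l k) = 0) ->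
    sqnormL2 f = 0%E.

(* W generates an A-regular CDV orthonormal basis
   (cdv_wavelet W l0 l k), l0 <= l, k < level_size l0 l, of L_2[0, 1]. *)
Record is_cdv_basis : Prop := IsCdvBasis {
  cdv_regularity : (A <= cdv_N W)%N /\ cdv_smooth;
  cdv_coarsest_scale : (2 * cdv_N W <= 2 ^ l0.+1)%N;
  cdv_daubechies : daubechies_pair (@cdv_filter _ W) (cdv_phi W) (cdv_psi W);
  cdv_supports : cdv_boundary_support;
  cdv_moments : cdv_vanishing_moments;
  cdv_mra : cdv_multiresolution;
  cdv_ortho : cdv_orthonormal;
  cdv_total : cdv_complete
}.

End cdv_basis.

Section besov.
Context (R : realType) (W : cdv_system R) (l0 : nat).
Variables (alpha : R) (p q : \bar R).

Definition wavelet_coef (f : R -> R) (l k : nat) : R :=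
  dotL2 f (cdv_wavelet W l0 l k).

Definition level_norm (f : R -> R) (l : nat) : \bar R :=
  'N[counting]_p[(fun k : nat =>
    if (k < level_size l0 l)%N then (wavelet_coef f l k)%:E else 0)]%E.

Definition besov_norm (f : R -> R) : \bar R :=
  'N[counting]_q[(fun l : nat =>
    if (l0 <= l)%N then
      (2 `^ (l%:R * (alpha + 2^-1 - fine (p^-1)%E)))%:E * level_norm f l
    else 0)]%E.

(* An element of L_2[0, 1] is represented by a Borel function on the line, of
   which only the values on [0, 1] matter. *)
Definition besov_ball (rad : R) :
    set {mfun measurableTypeR R >-> measurableTypeR R} :=
  [set f | (sqnormL2 f < +oo)%E /\ (besov_norm f <= rad%:E)%E].

End besov.

(* The sigma-algebra of T is the Borel sigma-algebra of a Polish topology. *)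
Definition standard_borel (R : realType) d (T : measurableType d) : Prop :=
  exists (X : completePseudoMetricType R) (phi : T -> X),
    [/\ hausdorff_space X,
        exists2 S : set X, countable S & dense S,
        bijective phi &
        forall A : set T,
          measurable A <-> <<s [set U : set X | open U] >> (phi @` A)].

(* Only datasets in the sample space are compared; how K extends to the other
   (null) datasets is irrelevant. *)
Definition diff_private (R : realType) d (T : measurableType d) (n : nat)
    (eps delta : R) (K : R.-pker n.-tuple (obs R) ~> T) : Prop :=
  forall z z' : n.-tuple (obs R),
    (forall i, in_sample_space (tnth z i)) ->
    (forall i, in_sample_space (tnth z' i)) ->
    (#|[pred i | tnth z i != tnth z' i]| <= 1)%N ->
    forall A : set T, measurable A ->
      (K z A <= (expR eps)%:E * K z' A + delta%:E)%E.

(* prot_est Pi (t, x) is the value at x of the function-valued estimate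
   computed from the transcripts t; joint measurability makes its squared
   L_2[0, 1] error a measurable function of t. *)
Record protocol (R : realType) (m : nat) (n : 'I_m -> nat) := Protocol {
  prot_display : measure_display;
  prot_space : measurableType prot_display;
  prot_mech : forall j : 'I_m, R.-pker (n j).-tuple (obs R) ~> prot_space;
  prot_est : {mfun (m.-tuple prot_space * measurableTypeR R)%type >->
                   measurableTypeR R}
}.

Definition private_protocol (R : realType) (m : nat) (n : 'I_m -> nat)
    (eps delta : 'I_m -> R) (Pi : protocol R n) : Prop :=
  standard_borel R (prot_space Pi) /\
  forall j, diff_private (eps j) (delta j) (prot_mech Pi j).

Section risk.
Context (R : realType) (m : nat) (n : 'I_m -> nat).

Definition total_size : nat := \sum_j n j.

Definition server_data (z : total_size.-tuple (obs R)) (j : 'I_m) :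
    (n j).-tuple (obs R) :=
  [tuple tnth z (tagnat.Rank j i) | i < n j].

(* Conditional law of the transcripts given all the data: without interaction
   they are conditionally independent. *)
Definition transcript_law (Pi : protocol R n) (z : total_size.-tuple (obs R)) :
    probability (m.-tuple (prot_space Pi)) R :=
  tuple_prob (fun j => kernel_law (prot_mech Pi j) (server_data z j)).

Definition risk (f : {mfun measurableTypeR R >-> measurableTypeR R})
    (Pi : protocol R n) : \bar R :=
  (\int[data_law f total_size]_z \int[transcript_law Pi z]_t
     sqnormL2 (fun x => (prot_est Pi (t, x) : R) - f x)%R)%E.

Definition minimax_risk (eps delta : 'I_m -> R)
    (F : set {mfun measurableTypeR R >-> measurableTypeR R}) : \bar R :=
  ereal_inf [set r | exists2 Pi : protocol R n,
    private_protocol eps delta Pi & r = ereal_sup [set risk f Pi | f in F]].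

End risk.

Arguments minimax_risk {R m} n eps delta F.

(* Main.v *)
(* Assouad's method over a hypercube of wavelet coefficients at a level L with
   2^L of order D \/ 1, for perturbations of amplitude a of order
   2^(-L(alpha + 1/2)) and disjoint supports, so that flipping one coefficient
   changes the regression function on a cell of length of order 2^-L only.

   For each coefficient, one has to bound from below the Hellinger affinity of
   the two laws of the transcripts. It is a product over the servers, and the
   factor of a server with n observations is at least 1 - V / 2 where
   V = E[(phi - 1) clip(phi - 1)], phi being the likelihood ratio of the two
   transcript laws. If n eps^2 >= D, data processing gives V of order n a^2.
   Otherwise split at a level c. Below c, changing one observation changes the
   expectation of a bounded statistic of the transcript by a factor e^eps and an
   additive delta, and a hybrid argument along the n observations, which differ
   in law by O(a 2^(-L/2)) in total variation, gives a term of order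
   n^2 eps^2 a^2 / 2^L and one proportional to delta c. Above c, a high even
   moment of the likelihood ratio of the data is used; the power 1 + kappa in the
   assumption on delta allows c to be larger than the typical fluctuations of
   that ratio by the factor (n eps^2 / D)^(-1/r), which makes the tail as small
   as the other terms. Altogether V is of order
   a^2 / D * min(n^2 eps^2, n D), and the definition of D makes the sum over the
   servers a small constant. *)

Require Import Defs.
From HB Require Import structures.
From mathcomp Require Import all_boot all_order all_algebra.
From mathcomp Require Import all_classical all_reals all_analysis.
From mathcomp Require Import measurable_realfun giry.
From mathcomp Require Import ring lra zify.

Set Implicit Arguments.
Unset Strict Implicit.
Unset Printing Implicit Defensive.

Import Order.TTheory GRing.Theory Num.Theory.
Import numFieldNormedType.Exports.

Local Open Scope classical_set_scope.
Local Open Scope ring_scope.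

(** Why truncate: privacy with an additive [delta] only controls expectations of bounded functions
    of the transcript, so the chi-square divergence of the transcript laws is out of reach. V
    replaces it. With u = clip(phi - 1), E[(phi - 1) u] is the difference of the expectations of u
    under the two laws, to which the hybrid argument applies; and V still controls the affinity,
    because the quadratic correction to the linear expansion of the square root at 1 is only needed
    near 1. Why the bound is quadratic in the privacy budget eta: the hybrid argument alone gives
    eta E|u|, which is linear. As u^2 <= (phi - 1) u, the arithmetic-geometric mean inequality
    absorbs half of the left-hand side and leaves eta^2. How moments reach phi: there is no formula
    for phi, only the Radon-Nikodym theorem. Moments of the data likelihood ratio are transferred by
    duality: Young's inequality is applied pointwise to a data set and a transcript, with a bounded
    test function w, then averaged; w = clip(phi - 1) is substituted at the end. *)

Lemma integral_probability_cst (R : realType) d (T : measurableType d)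
    (P : probability T R) (c : R) : (\int[P]_x c%:E = c%:E)%E.
Proof. by rewrite integral_cst//= probability_setT mule1. Qed.

(** The relation dQ = g dP, tested on nonnegative integrands so that it passes through Tonelli's
    theorem without integrability conditions. *)
Definition is_density (R : realType) d (T : measurableType d)
    (P Q : set T -> \bar R) (g : T -> R) :=
  forall f : T -> \bar R, measurable_fun setT f -> (forall x, 0 <= f x)%E ->
    (\int[Q]_x f x = \int[P]_x ((g x)%:E * f x))%E.

(** * Product laws on tuples *)

Section tuple_prob_theory.
Context (R : realType) d (T : measurableType d).

Lemma integral_tuple_prob_cons n (Q : 'I_n.+1 -> probability T R)
    (f : n.+1.-tuple T -> \bar R) :
  measurable_fun setT f -> (forall t, 0 <= f t)%E ->
  (\int[tuple_prob Q]_t f t =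
   \int[Q ord0]_x \int[tuple_prob (fun i => Q (lift ord0 i))]_t
     f (Defs.cons_tuple (x, t)))%E.
Proof.
move=> mf f0 /=; rewrite (ge0_integral_distribution (@Defs.cons_tuple d T n))//.
have mfc : measurable_fun setT (f \o @Defs.cons_tuple d T n).
  by apply: measurableT_comp => //; exact: measurable_cons_tuple.
by rewrite fubini_tonelli1//= => x; exact: f0.
Qed.

Lemma integral_tuple_prob_cons_swap n (Q : 'I_n.+1 -> probability T R)
    (f : n.+1.-tuple T -> \bar R) :
  measurable_fun setT f -> (forall t, 0 <= f t)%E ->
  (\int[tuple_prob Q]_t f t =
   \int[tuple_prob (fun i => Q (lift ord0 i))]_t \int[Q ord0]_x
     f (Defs.cons_tuple (x, t)))%E.
Proof.
move=> mf f0 /=; rewrite (ge0_integral_distribution (@Defs.cons_tuple d T n))//.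
have mfc : measurable_fun setT (f \o @Defs.cons_tuple d T n).
  by apply: measurableT_comp => //; exact: measurable_cons_tuple.
by rewrite fubini_tonelli2//= => x; exact: f0.
Qed.

Lemma tnth_cons_tupleS n (x : T) (t : n.-tuple T) i :
  tnth (Defs.cons_tuple (x, t)) (lift ord0 i) = tnth t i.
Proof. exact: tnthS. Qed.

Lemma measurable_prod_tnth n (g : 'I_n -> T -> R) :
  (forall i, measurable_fun setT (g i)) ->
  measurable_fun setT (fun t : n.-tuple T => \prod_i g i (tnth t i)).
Proof.
move=> mg; apply: measurable_prod => i _.
exact: (measurableT_comp (mg i) (@measurable_tnth _ T n i)).
Qed.

Lemma integral_tuple_prob_prod n (Q : 'I_n -> probability T R)
    (g : 'I_n -> T -> R) :
  (forall i, measurable_fun setT (g i)) -> (forall i x, 0 <= g i x) ->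
  (\int[tuple_prob Q]_t (\prod_i g i (tnth t i))%:E =
   \prod_i \int[Q i]_x (g i x)%:E)%E.
Proof.
elim: n Q g => [|n ih] Q g mg g0.
  rewrite big_ord0 /=; under eq_integral do rewrite big_ord0.
  exact: (integral_probability_cst \d_([tuple] : 0.-tuple T) 1).
have m1 : measurable_fun setT (fun x : T => (g ord0 x)%:E).
  exact/measurable_EFinP.
have m2 : measurable_fun setT (fun t : n.-tuple T =>
    (\prod_i g (lift ord0 i) (tnth t i))%:E).
  apply/measurable_EFinP.
  exact: (@measurable_prod_tnth _ (fun i => g (lift ord0 i))).
rewrite integral_tuple_prob_cons//; last 2 first.
  - by apply/measurable_EFinP; exact: (@measurable_prod_tnth _ g).
  - by move=> t; rewrite lee_fin prodr_ge0.
rewrite big_ord_recl -ih//.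
rewrite -ge0_integralZr//; last 2 first.
  - by move=> x _; rewrite lee_fin.
  - by apply: integral_ge0 => t _; rewrite lee_fin prodr_ge0.
apply: eq_integral => x _.
rewrite -ge0_integralZl//; last 2 first.
  - by move=> t _; rewrite lee_fin prodr_ge0.
  - by rewrite lee_fin.
apply: eq_integral => t _; rewrite -EFinM; congr EFin.
rewrite big_ord_recl; congr (_ * _).
by apply: eq_bigr => i _; rewrite tnth_cons_tupleS.
Qed.

Definition rect n (A : 'I_n -> set T) : set (n.-tuple T) :=
  [set t | forall i, A i (tnth t i)].

Lemma measurable_rect n (A : 'I_n -> set T) :
  (forall i, measurable (A i)) -> measurable (rect A).
Proof.
move=> mA; rewrite [rect A](_ : _ =
    \bigcap_(i in [set: 'I_n]) ((fun t => tnth t i) @^-1` A i)); last first.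
  by apply/seteqP; split => t /= tA i; [move=> _|]; exact: tA.
apply: fin_bigcap_measurable => [|i _]; first exact: finite_finset.
by rewrite -[X in measurable X]setTI; exact: measurable_tnth.
Qed.

Lemma indic_rect n (A : 'I_n -> set T) t :
  \1_(rect A) t = \prod_i \1_(A i) (tnth t i) :> R.
Proof.
rewrite indicE; case: (asboolP (rect A t)) => [tA|/existsNP[i ti]].
  by rewrite mem_set// big1// => i _; rewrite indicE mem_set.
rewrite memNset; last by move/(_ i).
by rewrite (bigD1 i)//= indicE memNset// mul0r.
Qed.

Lemma tuple_prob_rect n (Q : 'I_n -> probability T R) (A : 'I_n -> set T) :
  (forall i, measurable (A i)) ->
  tuple_prob Q (rect A) = (\prod_i Q i (A i))%E.
Proof.
move=> mA; transitivity (\int[tuple_prob Q]_t (\1_(rect A) t)%:E)%E.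
  by rewrite integral_indic ?setIT//; exact: measurable_rect.
under eq_integral do rewrite indic_rect.
rewrite (@integral_tuple_prob_prod _ Q (fun i => \1_(A i)))//.
by apply: eq_bigr => i _; rewrite integral_indic// setIT.
Qed.

Let rects (n : nat) : set (set (n.-tuple T)) :=
  [set rect A | A in [set A : 'I_n -> set T | forall i, measurable (A i)]].

Let measurable_tuple_rects n :
  @measurable _ (n.-tuple T) = <<s @rects n >>.
Proof.
apply/seteqP; split.
  apply: smallest_sub; first exact: smallest_sigma_algebra.
  rewrite -bigcup_seq; apply: bigcup_sub => i _ _ [A mA <-].
  apply: sub_sigma_algebra; exists (fun j => if j == i then A else setT).
    by move=> j; case: ifP.
  rewrite setTI; apply/seteqP; split => t /=; first by move/(_ i); rewrite eqxx.
  by move=> tA j; case: eqP => [->|].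
by apply: smallest_sub; [exact: sigma_algebra_measurable|] => _ [A mA <-];
  exact: measurable_rect.
Qed.

Let setI_closed_rects n : setI_closed (@rects n).
Proof.
move=> _ _ [A mA <-] [B mB <-]; exists (fun i => A i `&` B i).
  by move=> i; exact: measurableI.
apply/seteqP; split => t /=; first by move=> AB; split => i; case: (AB i).
by move=> [tA tB] i; split.
Qed.

(** Rectangles are stable under intersection and generate the product sigma-algebra, so two finite
    measures are compared on them only. *)
Lemma eq_measure_rect n (m1 m2 : {finite_measure set (n.-tuple T) -> \bar R}) :
  (forall A : 'I_n -> set T, (forall i, measurable (A i)) ->
    m1 (rect A) = m2 (rect A)) ->
  forall A, measurable A -> m1 A = m2 A.
Proof.
move=> m12; apply: (@measure_unique _ _ _ (@rects n) (fun=> setT)).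
- exact: measurable_tuple_rects.
- exact: setI_closed_rects.
- by move=> i; exists (fun=> setT) => //; apply/seteqP; split.
- by rewrite bigcup_const.
- by move=> _ [B mB <-]; exact: m12.
- by move=> _; rewrite -ge0_fin_numE// fin_num_measure.
Qed.

Lemma tuple_prob_density n (P Q : 'I_n -> probability T R)
    (g : 'I_n -> T -> R) :
  (forall i, measurable_fun setT (g i)) -> (forall i x, 0 <= g i x) ->
  (forall i, is_density (P i) (Q i) (g i)) ->
  is_density (tuple_prob P) (tuple_prob Q)
    (fun t => \prod_i g i (tnth t i)).
Proof.
elim: n P Q g => [|n ih] P Q g mg g0 gPQ f mf f0.
  by apply: eq_integral => t _; rewrite big_ord0 mul1e.
rewrite integral_tuple_prob_cons// gPQ//; last 2 first.
  - have mfc : measurable_fun setT (f \o @Defs.cons_tuple d T n).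
      by apply: measurableT_comp => //; exact: measurable_cons_tuple.
    exact: (measurable_fun_fubini_tonelli_F _ mfc (fun x => f0 _)).
  - by move=> x; exact: integral_ge0.
rewrite integral_tuple_prob_cons//; last 2 first.
  - apply: emeasurable_funM => //; apply/measurable_EFinP.
    exact: (@measurable_prod_tnth _ g).
  - by move=> t; rewrite mule_ge0// lee_fin prodr_ge0.
apply: eq_integral => x _.
have mfx : measurable_fun setT (fun t => f (Defs.cons_tuple (x, t))).
  apply: measurableT_comp => //; apply: (measurableT_comp (@measurable_cons_tuple d T n)).
  exact: measurable_pair1.
rewrite (ih (fun i => P (lift ord0 i)) (fun i => Q (lift ord0 i)) (fun i => g (lift ord0 i)))//.
rewrite -ge0_integralZl//; last 3 first.
  - apply: emeasurable_funM => //; apply/measurable_EFinP.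
    exact: (@measurable_prod_tnth _ (fun i => g (lift ord0 i))).
  - by move=> t _; rewrite mule_ge0// lee_fin prodr_ge0.
  - by rewrite lee_fin.
apply: eq_integral => t _; rewrite muleA -EFinM; congr (_%:E * _)%E.
rewrite big_ord_recl; congr (_ * _).
by apply: eq_bigr => i _; rewrite tnth_cons_tupleS.
Qed.

(** In the Giry monad, pairing two kernels and taking the product of two laws are measurable maps;
    the induction on the length adds one factor at a time, and [U] is pulled back along
    [cons_tuple]. *)
Lemma measurable_tuple_prob d' (Z : measurableType d') n
    (k : 'I_n -> Z -> probability T R) :
  (forall i U, measurable U -> measurable_fun setT (fun z => k i z U)) ->
  forall U, measurable U ->
    measurable_fun setT (fun z => tuple_prob (fun i => k i z) U).
Proof.
elim: n k => [|n ih] k mk U mU; first exact: measurable_cst.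
have mU' : measurable (@Defs.cons_tuple d T n @^-1` U).
  by rewrite -[X in measurable X]setTI; exact: measurable_cons_tuple.
pose k0 (z : Z) : giry T R := k ord0 z.
pose k1 (z : Z) : giry (n.-tuple T) R := tuple_prob (fun i => k (lift ord0 i) z).
have mk01 : measurable_fun setT (fun z => (k0 z, k1 z)).
  apply: measurable_fun_pair; apply: measurable_giry_codensity => //.
    by move=> B mB; exact: mk.
  by move=> B mB; apply: ih => // i V mV; exact: mk.
have /= := measurableT_comp (measurable_giry_ev mU')
  (measurableT_comp (@measurable_giry_prod _ _ T (n.-tuple T) R) mk01).
by [].
Qed.

End tuple_prob_theory.

(** * Laws of the transcripts *)

Section mixture.
Context (R : realType) d d' (X : measurableType d) (Y : measurableType d').
Variables (P : probability X R) (k : X -> probability Y R).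

(* The measurability of [k] is an argument, so that [mixture mk] is canonically
   a probability measure. *)
Definition mixture of (forall U, measurable U ->
  measurable_fun setT (fun x => k x U)) : set Y -> \bar R :=
  fun A => (\int[P]_x k x A)%E.

Hypothesis mk : forall U, measurable U -> measurable_fun setT (fun x => k x U).

Let mixture0 : mixture mk set0 = 0%E.
Proof. by rewrite /mixture; under eq_integral do rewrite measure0; exact: integral0. Qed.

Let mixture_ge0 A : (0 <= mixture mk A)%E.
Proof. exact: integral_ge0. Qed.

Let mixture_sigma_additive : semi_sigma_additive (mixture mk).
Proof.
move=> U mU tU mUU; rewrite [X in _ --> X](_ : _ =
  \int[P]_x (\sum_(n <oo) k x (U n)))%E; last first.
  apply: eq_integral => x _.
  by apply/esym/cvg_lim => //; exact/measure_semi_sigma_additive.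
apply/cvg_closeP; split.
  by apply: is_cvg_nneseries => n _ _; exact: integral_ge0.
by rewrite closeE// integral_nneseries// => n; exact: mk.
Qed.

HB.instance Definition _ := isMeasure.Build _ _ R
  (mixture mk) mixture0 mixture_ge0 mixture_sigma_additive.

Let mixture_setT : mixture mk setT = 1%E.
Proof.
rewrite /mixture; under eq_integral do rewrite probability_setT.
exact: integral_probability_cst.
Qed.

HB.instance Definition _ :=
  Measure_isProbability.Build _ _ R (mixture mk) mixture_setT.

Lemma measurable_integral_kernel (f : Y -> \bar R) :
  measurable_fun setT f -> (forall y, 0 <= f y)%E ->
  measurable_fun setT (fun x => \int[k x]_y f y)%E.
Proof. by move=> mf f0; apply: measurable_fun_integral_kernel. Qed.

(** [mixture mk] agrees on measurable sets with the bind of the Giry monad, whose integration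
    formula then applies. *)
Lemma integral_mixture (f : Y -> \bar R) :
  measurable_fun setT f -> (forall y, 0 <= f y)%E ->
  (\int[mixture mk]_y f y = \int[P]_x \int[k x]_y f y)%E.
Proof.
move=> mf f0; pose kg (x : X) : giry Y R := k x.
have mkg : measurable_fun setT kg by exact: measurable_giry_codensity.
have := giry_int_bind (P : giry X R) mkg mf f0.
rewrite /giry_int => <-; apply: eq_measure_integral => A mA _ /=.
by rewrite giry_int_map//; exact: measurable_giry_ev.
Qed.

End mixture.

Section blocks.
Context (R : realType) d (T : measurableType d) (P : probability T R).

Lemma integral_mfun_image d' (Y : measurableType d') d2
    (X : measurableType d2) (mu : probability X R) (nu : probability Y R)
    (phi : X -> Y) (mphi : measurable_fun setT phi) (f : Y -> \bar R) :
  (forall A, measurable A -> mu (phi @^-1` A) = nu A) ->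
  measurable_fun setT f -> (forall y, 0 <= f y)%E ->
  (\int[mu]_x f (phi x) = \int[nu]_y f y)%E.
Proof.
move=> munu mf f0.
have := @ge0_integral_pushforward _ _ _ _ _ _ mphi mu setT f measurableT mf (fun y _ => f0 y).
rewrite preimage_setT => <-.
pose X' : {mfun X >-> Y} := HB.pack phi (isMeasurableFun.Build _ _ _ _ phi mphi).
by apply: (@eq_measure_integral _ _ _ _ _ (distribution mu X')) => A mA _; exact: munu.
Qed.

(** The test for independence used below: a random tuple has a product law as soon as its
    probabilities on rectangles factor. *)
Lemma image_tuple_prob n d' (X : measurableType d') (mu : probability X R)
    (Q : 'I_n -> probability T R) (phi : X -> n.-tuple T) :
  measurable_fun setT phi ->
  (forall A : 'I_n -> set T, (forall i, measurable (A i)) ->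
    (\int[mu]_x (\prod_i \1_(A i) (tnth (phi x) i))%:E =
     \prod_i Q i (A i))%E) ->
  forall A, measurable A -> mu (phi @^-1` A) = tuple_prob Q A.
Proof.
move=> mphi phiQ A mA.
pose X' : {mfun X >-> n.-tuple T} :=
  HB.pack phi (isMeasurableFun.Build _ _ _ _ phi mphi).
apply: (@eq_measure_rect _ _ _ _ (distribution mu X') (tuple_prob Q)) => // B mB.
rewrite [RHS](tuple_prob_rect Q mB) -phiQ//.
have mBr := measurable_rect mB.
have mphiB : measurable (phi @^-1` rect B).
  by rewrite -[X in measurable X]setTI; exact: (measurable_funP X').
transitivity (\int[mu]_x (\1_(phi @^-1` rect B) x)%:E)%E.
  by rewrite integral_indic ?setIT.
by apply: eq_integral => x _; rewrite -indic_rect.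
Qed.

Lemma measurable_tuple_proj n N (s : 'I_n -> 'I_N) :
  measurable_fun setT (fun z : N.-tuple T => [tuple tnth z (s i) | i < n]).
Proof.
apply/measurable_fun_tnthP => i.
rewrite (_ : _ \o _ = (fun z : N.-tuple T => tnth z (s i))).
  exact: measurable_tnth.
by apply/funext => z /=; rewrite tnth_mktuple.
Qed.

Lemma integral_tuple_proj n N (s : 'I_n -> 'I_N) (F : n.-tuple T -> \bar R) :
  injective s -> measurable_fun setT F -> (forall t, 0 <= F t)%E ->
  (\int[tuple_prob (fun=> P)]_z F [tuple tnth z (s i) | i < n] =
   \int[tuple_prob (fun=> P)]_t F t)%E.
Proof.
move=> s_inj mF F0; apply: integral_mfun_image => //.
  exact: measurable_tuple_proj.
apply: image_tuple_prob; first exact: measurable_tuple_proj.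
move=> A mA.
(* The factors are grouped by the coordinate they read; as [s] is injective, each group is a single
   indicator or the empty product. *)
pose g (k : 'I_N) x : R := \prod_(i | s i == k) \1_(A i) x.
transitivity (\int[tuple_prob (fun=> P)]_(z in setT)
    (\prod_k g k (@tnth N T z k))%:E)%E.
  apply: eq_integral => z _; congr EFin.
  rewrite (partition_big s xpredT)//=; apply: eq_bigr => k _.
  by rewrite /g; apply: eq_bigr => i /eqP <-; rewrite (tnth_mktuple (fun j => tnth z (s j))).
rewrite (@integral_tuple_prob_prod _ _ _ _ _ g); last 2 first.
  - move=> k; rewrite (_ : g k = fun x => \prod_i
        if s i == k then \1_(A i) x else 1); last first.
      by apply/funext => x; exact: big_mkcond.
    apply: measurable_prod => i _; case: (s i == k); last exact: measurable_cst.
    exact: measurable_indic.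
  - by move=> k x; apply: prodr_ge0.
rewrite [RHS](partition_big s xpredT)//=; apply: eq_bigr => k _.
rewrite /g; case: (pickP (fun i => s i == k)) => [i /eqP sik|sk]; last first.
  under eq_integral do rewrite big_pred0//.
  by rewrite big_pred0// integral_probability_cst.
have si : (fun j => s j == k) =1 pred1 i.
  by move=> j /=; rewrite -sik (inj_eq s_inj).
under eq_integral do rewrite (big_pred1 i)//.
by rewrite (big_pred1 i)// integral_indic// setIT.
Qed.

(* Reading the block of server [j] from the [j]-th of [m] independent copies of
   the whole sample does not change the law of the sample, and makes the
   independence of the blocks an instance of Fubini. *)
Definition assemble m N (s : 'I_N -> 'I_m) (Z : m.-tuple (N.-tuple T)) :
  N.-tuple T := [tuple tnth (tnth Z (s i)) i | i < N].

Lemma measurable_assemble m N (s : 'I_N -> 'I_m) :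
  measurable_fun setT (@assemble m N s).
Proof.
apply/measurable_fun_tnthP => i.
rewrite (_ : _ \o _ = (fun z : N.-tuple T => tnth z i) \o
   (fun Z : m.-tuple (N.-tuple T) => tnth Z (s i))).
  by apply: measurableT_comp; exact: measurable_tnth.
by apply/funext => z /=; rewrite tnth_mktuple.
Qed.

Lemma integral_assemble m N (s : 'I_N -> 'I_m) (F : N.-tuple T -> \bar R) :
  measurable_fun setT F -> (forall t, 0 <= F t)%E ->
  (\int[tuple_prob (fun _ : 'I_m => tuple_prob (fun _ : 'I_N => P))]_Z
     F (assemble s Z) = \int[tuple_prob (fun=> P)]_z F z)%E.
Proof.
move=> mF F0; apply: integral_mfun_image => //.
  exact: measurable_assemble.
apply: image_tuple_prob; first exact: measurable_assemble.
move=> A mA.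
(* Copy [j] contributes only through the coordinates that are read from it; its other factors are
   1. *)
pose h (j : 'I_m) (i : 'I_N) x : R := if s i == j then \1_(A i) x else 1.
pose g (j : 'I_m) (z : N.-tuple T) : R := \prod_i h j i (tnth z i).
have mh j i : measurable_fun setT (h j i).
  by rewrite /h; case: (s i == j); [exact: measurable_indic|exact: measurable_cst].
have h0 j i x : 0 <= h j i x by rewrite /h; case: (s i == j).
transitivity (\int[tuple_prob (fun _ : 'I_m => tuple_prob (fun _ : 'I_N => P))]_Z
    (\prod_j g j (tnth Z j))%:E)%E.
  apply: eq_integral => Z _; congr EFin.
  rewrite (partition_big s xpredT)//=; apply: eq_bigr => j _.
  rewrite big_mkcond /g; apply: eq_bigr => i _.
  by rewrite /h; case: eqP => // <-; rewrite tnth_mktuple.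
rewrite (@integral_tuple_prob_prod _ _ _ _ _ g); last 2 first.
  - by move=> j; exact: measurable_prod_tnth.
  - by move=> j z; exact: prodr_ge0.
rewrite [RHS](partition_big s xpredT)//=; apply: eq_bigr => j _.
rewrite integral_tuple_prob_prod// [RHS]big_mkcond; apply: eq_bigr => i _.
rewrite /h; case: (s i == j); last by rewrite integral_probability_cst.
by rewrite integral_indic// setIT.
Qed.

Lemma integral_blocks m N (n : 'I_m -> nat) (s : 'I_N -> 'I_m)
    (r : forall j, 'I_(n j) -> 'I_N) (G : forall j, (n j).-tuple T -> R) :
  (forall j, injective (r j)) -> (forall j i, s (r j i) = j) ->
  (forall j, measurable_fun setT (G j)) -> (forall j t, 0 <= G j t) ->
  (\int[tuple_prob (fun _ : 'I_N => P)]_z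
     (\prod_j G j [tuple tnth z (r j i) | i < n j])%:E =
   \prod_j \int[tuple_prob (fun _ : 'I_(n j) => P)]_t (G j t)%:E)%E.
Proof.
move=> r_inj sr mG G0.
pose g j (z : N.-tuple T) := G j [tuple tnth z (r j i) | i < n j].
have mg j : measurable_fun setT (g j).
  exact: measurableT_comp (mG j) (@measurable_tuple_proj _ _ (r j)).
rewrite -(@integral_assemble m N s (fun z => (\prod_j g j z)%:E)); last 2 first.
  - by apply/measurable_EFinP; exact: measurable_prod.
  - by move=> t; rewrite lee_fin prodr_ge0// => j _; exact: G0.
transitivity (\int[tuple_prob (fun _ : 'I_m => tuple_prob (fun _ : 'I_N => P))]_Z
    (\prod_j g j (tnth Z j))%:E)%E.
  apply: eq_integral => Z _; congr EFin; apply: eq_bigr => j _.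
  rewrite /g; congr (G j _); apply: eq_from_tnth => i.
  by rewrite !tnth_mktuple sr.
rewrite (@integral_tuple_prob_prod _ _ _ _ _ g)//; last by move=> j z; exact: G0.
apply: eq_bigr => j _.
apply: (@integral_tuple_proj _ _ (r j) (fun t => (G j t)%:E)) => //.
- by apply/measurable_EFinP; exact: mG.
- by move=> t; rewrite lee_fin; exact: G0.
Qed.

End blocks.

Section transcripts.
Context (R : realType) (m : nat) (n : 'I_m -> nat) (Pi : protocol R n).
Context (f : {mfun measurableTypeR R >-> measurableTypeR R}).
Local Notation T := (prot_space Pi).
Local Notation mech := (prot_mech Pi).

Lemma measurable_kernel_law j U : measurable U ->
  measurable_fun setT (fun z => kernel_law (mech j) z U).
Proof. by move=> mU; exact: measurable_kernel. Qed.

Definition server_law j : probability T R :=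
  mixture (data_law f (n j)) (@measurable_kernel_law j).

(** Servers read disjoint blocks of an i.i.d. sample, so conditional independence of the transcripts
    given the data becomes plain independence after averaging over the data. Both sides are laws on
    tuples and are compared on rectangles, where [integral_blocks] applies. *)
Lemma integral_transcripts (L : m.-tuple T -> \bar R) :
  measurable_fun setT L -> (forall t, 0 <= L t)%E ->
  (\int[data_law f (total_size n)]_z \int[transcript_law Pi z]_t L t =
   \int[tuple_prob server_law]_t L t)%E.
Proof.
move=> mL L0.
have mserver j : measurable_fun setT
    (fun z : (total_size n).-tuple (obs R) => server_data z j).
  exact: (@measurable_tuple_proj _ _ _ _ (fun i => tagnat.Rank j i)).
have mk j U : measurable U -> measurable_fun setT
    (fun z : (total_size n).-tuple (obs R) =>
       kernel_law (mech j) (server_data z j) U).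
  move=> mU; apply: (measurableT_comp (@measurable_kernel_law j U mU)).
  exact: mserver.
have mtl : forall U, measurable U -> measurable_fun setT
   (fun z => transcript_law Pi z U).
  exact: (@measurable_tuple_prob _ _ _ _ _ _
    (fun j z => kernel_law (mech j) (server_data z j)) mk).
rewrite -(integral_mixture _ mtl)//.
apply: eq_measure_integral => U mU _.
apply: (@eq_measure_rect _ _ _ _ (mixture (data_law f (total_size n)) mtl)
  (tuple_prob server_law)) => // A mA.
rewrite [RHS](tuple_prob_rect server_law mA).
pose G j z : R := fine (kernel_law (mech j) z (A j)).
have GE j z : kernel_law (mech j) z (A j) = (G j z)%:E.
  by rewrite fineK// fin_num_measure.
have /= := @integral_blocks _ _ _ (obs_law f) m (total_size n) n
   (@tagnat.sig1 _ n) (@tagnat.Rank _ n) G.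
move=> Gint; rewrite [RHS](_ : _ =
    (\prod_j \int[data_law f (n j)]_t (G j t)%:E)%E); last first.
  by apply: eq_bigr => j _; apply: eq_integral => z _; exact: GE.
rewrite -Gint.
- apply: eq_integral => z _; rewrite -prodEFin.
  have /= -> := tuple_prob_rect (fun j => kernel_law (mech j) (server_data z j)) mA.
  by apply: eq_bigr => j _; exact: GE.
- move=> j i i' /(congr1 val)/eqP.
  by rewrite tagnat.eq_Rank eqxx => /eqP/val_inj.
- by move=> j i; exact: tagnat.Rank1K.
- move=> j; apply: measurableT_comp => //; exact: measurable_kernel_law.
- by move=> j t; exact: fine_ge0.
Qed.

End transcripts.

(** * Comparison of two product laws through a private mechanism *)

Section integrable_real.
Context (R : realType) d (T : measurableType d).
Variable mu : {measure set T -> \bar R}.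
Implicit Types f g : T -> R.

Lemma integrable_EFinD f g : mu.-integrable setT (EFin \o f) ->
  mu.-integrable setT (EFin \o g) ->
  mu.-integrable setT (EFin \o (fun x => f x + g x)).
Proof. by move=> fi gi; exact: (integrableD measurableT fi gi). Qed.

Lemma integrable_EFinB f g : mu.-integrable setT (EFin \o f) ->
  mu.-integrable setT (EFin \o g) ->
  mu.-integrable setT (EFin \o (fun x => f x - g x)).
Proof. by move=> fi gi; exact: (integrableB measurableT fi gi). Qed.

Lemma integrable_EFinZl k f : mu.-integrable setT (EFin \o f) ->
  mu.-integrable setT (EFin \o (fun x => k * f x)).
Proof. by move=> fi; exact: (integrableZl measurableT k fi). Qed.

Lemma integrable_EFinZr k f : mu.-integrable setT (EFin \o f) ->
  mu.-integrable setT (EFin \o (fun x => f x * k)).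
Proof. by move=> fi; exact: (integrableZr measurableT k fi). Qed.

End integrable_real.

Section probability_integrals.
Context (R : realType) d (T : measurableType d) (P : probability T R).

Lemma integrable_bounded_fun (f : T -> R) (c : R) :
  measurable_fun setT f -> (forall x, `|f x| <= c) ->
  P.-integrable setT (EFin \o f).
Proof.
move=> mf fc; apply: measurable_bounded_integrable => //.
  by rewrite (le_lt_trans (probability_le1 P measurableT))// ltry.
exists c; split; first exact: num_real.
by move=> M cM x _; rewrite /= (le_trans (fc x))// ltW.
Qed.

Lemma Rintegral_probability_cst (c : R) : \int[P]_x c = c.
Proof. by rewrite /Rintegral integral_probability_cst. Qed.

Lemma EFin_Rintegral (f : T -> R) : P.-integrable setT (EFin \o f) ->
  (\int[P]_x f x)%:E = (\int[P]_x (f x)%:E)%E.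
Proof. by move=> fi; rewrite /Rintegral fineK//; exact: integrable_fin_num. Qed.

Lemma Rintegral_bounds (f : T -> R) (c : R) :
  measurable_fun setT f -> (forall x, 0 <= f x <= c) ->
  0 <= \int[P]_x f x <= c.
Proof.
move=> mf fc; rewrite Rintegral_ge0/=; last by move=> x _; case/andP: (fc x).
rewrite -[leRHS]Rintegral_probability_cst; apply: le_Rintegral => //.
- apply: (@integrable_bounded_fun _ c) => // x; case/andP: (fc x) => f0 fxc.
  by rewrite ger0_norm.
- exact: (@integrable_bounded_fun _ `|c|).
- by move=> x _; case/andP: (fc x).
Qed.

End probability_integrals.

(** Layer-cake formula: [w] is the superposition of the events that it exceeds [r]. Each level costs
    [delta], and only levels up to [c] count, whence [delta * c]. *)
Lemma approx_dominated_integral (R : realType) d (T : measurableType d)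
    (P Q : probability T R) (e delta c : R) (w : T -> R) :
  0 <= e -> 0 <= delta -> 0 <= c ->
  (forall A, measurable A -> P A <= e%:E * Q A + delta%:E)%E ->
  measurable_fun setT w -> (forall x, 0 <= w x <= c) ->
  \int[P]_x w x <= e * \int[Q]_x w x + delta * c.
Proof.
move=> e0 d0 c0 PQ mw wc.
pose X : {mfun T >-> R} := HB.pack w (isMeasurableFun.Build _ _ _ _ w mw).
have wi (P' : probability T R) : P'.-integrable setT (EFin \o w) by
  apply: (@integrable_bounded_fun _ _ _ P' _ c) => // x;
  case/andP: (wc x) => w0 wxc; rewrite ger0_norm.
have w0 x : 0 <= X x by case/andP: (wc x).
rewrite -lee_fin EFinD EFinM !EFin_Rintegral//.
have := ge0_expectation_ccdf (P := P) w0; rewrite unlock => ->.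
have := ge0_expectation_ccdf (P := Q) w0; rewrite unlock => ->.
have mccdf (P' : probability T R) : measurable_fun (`[0, +oo[ : set R) (ccdf (P := P') X).
  by apply: measurable_funTS; exact: ccdf_measurable.
have ccdf0 (P' : probability T R) r : (0 <= ccdf (P := P') X r)%E by exact: measure_ge0.
have mi : measurable_fun (`[0, +oo[ : set R) (fun r => (delta * \1_(`[0, c] : set R) r)%:E).
  apply/measurable_funTS/measurable_EFinP; apply: measurable_funM => //.
have -> : (delta * c)%:E = (\int[lebesgue_measure]_(r in `[0%R, +oo[)
    (delta * \1_(`[0, c] : set R) r)%:E)%E.
  under eq_integral do rewrite EFinM.
  rewrite ge0_integralZl//; last exact/measurable_EFinP/measurable_funTS.
  rewrite integral_indic//= setIidl//; last first.
    by move=> r /=; rewrite !in_itv/= => /andP[->].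
  by rewrite lebesgue_measure_itv/= lte_fin; case: ltrgtP c0 => // [c0|<-] _;
    rewrite ?sube0// EFinM oppr0 adde0.
apply: (@le_trans _ _ (\int[lebesgue_measure]_(r in `[0%R, +oo[)
    (e%:E * ccdf (P := Q) X r + (delta * \1_(`[0, c] : set R) r)%:E))%E);
    last first.
  rewrite ge0_integralD//; last 3 first.
  - by move=> r _; rewrite mule_ge0// lee_fin.
  - exact: (measurable_funeM _ (mccdf Q)).
  - by move=> r _; rewrite lee_fin mulr_ge0.
  by rewrite ge0_integralZl//; exact: (mccdf Q).
apply: ge0_le_integral => //.
- exact: (mccdf P).
- apply: emeasurable_funD; last exact: mi.
  exact: (measurable_funeM _ (mccdf Q)).
move=> r /=; rewrite in_itv/= andbT => r0.
have [rc|cr] := leP r c.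
  rewrite indicE mem_set ?mulr1/=; last by rewrite in_itv/= r0.
  apply: PQ; rewrite -[X in measurable X]setTI; exact: (measurable_funP X).
rewrite [leLHS](_ : _ = 0%E); last first.
  rewrite /ccdf /distribution /pushforward [X in P X](_ : _ = set0) ?measure0//.
  apply/seteqP; split => // x /=; rewrite in_itv/= andbT => rx.
  by case/andP: (wc x) => _; rewrite leNgt (lt_trans cr).
by rewrite adde_ge0 ?lee_fin ?mulr_ge0// mule_ge0.
Qed.

Section slot.
Context (R : realType) d (X : measurableType d).
Variables (P Q : probability X R) (l : X -> R) (tau : R).
Hypotheses (ml : measurable_fun setT l) (l0 : forall x, 0 <= l x).
Hypothesis PQ : is_density P Q l.
Hypothesis l_tau : (\int[P]_x `|l x - 1|%:E <= tau%:E)%E.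

Lemma Rintegral_density (f : X -> R) (c : R) : measurable_fun setT f ->
  (forall x, 0 <= f x <= c) ->
  P.-integrable setT (EFin \o (fun x => l x * f x)) /\
  \int[Q]_x f x = \int[P]_x (l x * f x).
Proof.
move=> mf fc.
have f0 x : 0 <= f x by case/andP: (fc x).
have QP : (\int[Q]_x (f x)%:E = \int[P]_x (l x * f x)%:E)%E.
  rewrite PQ; first by apply: eq_integral => x _; rewrite EFinM.
    exact/measurable_EFinP.
  by move=> x; rewrite lee_fin.
split; last by rewrite /Rintegral QP.
apply/integrableP; split; first by apply/measurable_EFinP; exact: measurable_funM.
rewrite (_ : (fun x => _) = (fun x => (l x * f x)%:E)); last first.
  by apply/funext => x; rewrite /= ger0_norm// mulr_ge0.
rewrite -QP; have /integrableP[_] : Q.-integrable setT (EFin \o f).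
  apply: (@integrable_bounded_fun _ _ _ Q _ c) => // x.
  by rewrite ger0_norm; case/andP: (fc x).
by rewrite (eq_integral (EFin \o f))// => x _; rewrite /= ger0_norm.
Qed.

Lemma integrable_likelihood : P.-integrable setT (EFin \o l).
Proof.
have [+ _] := @Rintegral_density (cst 1) 1 (measurable_cst _)
  (fun x => ltac:(by rewrite /= ler01 lexx)).
by apply: eq_integrable => // x _ /=; rewrite mulr1.
Qed.

Lemma integrable_likelihoodB : P.-integrable setT (EFin \o (fun x => l x - 1)).
Proof.
apply: (integrable_EFinB integrable_likelihood).
exact: (@integrable_bounded_fun _ _ _ P (cst 1) `|1|).
Qed.

Lemma Rintegral_likelihood : \int[P]_x l x = 1.
Proof.
have [_] := @Rintegral_density (cst 1) 1 (measurable_cst _)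
  (fun x => ltac:(by rewrite /= ler01 lexx)).
rewrite Rintegral_probability_cst => ->.
by apply: eq_Rintegral => x _; rewrite /= mulr1.
Qed.

(** As [l - 1] has mean zero, the difference is the integral of [(l - 1) * (H - Hb)], where [Hb] is
    the mean of [H]. Averaging the hypothesis over one of its two arguments keeps [H] within
    [(e - 1) * Hb + delta] of [Hb], and [tau] bounds the L1 norm of [l - 1]. *)
Lemma slot_comparison (H : X -> R) (c e delta : R) :
  1 <= e -> 0 <= delta -> 
  measurable_fun setT H -> (forall x, 0 <= H x <= c) ->
  (forall x x', H x <= e * H x' + delta) ->
  `|\int[Q]_x H x - \int[P]_x H x| <=
    tau * ((e - 1) * \int[P]_x H x + delta).
Proof.
move=> e1 d0 mH Hc He; set Hb := \int[P]_x H x.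
have Hi : P.-integrable setT (EFin \o H).
  apply: (@integrable_bounded_fun _ _ _ P _ c) => // x.
  by rewrite ger0_norm; case/andP: (Hc x).
have [lHi ->] := Rintegral_density mH Hc.
have Hb0 : 0 <= Hb by apply: Rintegral_ge0 => x _; case/andP: (Hc x).
have ci k : P.-integrable setT (EFin \o cst k).
  exact: (@integrable_bounded_fun _ _ _ P (cst k) `|k|).
have upper x : H x <= e * Hb + delta.
  rewrite -[leLHS](Rintegral_probability_cst P).
  have -> : e * Hb + delta = \int[P]_x' (e * H x' + delta).
    rewrite RintegralD//; [|exact: (integrable_EFinZl e Hi)|exact: ci].
    by rewrite RintegralZl// Rintegral_probability_cst.
  apply: le_Rintegral => //; first exact: ci.
  apply: integrable_EFinD; first exact: (integrable_EFinZl e Hi).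
  exact: ci.
have lower x : Hb <= e * H x + delta.
  rewrite -[leRHS](Rintegral_probability_cst P).
  by apply: le_Rintegral => //; exact: ci.
have HHb x : `|H x - Hb| <= (e - 1) * Hb + delta.
  rewrite ler_norml; apply/andP; split; last by have := upper x; lra.
  have := lower x; have : 0 <= H x by case/andP: (Hc x).
  move=> Hx0 low.
  (* Multiplied by [e], the lower bound follows from [low] up to exactly this nonnegative
     quantity. *)
  have : 0 <= (e - 1) * (e - 1) * Hb + (e - 1) * delta.
    by rewrite addr_ge0// mulr_ge0//; [rewrite -expr2 sqr_ge0|lra].
  rewrite -subr_ge0 => ?; rewrite -subr_ge0.
  rewrite -(pmulr_rge0 _ (_ : 0 < e)); last by lra.
  nra.
have -> : \int[P]_x (l x * H x) - Hb = \int[P]_x ((l x - 1) * (H x - Hb)).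
  have -> : \int[P]_x ((l x - 1) * (H x - Hb)) =
      \int[P]_x ((l x * H x - H x) - Hb * (l x - 1)).
    by apply: eq_Rintegral => x _; ring.
  rewrite RintegralB//; last 2 first.
    - exact: (integrable_EFinB lHi).
    - exact: (integrable_EFinZl Hb integrable_likelihoodB).
  rewrite RintegralB// RintegralZl//; last exact: integrable_likelihoodB.
  rewrite RintegralB//; [|exact: integrable_likelihood|exact: ci].
  by rewrite Rintegral_likelihood Rintegral_probability_cst subrr mulr0 subr0.
set B := (e - 1) * Hb + delta in HHb *.
have B0 : 0 <= B by rewrite addr_ge0// mulr_ge0// subr_ge0.
have mlH : measurable_fun setT (fun x => (l x - 1) * (H x - Hb)).
  by apply: measurable_funM; apply: measurable_funB.
have bi : P.-integrable setT (EFin \o (fun x => `|l x - 1| * B)).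
  exact: (integrable_EFinZr B (integrable_norm integrable_likelihoodB)).
have i1 : P.-integrable setT (EFin \o (fun x => (l x - 1) * (H x - Hb))).
  apply: le_integrable bi => //; first exact/measurable_EFinP.
  move=> x _; rewrite /= lee_fin normrM normrM normr_id (ger0_norm B0).
  by rewrite ler_wpM2l.
rewrite (le_trans (le_normr_Rintegral _ i1))//.
apply: (@le_trans _ _ (\int[P]_x (`|l x - 1| * B))).
  apply: le_Rintegral => //; first exact: integrable_norm.
  by move=> x _; rewrite normrM ler_wpM2l.
rewrite RintegralZr//; last exact: (integrable_norm integrable_likelihoodB).
rewrite ler_wpM2r// -lee_fin EFin_Rintegral//.
exact: (integrable_norm integrable_likelihoodB).
Qed.

End slot.

Section tuple_cons_Rintegral.
Context (R : realType) d (T : measurableType d) (n : nat).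
Variables (P : probability T R) (G : n.+1.-tuple T -> R) (c : R).
Hypotheses (mG : measurable_fun setT G) (Gc : forall z, 0 <= G z <= c).

Lemma measurable_cons_tuple_l (t : n.-tuple T) :
  measurable_fun setT (fun x => Defs.cons_tuple (x, t)).
Proof.
by apply: (measurableT_comp (@measurable_cons_tuple d T n)); exact: measurable_pair2.
Qed.

Lemma measurable_Rintegral_cons :
  measurable_fun setT (fun t : n.-tuple T => \int[P]_x G (Defs.cons_tuple (x, t))).
Proof.
apply: measurableT_comp => //.
pose f (z : T * n.-tuple T) := (G (Defs.cons_tuple z))%:E.
have mf : measurable_fun setT f.
  apply/measurable_EFinP.
  exact: (measurableT_comp mG (@measurable_cons_tuple d T n)).
apply: (measurable_fun_fubini_tonelli_G f mf) => z.
by rewrite lee_fin; case/andP: (Gc (Defs.cons_tuple z)).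
Qed.

Lemma Rintegral_tuple_cons (Q : 'I_n.+1 -> probability T R) : Q ord0 = P ->
  \int[tuple_prob Q]_z G z =
  \int[tuple_prob (fun i => Q (lift ord0 i))]_t
    \int[P]_x G (Defs.cons_tuple (x, t)).
Proof.
move=> <-; congr fine; rewrite integral_tuple_prob_cons_swap.
- apply: eq_integral => t _; rewrite EFin_Rintegral//.
  apply: (@integrable_bounded_fun _ _ _ _ _ c) => [|x].
    exact: (measurableT_comp mG (measurable_cons_tuple_l t)).
  by rewrite ger0_norm; case/andP: (Gc (Defs.cons_tuple (x, t))).
- exact/measurable_EFinP.
- by move=> t; rewrite lee_fin; case/andP: (Gc t).
Qed.

End tuple_cons_Rintegral.

Section tuple_comparison.
Context (R : realType) d (X : measurableType d).
Variables (P Q : probability X R) (l : X -> R) (tau : R).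
Hypotheses (ml : measurable_fun setT l) (l0 : forall x, 0 <= l x).
Hypothesis PQ : is_density P Q l.
Hypothesis l_tau : (\int[P]_x `|l x - 1|%:E <= tau%:E)%E.

(** Approximate privacy for a real statistic of the data. Since [z] and [z'] can be exchanged, it
    gives both an upper and a lower bound. *)
Definition one_change n (G : n.-tuple X -> R) (e delta : R) :=
  forall i z z', (forall j, j != i -> tnth z j = tnth z' j) ->
    G z <= e * G z' + delta.

(** Hybrid argument: the first observation is averaged out under [P] ([G1]) or [Q] ([G2]), the
    induction hypothesis handles [G1], and [slot_comparison] handles the exchange of [G1] and [G2].
    The cost of an exchange involves the mean [b] of a hybrid law; the smallness condition keeps it
    comparable to the mean under [P], and the factor 2 pays for this. *)
Lemma tuple_comparison n (G : n.-tuple X -> R) (c e delta : R) :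
  1 <= e -> 0 <= delta -> measurable_fun setT G ->
  (forall z, 0 <= G z <= c) -> one_change G e delta ->
  n%:R * (tau * (e - 1)) <= 2^-1 ->
  `|\int[tuple_prob (fun=> Q)]_z G z - \int[tuple_prob (fun=> P)]_z G z| <=
    n%:R * (2 * (tau * ((e - 1) * \int[tuple_prob (fun=> P)]_z G z + delta))).
Proof.
move=> e1 d0; have tau0 : 0 <= tau.
  by rewrite -lee_fin (le_trans _ l_tau)// integral_ge0.
elim: n G => [|n ih] G mG Gc Gdp nle; set a := \int[tuple_prob (fun=> P)]_z G z.
  by rewrite subrr normr0 mul0r.
pose G1 t := \int[P]_x G (Defs.cons_tuple (x, t)).
pose G2 t := \int[Q]_x G (Defs.cons_tuple (x, t)).
have mGx t : measurable_fun setT (fun x => G (Defs.cons_tuple (x, t))).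
  exact: (measurableT_comp mG (measurable_cons_tuple_l t)).
have iGx t (P' : probability X R) :
    P'.-integrable setT (EFin \o (fun x => G (Defs.cons_tuple (x, t)))).
  apply: (@integrable_bounded_fun _ _ _ _ _ c) => // x.
  by rewrite ger0_norm; case/andP: (Gc (Defs.cons_tuple (x, t))).
have G1c t : 0 <= G1 t <= c by apply: Rintegral_bounds => // x.
have G2c t : 0 <= G2 t <= c by apply: Rintegral_bounds => // x.
have mG1 : measurable_fun setT G1 by exact: measurable_Rintegral_cons Gc.
have mG2 : measurable_fun setT G2 by exact: measurable_Rintegral_cons Gc.
have G1dp : one_change G1 e delta.
  move=> i t t' tt'; rewrite /G1 -RintegralZl//; last exact: iGx.
  rewrite -[X in _ <= _ + X](Rintegral_probability_cst P).
  have ci : P.-integrable setT (EFin \o cst delta).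
    exact: (@integrable_bounded_fun _ _ _ P (cst delta) `|delta|).
  have i2 := integrable_EFinZl e (iGx t' P).
  rewrite -(RintegralD measurableT i2 ci).
  apply: (le_Rintegral measurableT (iGx t P) (integrable_EFinD i2 ci)) => x _.
  apply: (Gdp (lift ord0 i)) => j ji.
  case: (unliftP ord0 j) ji => [k|] -> ji; last by [].
  rewrite !tnth_cons_tupleS; apply: tt'.
  by apply: contra_neq ji => ->.
have G12 t : `|G2 t - G1 t| <= tau * ((e - 1) * G1 t + delta).
  apply: (slot_comparison ml l0 PQ l_tau) => // x x'; apply: (Gdp ord0) => j j0.
  by case: (unliftP ord0 j) j0 => [k|] -> //; rewrite !tnth_cons_tupleS.
pose b := \int[tuple_prob (fun _ : 'I_n => Q)]_t G1 t.
have bE : \int[tuple_prob (fun=> Q)]_z G z = \int[tuple_prob (fun=> Q)]_t G2 t.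
  by rewrite (Rintegral_tuple_cons (P := Q) mG Gc).
have aE' : a = \int[tuple_prob (fun=> P)]_t G1 t.
  by rewrite /a (Rintegral_tuple_cons (P := P) mG Gc).
have nle' : n%:R * (tau * (e - 1)) <= 2^-1.
  apply: le_trans nle; rewrite ler_wpM2r ?ler_nat//.
  by rewrite mulr_ge0// subr_ge0.
have := ih G1 mG1 G1c G1dp nle'; rewrite -aE' -/b => ba.
have iG (G' : n.-tuple X -> R) : measurable_fun setT G' -> (forall z, 0 <= G' z <= c) ->
    (tuple_prob (fun _ : 'I_n => Q)).-integrable setT (EFin \o G').
  move=> mG' G'c; apply: (@integrable_bounded_fun _ _ _ _ _ c) => // z.
  by rewrite ger0_norm; case/andP: (G'c z).
pose Qn : probability _ R := tuple_prob (fun _ : 'I_n => Q).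
set E := \int[tuple_prob _]_z G z in bE *.
have i12 := integrable_EFinB (iG _ mG2 G2c) (iG _ mG1 G1c).
have b'b : `|E - b| <= tau * ((e - 1) * b + delta).
  rewrite bE /b -RintegralB//; [|exact: iG|exact: iG].
  rewrite (le_trans (le_normr_Rintegral _ i12))//.
  have ci k : Qn.-integrable setT (EFin \o cst k).
    exact: (@integrable_bounded_fun _ _ _ Qn (cst k) `|k|).
  rewrite -RintegralZl//; last exact: iG.
  rewrite -[X in _ <= _ * (_ + X)](Rintegral_probability_cst Qn).
  have i2 := integrable_EFinZl (e - 1) (iG _ mG1 G1c).
  rewrite -(RintegralD measurableT i2 (ci delta)).
  have i3 := integrable_EFinD (integrable_EFinZl (e - 1) (iG _ mG1 G1c)) (ci delta).
  rewrite -(RintegralZl tau measurableT i3).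
  have i4 := integrable_EFinZl tau i3.
  apply: (le_Rintegral measurableT (integrable_norm i12) i4) => t _; exact: G12.
move: ba b'b nle nle'; set u := tau * ((e - 1) * a + delta).
set eta := tau * (e - 1) => ba b'b nle nle'.
have eta0 : 0 <= eta by rewrite mulr_ge0// subr_ge0.
have a0 : 0 <= a by apply: Rintegral_ge0 => z _; case/andP: (Gc z).
have u0 : 0 <= u by rewrite mulr_ge0// addr_ge0// mulr_ge0// subr_ge0.
have uE : u = eta * a + tau * delta by rewrite /u /eta; ring.
have b'b2 : `|E - b| <= eta * b + tau * delta.
  by apply: (le_trans b'b); rewrite /eta le_eqVlt; apply/orP; left; apply/eqP; ring.
have ble : b <= a + n%:R * (2 * u).
  by have := ler_normlW ba; rewrite lerBlDl.
(* The mean [b] exceeds [a] by at most [n%:R * (2 * u)], and [n%:R * eta <= 2^-1] makes the effect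
   of this excess at most [u]. *)
have step : eta * b + tau * delta <= 2 * u.
  apply: (@le_trans _ _ (eta * (a + n%:R * (2 * u)) + tau * delta)).
    by rewrite lerD2r ler_wpM2l.
  have -> : eta * (a + n%:R * (2 * u)) + tau * delta =
      u + 2 * (n%:R * eta) * u by rewrite uE; ring.
  have : 2 * (n%:R * eta) * u <= 1 * u by rewrite ler_wpM2r//; lra.
  lra.
have -> : E - a = (E - b) + (b - a) by ring.
rewrite (le_trans (ler_normD _ _))// -natr1 mulrDl mul1r addrC lerD//.
exact: le_trans b'b2 step.
Qed.

End tuple_comparison.

(** * Moments of the likelihood ratio *)

Section power_expansion.
Context (R : realFieldType).
Implicit Types x y h b : R.

Lemma mix_pow_le (u v : R) (k i : nat) : 0 <= u -> 0 <= v ->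
  u ^+ k * v ^+ i <= u ^+ (k + i) + v ^+ (k + i).
Proof.
move=> u0 v0; rewrite !exprD; have [uv|/ltW vu] := leP u v.
  by rewrite ler_wpDl ?mulr_ge0 ?exprn_ge0// ler_wpM2r ?exprn_ge0// lerXn2r.
by rewrite ler_wpDr ?mulr_ge0 ?exprn_ge0// ler_wpM2l ?exprn_ge0// lerXn2r.
Qed.

(** Every binomial term beyond the linear one carries [y ^+ 2] times a monomial of degree [r], which
    [mix_pow_le] bounds by the two pure powers; the binomial coefficients sum to [2 ^+ r.+2]. *)
Lemma expr_taylor2_le (r : nat) x y : ~~ odd r ->
  (x + y) ^+ r.+2 <= x ^+ r.+2 + r.+2%:R * x ^+ r.+1 * y +
    2 ^+ r.+2 * (x ^+ r * y ^+ 2 + y ^+ r.+2).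
Proof.
move=> odr; rewrite exprDn big_ord_recl big_ord_recl /=.
rewrite /bump /= !subn0 bin0 mulr1n expr0 mulr1 -addrA lerD2l subn1/= bin1 expr1.
rewrite -[_ *+ _]mulr_natl mulrA lerD2l.
have ev (z : R) k : ~~ odd k -> z ^+ k = `|z| ^+ k.
  by move=> odk; rewrite -normrX ger0_norm// exprn_even_ge0.
(* The remainder is spread over all [r.+3] binomial coefficients, so that the comparison is termwise
   and the two terms in excess are dropped by positivity. *)
have -> : (2 : R) ^+ r.+2 * (x ^+ r * y ^+ 2 + y ^+ r.+2) =
    \sum_(i < r.+3) (`|x| ^+ r * `|y| ^+ 2 + `|y| ^+ r.+2) *+ 'C(r.+2, i).
  rewrite sumrMnr; have -> : (\sum_(i < r.+3) 'C(r.+2, i) = 2 ^ r.+2)%N.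
    rewrite -[2%N]/((1 + 1)%N) expnDn; apply: eq_bigr => i _.
    by rewrite !exp1n !muln1.
  rewrite -[RHS]mulr_natl natrX (ev x)// (ev y 2%N)// (ev y r.+2)//=.
  by rewrite negbK.
rewrite [leRHS]big_ord_recl [in leRHS]big_ord_recl /=.
apply: ler_wpDl.
  by rewrite mulrn_wge0// addr_ge0// ?mulr_ge0// exprn_ge0.
apply: ler_wpDl.
  by rewrite mulrn_wge0// addr_ge0// ?mulr_ge0// exprn_ge0.
apply: ler_sum => i _; rewrite !lerMn2r; apply/orP; right.
rewrite /bump /= !add1n subSS subSS.
rewrite (le_trans (ler_norm _))// normrM !normrX.
have ir : (i <= r)%N by rewrite -ltnS.
rewrite -(addn2 i) -(addn2 r) !exprD mulrA -mulrDl ler_wpM2r ?exprn_ge0//.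
have := mix_pow_le (r - i) i (normr_ge0 x) (normr_ge0 y).
by rewrite subnK.
Qed.

(* One more observation turns the likelihood ratio [1 + x] into
   [(1 + x) * (1 + h)]. The term linear in [h] has mean zero; when [b] bounds the
   size of [h], the last factor has mean of order [E h^2], and integrating gives
   a Gronwall recursion for the moments of [x]. *)
Lemma likelihood_step_le (r : nat) x h b : ~~ odd r -> 0 < b <= 1 ->
  (x + (1 + x) * h) ^+ r.+2 <=
  x ^+ r.+2 + r.+2%:R * x ^+ r.+1 * (1 + x) * h +
    4 ^+ r.+2 / b ^+ 2 * (x ^+ r.+2 + b ^+ r.+2) *
    (h ^+ 2 + b ^+ 2 * (h / b) ^+ r.+2).
Proof.
move=> odr /andP[b0 b1].
have od2 : ~~ odd r.+2 by rewrite /= negbK.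
apply: (le_trans (expr_taylor2_le _ _ odr)).
rewrite [_ * ((1 + x) * h)]mulrA lerD2l.
have xr0 k (z : R) : ~~ odd k -> 0 <= z ^+ k by exact: exprn_even_ge0.
have b2 : 0 < b ^+ 2 by rewrite exprn_gt0.
have b21 : b ^+ 2 <= 1 by rewrite exprn_ile1// ltW.
have br0 k : 0 <= b ^+ k by rewrite exprn_ge0// ltW.
(* One factor [2 ^+ r.+2] is that of the expansion, the other pays for the powers of [1 + x]. *)
have -> : (4 : R) ^+ r.+2 = 2 ^+ r.+2 * 2 ^+ r.+2.
  by rewrite -exprMn; congr (_ ^+ _); ring.
rewrite -(mulrA (2 ^+ r.+2) (2 ^+ r.+2)) -(mulrA (2 ^+ r.+2)) -(mulrA (2 ^+ r.+2)).
rewrite ler_wpM2l ?exprn_ge0//.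
set S := x ^+ r.+2 + b ^+ r.+2.
have S0 : 0 <= S by rewrite addr_ge0// xr0.
have t4 : (4 : R) <= 2 ^+ r.+2.
  rewrite !exprS mulrA -[leLHS]mulr1; apply: ler_pM => //; first by lra.
  by rewrite exprn_ege1//; lra.
have p1 : x ^+ r * ((1 + x) * h) ^+ 2 <= 2 ^+ r.+2 * ((b ^+ 2)^-1 * (S * h ^+ 2)).
  have q1 : (1 + x) ^+ 2 <= 2 * (1 + x ^+ 2).
    by have := sqr_ge0 (x - 1); rewrite !expr2; lra.
  have q2 : x ^+ r * b ^+ 2 <= S.
    have := mix_pow_le r 2 (normr_ge0 x) (ltW b0).
    rewrite addn2 -!normrX (ger0_norm (xr0 r x odr)) (ger0_norm (xr0 r.+2 x od2)).
    exact.
  have q3 : x ^+ r * x ^+ 2 * b ^+ 2 <= S.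
    rewrite -exprD addn2 ler_wpDr// ler_piMr// xr0//.
  have q4 : x ^+ r * (1 + x) ^+ 2 <= 2 ^+ r.+2 * ((b ^+ 2)^-1 * S).
    rewrite -(ler_pM2r b2).
    have -> : 2 ^+ r.+2 * ((b ^+ 2)^-1 * S) * b ^+ 2 = 2 ^+ r.+2 * S.
      by field; rewrite gt_eqF.
    apply: (@le_trans _ _ (4 * S)); last by rewrite ler_wpM2r.
    apply: (@le_trans _ _ (x ^+ r * (2 * (1 + x ^+ 2)) * b ^+ 2)).
      by rewrite ler_wpM2r ?(ltW b2)// ler_wpM2l// xr0.
    have -> : x ^+ r * (2 * (1 + x ^+ 2)) * b ^+ 2 =
      2 * (x ^+ r * b ^+ 2) + 2 * (x ^+ r * x ^+ 2 * b ^+ 2) by ring.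
    by move: q2 q3; lra.
  rewrite exprMn (mulrA (x ^+ r)) (mulrA (b ^+ 2)^-1) (mulrA (2 ^+ r.+2)).
  by rewrite ler_wpM2r ?sqr_ge0.
have p2 : ((1 + x) * h) ^+ r.+2 <=
    2 ^+ r.+2 * ((b ^+ 2)^-1 * (S * (b ^+ 2 * (h / b) ^+ r.+2))).
  have -> : 2 ^+ r.+2 * ((b ^+ 2)^-1 * (S * (b ^+ 2 * (h / b) ^+ r.+2))) =
      2 ^+ r.+2 * S / b ^+ r.+2 * h ^+ r.+2.
    rewrite exprMn exprVn; field.
    by rewrite !gt_eqF// exprn_gt0.
  rewrite exprMn ler_wpM2r ?xr0// ler_pdivlMr ?exprn_gt0//.
  have q5 : (1 + x) ^+ r.+2 <= 2 ^+ r.+2 * (1 + x ^+ r.+2).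
    rewrite -[leLHS](ger0_norm (xr0 r.+2 _ od2)) normrX.
    apply: (@le_trans _ _ ((1 + `|x|) ^+ r.+2)).
      by rewrite lerXn2r ?nnegrE// ?addr_ge0// (le_trans (ler_normD _ _))// normr1.
    have [x1|/ltW x1] := leP `|x| 1.
      apply: (@le_trans _ _ (2 ^+ r.+2 * 1)).
        by rewrite mulr1 lerXn2r ?nnegrE ?addr_ge0//; lra.
      by rewrite ler_wpM2l ?exprn_ge0// ler_wpDr// xr0.
    apply: (@le_trans _ _ (2 ^+ r.+2 * x ^+ r.+2)).
      rewrite -[x ^+ r.+2](ger0_norm (xr0 r.+2 _ od2)) normrX -exprMn.
      by rewrite lerXn2r ?nnegrE ?addr_ge0 ?mulr_ge0//; lra.
    by rewrite ler_wpM2l ?exprn_ge0// ler_wpDl.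
  apply: (@le_trans _ _ (2 ^+ r.+2 * (1 + x ^+ r.+2) * b ^+ r.+2)).
    by rewrite ler_wpM2r.
  rewrite -mulrA ler_wpM2l ?exprn_ge0// mulrDl mul1r addrC lerD2r.
  by rewrite ler_piMr ?xr0// exprn_ile1// ltW.
rewrite mulrDr (le_trans (lerD p1 p2))//.
by rewrite -!(mulrA (2 ^+ r.+2)) -!(mulrA (b ^+ 2)^-1).
Qed.

End power_expansion.

Section likelihood_moments.
Context (R : realType) d (X : measurableType d).
Variables (P Q : probability X R) (l : X -> R) (kap b : R) (r : nat).
Hypotheses (ml : measurable_fun setT l) (l0 : forall x, 0 <= l x).
Hypothesis PQ : is_density P Q l.
Hypotheses (odr : ~~ odd r) (b01 : 0 < b <= 1) (kap0 : 0 <= kap).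
Hypothesis kapP : (\int[P]_x
  ((l x - 1) ^+ 2 + b ^+ 2 * ((l x - 1) / b) ^+ r.+2)%:E <= kap%:E)%E.

Let theta := 4 ^+ r.+2 / b ^+ 2 * kap.

Lemma even_pow_ge0 (x : R) : 0 <= x ^+ r.+2.
Proof. by rewrite exprn_even_ge0//= negbK. Qed.

(** [L] is the likelihood ratio of the other observations, held fixed. The linear term of
    [likelihood_step_le] integrates to zero because [l - 1] has mean zero. *)
Lemma likelihood_moments_slot (L : R) :
  (\int[P]_x ((l x * L - 1) ^+ r.+2)%:E <=
   ((L - 1) ^+ r.+2 + theta * ((L - 1) ^+ r.+2 + b ^+ r.+2))%:E)%E.
Proof.
set x0 := L - 1.
pose k x := (l x - 1) ^+ 2 + b ^+ 2 * ((l x - 1) / b) ^+ r.+2.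
have mk : measurable_fun setT k.
  apply: measurable_funD; first by apply: measurable_funX; exact: measurable_funB.
  apply: measurable_funM => //; apply: measurable_funX; apply: measurable_funM => //.
  exact: measurable_funB.
have k0 x : 0 <= k x.
  by rewrite addr_ge0 ?sqr_ge0// mulr_ge0 ?sqr_ge0 ?even_pow_ge0.
have ki : P.-integrable setT (EFin \o k).
  apply/integrableP; split; first exact/measurable_EFinP.
  rewrite (eq_integral (EFin \o k)); last by move=> x _; rewrite /= ger0_norm.
  by rewrite (le_lt_trans kapP)// ltry.
pose c1 := r.+2%:R * x0 ^+ r.+1 * (1 + x0).
pose c2 := 4 ^+ r.+2 / b ^+ 2 * (x0 ^+ r.+2 + b ^+ r.+2).
pose U x := x0 ^+ r.+2 + (c1 * (l x - 1) + c2 * k x).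
have hi := integrable_likelihoodB ml l0 PQ.
have ci : P.-integrable setT (EFin \o cst (x0 ^+ r.+2)).
  exact: (@integrable_bounded_fun _ _ _ P (cst (x0 ^+ r.+2)) `|x0 ^+ r.+2|).
have i12 := integrable_EFinD (integrable_EFinZl c1 hi) (integrable_EFinZl c2 ki).
have Ui : P.-integrable setT (EFin \o U) := integrable_EFinD ci i12.
apply: (@le_trans _ _ (\int[P]_x (U x)%:E)%E).
  apply: ge0_le_integral => //.
  - by move=> x _; rewrite lee_fin even_pow_ge0.
  - apply/measurable_EFinP; apply: measurable_funX; apply: measurable_funB => //.
    exact: measurable_funM.
  - exact: (measurable_int _ Ui).
  move=> x _; rewrite lee_fin.
  have -> : l x * L - 1 = x0 + (1 + x0) * (l x - 1) by rewrite /x0; ring.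
  apply: (le_trans (likelihood_step_le _ _ odr b01)).
  by rewrite -[leLHS]addrA; exact: lexx.
rewrite -EFin_Rintegral// lee_fin /U.
rewrite (RintegralD measurableT ci i12) Rintegral_probability_cst lerD2l.
rewrite (RintegralD measurableT (integrable_EFinZl c1 hi) (integrable_EFinZl c2 ki)).
rewrite (RintegralZl c1 measurableT hi) (RintegralZl c2 measurableT ki).
have -> : \int[P]_x (l x - 1) = 0.
  have c1i : P.-integrable setT (EFin \o cst 1).
    exact: (@integrable_bounded_fun _ _ _ P (cst 1) `|1|).
  rewrite (RintegralB measurableT (integrable_likelihood ml l0 PQ) c1i).
  by rewrite (Rintegral_likelihood ml l0 PQ) Rintegral_probability_cst subrr.
rewrite mulr0 add0r; have kE : \int[P]_x k x <= kap.
  by rewrite -lee_fin EFin_Rintegral.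
have b0 : 0 < b by case/andP: b01.
apply: (@le_trans _ _ (c2 * kap)).
  rewrite ler_wpM2l// /c2; apply: mulr_ge0.
    by rewrite divr_ge0 ?sqr_ge0// exprn_ge0.
  by apply: addr_ge0; exact: even_pow_ge0.
by rewrite /c2 /theta le_eqVlt; apply/orP; left; apply/eqP; ring.
Qed.

Definition likelihood n (z : n.-tuple X) : R := \prod_i l (tnth z i).

Lemma measurable_likelihood n : measurable_fun setT (@likelihood n).
Proof. exact: (@measurable_prod_tnth _ _ _ _ (fun=> l)). Qed.

Lemma likelihood_ge0 n (z : n.-tuple X) : 0 <= likelihood z.
Proof. by apply: prodr_ge0 => i _. Qed.

(** The recursion is m' <= (1 + theta) m + theta b^(r+2), started at 0, and the right-hand side is
    its exact solution. *)
Lemma likelihood_moments n :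
  (\int[tuple_prob (fun _ : 'I_n => P)]_z ((likelihood z - 1) ^+ r.+2)%:E <=
   (b ^+ r.+2 * ((1 + theta) ^+ n - 1))%:E)%E.
Proof.
have b0 : 0 < b by case/andP: b01.
have theta0 : 0 <= theta.
  by rewrite mulr_ge0// divr_ge0 ?sqr_ge0// exprn_ge0.
elim: n => [|n ih].
  rewrite expr0 subrr mulr0.
  rewrite (eq_integral (fun=> 0%E)) ?integral0// => z _.
  by rewrite /likelihood big_ord0 subrr expr0n.
have mL k : measurable_fun setT (fun z : k.-tuple X => ((likelihood z - 1) ^+ r.+2)%:E).
  apply/measurable_EFinP; apply: measurable_funX; apply: measurable_funB => //.
  exact: measurable_likelihood.
rewrite integral_tuple_prob_cons_swap//; last first.
  by move=> t; rewrite lee_fin even_pow_ge0.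
pose Pn : probability _ R := tuple_prob (fun _ : 'I_n => P).
pose F (t : n.-tuple X) := (likelihood t - 1) ^+ r.+2.
have F0 t : 0 <= F t by exact: even_pow_ge0.
apply: (@le_trans _ _ (\int[Pn]_t ((1 + theta)%:E * (F t)%:E + (theta * b ^+ r.+2)%:E))%E).
  apply: ge0_le_integral => //.
  - by move=> t _; apply: integral_ge0 => x _; rewrite lee_fin even_pow_ge0.
  - have mc : measurable_fun setT (fun z : X * n.-tuple X =>
        ((likelihood (Defs.cons_tuple z) - 1) ^+ r.+2)%:E).
      exact: (measurableT_comp (mL n.+1) (@measurable_cons_tuple d X n)).
    apply: (measurable_fun_fubini_tonelli_G _ mc) => z.
    by rewrite lee_fin even_pow_ge0.
  - by apply: emeasurable_funD => //; apply: measurable_funeM; exact: mL.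
  move=> t _.
  rewrite (eq_integral (fun x => ((l x * likelihood t - 1) ^+ r.+2)%:E)).
    apply: (le_trans (likelihood_moments_slot _)).
    by rewrite -EFinM -EFinD lee_fin /F; lra.
  move=> x _; congr ((_ - 1) ^+ r.+2)%:E.
  rewrite /likelihood big_ord_recl; congr (_ * _).
  by apply: eq_bigr => i _; rewrite tnth_cons_tupleS.
have tb0 : 0 <= theta * b ^+ r.+2 by rewrite mulr_ge0// even_pow_ge0.
rewrite ge0_integralD//; last 2 first.
  - by move=> t _; rewrite mule_ge0 ?lee_fin// addr_ge0.
  - by apply: measurable_funeM; exact: mL.
rewrite integral_probability_cst ge0_integralZl//; last 2 first.
  - by move=> t _; rewrite lee_fin.
  - by rewrite lee_fin addr_ge0.
apply: (@le_trans _ _ ((1 + theta)%:E * (b ^+ r.+2 * ((1 + theta) ^+ n - 1))%:E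
    + (theta * b ^+ r.+2)%:E)%E).
  by rewrite leeD2r// lee_wpmul2l// lee_fin addr_ge0.
by rewrite -EFinM -EFinD lee_fin (exprS _ n) le_eqVlt; apply/orP; left; apply/eqP; ring.
exact: mL.
Qed.

End likelihood_moments.

Lemma measurable_sqrt (R : realType) :
  measurable_fun [set: R] (@Num.sqrt R).
Proof. by apply: continuous_measurable_fun; exact: sqrt_continuous. Qed.

(** * Hellinger affinity of the transcript laws *)

Section young.
Context (R : realFieldType).

(** Young's inequality with exponents m + 1 and (m + 1) / m, cleared of denominators. In the
    induction, the gap at one rank is [a] times the previous gap plus a multiple of
    [(a - b) ^+ 2]. *)
Lemma young_pow_ge0 (a b : R) (m : nat) : 0 <= a -> 0 <= b ->
  m.+1%:R * a * b ^+ m <= a ^+ m.+1 + m%:R * b ^+ m.+1.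
Proof.
move=> a0 b0; elim: m => [|m ih]; first by rewrite expr0 !mul0r addr0 mul1r mulr1 expr1.
rewrite -subr_ge0; rewrite -subr_ge0 in ih.
have -> : a ^+ m.+2 + m.+1%:R * b ^+ m.+2 - m.+2%:R * a * b ^+ m.+1 =
  a * (a ^+ m.+1 + m%:R * b ^+ m.+1 - m.+1%:R * a * b ^+ m) +
  m.+1%:R * b ^+ m * (a - b) ^+ 2.
  by rewrite !exprS expr0 -!natr1; ring.
by rewrite addr_ge0// mulr_ge0 ?sqr_ge0 ?mulr_ge0// exprn_ge0.
Qed.

Lemma young_pow (x w : R) (r : nat) : ~~ odd r ->
  r.+2%:R * (x * w ^+ r.+1) <= x ^+ r.+2 + r.+1%:R * w ^+ r.+2.
Proof.
move=> odr; have ev (z : R) : z ^+ r.+2 = `|z| ^+ r.+2.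
  by rewrite -normrX ger0_norm// exprn_even_ge0//= negbK.
rewrite (ev x) (ev w); apply: le_trans (young_pow_ge0 r.+1 (normr_ge0 x) (normr_ge0 w)).
by rewrite -mulrA ler_wpM2l// -normrX -normrM ler_norm.
Qed.

End young.

Section radon_nikodym_mixture.
Context (R : realType) d d' (X : measurableType d) (Y : measurableType d').
Variables (P Q : probability X R) (L : X -> R) (k : X -> probability Y R).
Hypotheses (mL : measurable_fun setT L) (L0 : forall x, 0 <= L x).
Hypothesis PQ : is_density P Q L.
Hypothesis mk : forall U, measurable U -> measurable_fun setT (fun x => k x U).

Lemma mixture_density : exists phi : Y -> R,
  [/\ measurable_fun setT phi, forall y, 0 <= phi y &
      is_density (mixture P mk) (mixture Q mk) phi].
Proof.
have dom : mixture Q mk `<< mixture P mk.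
  apply/null_content_dominatesP => A mA PA0.
  rewrite /= /mixture PQ//; last exact: mk.
  rewrite (_ : 0%E = \int[P]_x (cst 0 x))%E; last by rewrite integral0.
  apply: ge0_ae_eq_integral => //.
  - by apply: emeasurable_funM; [exact/measurable_EFinP|exact: mk].
  - by move=> x _; rewrite mule_ge0// lee_fin.
  have : ae_eq P setT (fun x => k x A) (cst 0%E).
    apply/(ae_eq_integral_abs _ measurableT (mk mA)).
    by under eq_integral do rewrite gee0_abs//.
  by apply: filterS => x /= + _ => ->; rewrite ?mule0.
pose phi := Radon_Nikodym_SigmaFinite.f (mixture Q mk) (mixture P mk).
have phiE y : phi y = (fine (phi y))%:E.
  by rewrite fineK//; exact: Radon_Nikodym_SigmaFinite.f_fin_num.
have mphi : measurable_fun setT phi.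
  exact: (measurable_int _ (Radon_Nikodym_SigmaFinite.f_integrable dom)).
exists (fun y => fine (phi y)); split.
- exact: measurableT_comp.
- by move=> y; apply: fine_ge0; exact: Radon_Nikodym_SigmaFinite.f_ge0.
- move=> f mf f0.
  rewrite -(Radon_Nikodym_SigmaFinite.change_of_variables dom)//.
  by apply: eq_integral => y _; rewrite -phiE muleC.
Qed.

Lemma Rintegral_mixture (f : Y -> R) (c : R) :
  measurable_fun setT f -> (forall y, `|f y| <= c) ->
  [/\ measurable_fun setT (fun x => \int[k x]_y f y),
      forall x, `|\int[k x]_y f y| <= c &
  \int[mixture P mk]_y f y = \int[P]_x \int[k x]_y f y].
Proof.
move=> mf fc.
have c0 : 0 <= c by rewrite (le_trans _ (fc point)).
(* The integration formula for mixtures is for nonnegative functions; a bounded [f] is shifted by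
   its bound. *)
pose F y := f y + c.
have F0 y : 0 <= F y by have := fc y; rewrite ler_norml /F => /andP[]; lra.
have F2c y : 0 <= F y <= 2 * c.
  by rewrite F0/=; have := fc y; rewrite ler_norml /F => /andP[]; lra.
have mF : measurable_fun setT F by exact: measurable_funD.
have ifm (mu : probability Y R) : mu.-integrable setT (EFin \o f).
  exact: integrable_bounded_fun.
have ci d2 (Z : measurableType d2) (mu : probability Z R) (a : R) :
    mu.-integrable setT (EFin \o cst a).
  exact: (@integrable_bounded_fun _ _ _ mu (cst a) `|a|).
have FE (mu : probability Y R) : \int[mu]_y F y = \int[mu]_y f y + c.
  by rewrite (RintegralD measurableT (ifm mu) (ci _ _ mu c)) Rintegral_probability_cst.
have mIF : measurable_fun setT (fun x => \int[k x]_y F y).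
  apply: measurableT_comp => //; apply: measurable_integral_kernel => //.
  exact/measurable_EFinP.
have mIf : measurable_fun setT (fun x => \int[k x]_y f y).
  rewrite (_ : (fun x => _) = (fun x => \int[k x]_y F y - c)); last first.
    by apply/funext => x; rewrite FE addrK.
  exact: measurable_funB.
have Ifc x : `|\int[k x]_y f y| <= c.
  have := Rintegral_bounds (k x) mF F2c; rewrite FE ler_norml => /andP[]; lra.
split => //.
have IFi : P.-integrable setT (EFin \o (fun x => \int[k x]_y f y)).
  exact: (@integrable_bounded_fun _ _ _ P _ c).
suff : \int[mixture P mk]_y F y = \int[P]_x \int[k x]_y F y.
  rewrite FE => /(canRL (addrK c)) ->; rewrite (_ : \int[P]_x _ =
    \int[P]_x (\int[k x]_y f y + c)); last by apply: eq_Rintegral => x _; exact: FE.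
  by rewrite (RintegralD measurableT IFi (ci _ _ P c)) Rintegral_probability_cst addrK.
congr fine; rewrite integral_mixture//.
- apply: eq_integral => x _; rewrite EFin_Rintegral//.
  exact: (integrable_EFinD (ifm _) (ci _ _ _ c)).
- exact/measurable_EFinP.
Qed.

End radon_nikodym_mixture.

Section affinity.
Context (R : realType) d (T : measurableType d).
Variables (mu nu : probability T R) (phi : T -> R).
Hypotheses (mphi : measurable_fun setT phi) (phi0 : forall t, 0 <= phi t).
Hypothesis munu : is_density mu nu phi.

Let iphi := integrable_likelihood mphi phi0 munu.

Let ci (a : R) : mu.-integrable setT (EFin \o cst a).
Proof. exact: (@integrable_bounded_fun _ _ _ mu (cst a) `|a|). Qed.

(** Turns an integral against [phi - 1] into a difference of expectations of a bounded statistic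
    under the two transcript laws, the only quantity that privacy controls. *)
Lemma Rintegral_excess (f : T -> R) (c : R) : measurable_fun setT f ->
  (forall t, `|f t| <= c) ->
  mu.-integrable setT (EFin \o (fun t => (phi t - 1) * f t)) /\
  \int[mu]_t ((phi t - 1) * f t) = \int[nu]_t f t - \int[mu]_t f t.
Proof.
move=> mf fc.
pose F y := f y + c.
have F2c y : 0 <= F y <= 2 * c.
  by have := fc y; rewrite ler_norml /F => /andP[]; lra.
have mF : measurable_fun setT F by exact: measurable_funD.
have ifm (m : probability T R) : m.-integrable setT (EFin \o f).
  exact: integrable_bounded_fun.
have cim (m : probability T R) : m.-integrable setT (EFin \o cst c).
  exact: (@integrable_bounded_fun _ _ _ m (cst c) `|c|).
have FE (m : probability T R) : \int[m]_y F y = \int[m]_y f y + c.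
  by rewrite (RintegralD measurableT (ifm m) (cim m)) Rintegral_probability_cst.
have [iF nuF] := Rintegral_density mphi phi0 munu mF F2c.
have ic := integrable_EFinZl c iphi.
have i1 := integrable_EFinB (integrable_EFinB iF ic) (ifm mu).
have E : (fun t => phi t * F t - c * phi t - f t) = (fun t => (phi t - 1) * f t).
  by apply/funext => t; rewrite /F; ring.
rewrite -E; split => //.
rewrite (RintegralB measurableT (integrable_EFinB iF ic) (ifm mu)).
rewrite (RintegralB measurableT iF ic) (RintegralZl c measurableT iphi).
by rewrite (Rintegral_likelihood mphi phi0 munu) -nuF FE; ring.
Qed.

Definition clip (c x : R) : R := Num.max (- c) (Num.min c x).

Lemma clip_norm c x : 0 <= c -> `|clip c x| <= c.
Proof. by move=> c0; rewrite /clip ler_norml le_max lexx/= ge_max ge_min lexx/= andbT; lra. Qed.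

Lemma clip_sub_ge0 c x : 0 <= c -> 0 <= (x - clip c x) * clip c x.
Proof.
move=> c0; rewrite /clip; have [xc|/ltW cx] := leP x c.
  have [cx|/ltW xc'] := leP (- c) x; first by rewrite subrr mul0r.
  by rewrite -mulrNN mulr_ge0; lra.
by rewrite (max_idPr _); [rewrite mulr_ge0; lra|lra].
Qed.

(* What lies below the level [c] will be controlled by privacy and the rest by a
   high moment, at the price of [c^-r]. *)
Lemma clip_split (c x : R) (r : nat) : ~~ odd r -> 0 < c <= 1 ->
  x * clip 1 x <= x * clip c x + (c ^+ r)^-1 * (x * clip 1 x ^+ r.+1).
Proof.
move=> odr /andP[c0 c1].
have xc_ge0 a : 0 <= a -> 0 <= x * clip a x.
  move=> a0; have := clip_sub_ge0 x a0; rewrite mulrBl subr_ge0; apply: le_trans.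
  by rewrite -expr2 sqr_ge0.
have y0 := xc_ge0 1 ler01; have yc := xc_ge0 c (ltW c0).
have yr : x * clip 1 x ^+ r.+1 = x * clip 1 x * clip 1 x ^+ r.
  by rewrite exprS mulrA.
have cr : 0 < c ^+ r by rewrite exprn_gt0.
have yr0 : 0 <= clip 1 x ^+ r by rewrite exprn_even_ge0.
have [xc|xc] := leP `|x| c.
  have clipE a : c <= a -> clip a x = x.
    move: xc; rewrite ler_norml => /andP[x1 x2] ca.
    by rewrite /clip (min_idPr _) ?(max_idPr _)//; lra.
  rewrite !clipE// lerDl mulr_ge0 ?invr_ge0 ?(ltW cr)//.
  by rewrite -exprS exprn_even_ge0//= negbK.
apply: ler_wpDl => //; rewrite yr mulrCA ler_peMr// mulrC ler_pdivlMr// mul1r.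
have -> : clip 1 x ^+ r = `|clip 1 x| ^+ r by rewrite -normrX ger0_norm.
rewrite lerXn2r ?nnegrE ?(ltW c0)//.
rewrite /clip; have [x1|/ltW x1] := leP 1 x.
  by rewrite (max_idPr _) ?normr1//; lra.
have [x2|/ltW x2] := leP (- 1) x; first exact: ltW.
by rewrite normrN1.
Qed.

Lemma measurable_clip c : measurable_fun setT (fun t => clip c (phi t - 1)).
Proof.
apply: measurable_maxr; first exact: measurable_cst.
by apply: measurable_minr; [exact: measurable_cst|exact: measurable_funB].
Qed.

Let g t := phi t - 1.
Let V := \int[mu]_t (g t * clip 1 (g t)).

(** With s the square root of [x], for [x <= 2] the gap is (s - 1)^2 ((s + 1)^2 - 1) / 2. For
    [x >= 2] the clipped correction cancels the linear term and the left-hand side is 1. *)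
Lemma sqrt_lower (x : R) : 0 <= x ->
  1 + 2^-1 * (x - 1) - 2^-1 * ((x - 1) * clip 1 (x - 1)) <= Num.sqrt x.
Proof.
move=> x0; rewrite /clip; set s := Num.sqrt x.
have s0 : 0 <= s by exact: sqrtr_ge0.
have xE : x = s ^+ 2 by rewrite sqr_sqrtr.
have -> : Num.max (- 1) (Num.min 1 (x - 1)) = Num.min 1 (x - 1).
  by apply/max_idPr; rewrite le_min; lra.
have [x1|x1] := leP 1 (x - 1).
  rewrite mulr1; have : 1 <= s by rewrite -sqrtr1 ler_wsqrtr//; lra.
  lra.
have : 0 <= (s - 1) ^+ 2 * ((s + 1) ^+ 2 - 1).
  rewrite mulr_ge0 ?sqr_ge0//; have -> : (s + 1) ^+ 2 - 1 = s * (s + 2) by ring.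
  by rewrite mulr_ge0//; lra.
by rewrite xE !expr2; nra.
Qed.

Lemma affinity_ge : 1 - 2^-1 * V <= \int[mu]_t Num.sqrt (phi t).
Proof.
have [iV _] := Rintegral_excess (measurable_clip 1) (fun t => clip_norm _ ler01).
have igg : mu.-integrable setT (EFin \o g) := integrable_EFinB iphi (ci 1).
have i2 := integrable_EFinB (integrable_EFinD (ci 1) (integrable_EFinZl 2^-1 igg))
  (integrable_EFinZl 2^-1 iV).
have isq : mu.-integrable setT (EFin \o (fun t => Num.sqrt (phi t))).
  apply: (le_integrable measurableT _ _ (integrable_EFinD (ci 1) iphi)).
    apply/measurable_EFinP; apply: (measurableT_comp _ mphi).
    exact: measurable_sqrt.
  move=> t _ /=; rewrite lee_fin ger0_norm ?sqrtr_ge0// ger0_norm ?addr_ge0//.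
  have s0 := sqrtr_ge0 (phi t); rewrite -[in leRHS](sqr_sqrtr (phi0 t)) expr2.
  by have := sqr_ge0 (Num.sqrt (phi t) - 2^-1); rewrite expr2; lra.
apply: le_trans (le_Rintegral measurableT i2 isq _); last first.
  by move=> t _; exact: sqrt_lower.
rewrite (RintegralB measurableT (integrable_EFinD (ci 1) (integrable_EFinZl 2^-1 igg))
  (integrable_EFinZl 2^-1 iV)) (RintegralD measurableT (ci 1) (integrable_EFinZl 2^-1 igg)).
rewrite !(RintegralZl _ measurableT)// Rintegral_probability_cst.
rewrite (RintegralB measurableT iphi (ci 1)) (Rintegral_likelihood mphi phi0 munu).
by rewrite Rintegral_probability_cst subrr mulr0 addr0.
Qed.

Section moment_bound.
Variables (r : nat) (M : R).
Hypothesis odr : ~~ odd r.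
Hypothesis H2 : forall w : T -> R, measurable_fun setT w ->
  (forall t, `|w t| <= 1) ->
  r.+2%:R * (\int[nu]_t w t ^+ r.+1 - \int[mu]_t w t ^+ r.+1) <=
  M + r.+1%:R * \int[mu]_t w t ^+ r.+2.

(** Take [w = clip 1 (phi - 1)] in [H2]. Since [w ^+ 2 <= (phi - 1) * w], the integral on the right
    of [H2] is at most the one to be bounded, and [r.+1] of its [r.+2] copies are absorbed. *)
Lemma excess_moment_le :
  \int[mu]_t (g t * clip 1 (g t) ^+ r.+1) <= M.
Proof.
have wc t := clip_norm (g t) ler01.
have mw := measurable_clip 1.
have wpow k t : `|clip 1 (g t) ^+ k| <= 1 by rewrite normrX exprn_ile1.
have [i1 E1] := Rintegral_excess (measurable_funX r.+1 mw) (wpow r.+1).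
have := H2 mw wc; rewrite -E1 => H.
have i2 : mu.-integrable setT (EFin \o (fun t => clip 1 (g t) ^+ r.+2)).
  exact: (@integrable_bounded_fun _ _ _ mu _ 1 (measurable_funX r.+2 mw) (wpow r.+2)).
have : \int[mu]_t clip 1 (g t) ^+ r.+2 <= \int[mu]_t (g t * clip 1 (g t) ^+ r.+1).
  apply: (le_Rintegral measurableT i2 i1) => t _.
  rewrite [in leLHS]exprS (exprS _ r) !mulrA ler_wpM2r ?exprn_even_ge0//.
  by rewrite -subr_ge0 -mulrBl clip_sub_ge0.
move=> le1; have n0 : 0 < r.+2%:R :> R by rewrite ltr0n.
move: H; set v := \int[mu]_t (_ * _) in le1 *; set u := \int[mu]_t _ in le1 *.
move=> H; have : r.+1%:R * u <= r.+1%:R * v by rewrite ler_wpM2l.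
by move: H; rewrite -(natr1 r.+1); lra.
Qed.

End moment_bound.

(** Self-bounding estimate: the part below [c] is at most [eta] times the mean of
    [|clip c (phi - 1)|], plus [2 * kap], and that mean is in turn controlled by the part being
    bounded. When [c = 1], clipping at [c] is clipping at 1 and there is no tail. *)
Lemma excess_le_clip (c eta kap M : R) (r : nat) : ~~ odd r -> 0 < c <= 1 ->
  0 <= eta ->
  (forall w : T -> R, measurable_fun setT w -> (forall t, 0 <= w t <= c) ->
    `|\int[nu]_t w t - \int[mu]_t w t| <= eta * \int[mu]_t w t + kap) ->
  (c < 1 -> \int[mu]_t (g t * clip 1 (g t) ^+ r.+1) <= M) ->
  V <= eta ^+ 2 + 4 * kap + (if c < 1 then M / c ^+ r else 0).
Proof.
move=> odr /andP[c0 c1] eta0 H1 HM.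
have mc := measurable_clip c.
have cle0 : 0 <= c by exact: ltW.
(* Positive and negative parts of the clipped excess, as the comparison hypothesis is for functions
   with values in [[0, c]]. *)
pose gp t := Num.max 0 (clip c (g t)); pose gm t := Num.max 0 (- clip c (g t)).
have cc t := clip_norm (g t) cle0.
have mgp : measurable_fun setT gp by exact: measurable_maxr.
have mgm : measurable_fun setT gm.
  by apply: measurable_maxr; [exact: measurable_cst|exact: measurableT_comp].
have gpc t : 0 <= gp t <= c.
  have := cc t; rewrite ler_norml => /andP[h1 h2].
  by rewrite /gp le_max lexx ge_max cle0.
have gmc t : 0 <= gm t <= c.
  have := cc t; rewrite ler_norml => /andP[h1 h2].
  by rewrite /gm le_max lexx ge_max cle0/=; lra.
have gpm t : gp t - gm t = clip c (g t) /\ gp t + gm t = `|clip c (g t)|.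
  rewrite /gp /gm; set u := clip c (g t); have [h|/ltW h] := leP 0 u.
    have -> : Num.max 0 (- u) = 0 by apply/max_idPl; rewrite oppr_le0.
    by rewrite subr0 addr0 ger0_norm.
  have -> : Num.max 0 (- u) = - u by apply/max_idPr; rewrite oppr_ge0.
  by rewrite add0r sub0r opprK ler0_norm.
have Hp := H1 _ mgp gpc; have Hm := H1 _ mgm gmc.
have ip (m : probability T R) : m.-integrable setT (EFin \o gp).
  apply: (@integrable_bounded_fun _ _ _ m _ c) => // t.
  by rewrite ger0_norm; case/andP: (gpc t).
have im (m : probability T R) : m.-integrable setT (EFin \o gm).
  apply: (@integrable_bounded_fun _ _ _ m _ c) => // t.
  by rewrite ger0_norm; case/andP: (gmc t).
have [i1 E1] := Rintegral_excess mc cc.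
set V1 := \int[mu]_t _ in E1.
have E2 (m : probability T R) : \int[m]_t clip c (phi t - 1) = \int[m]_t gp t - \int[m]_t gm t.
  rewrite -(RintegralB measurableT (ip m) (im m)).
  by apply: eq_Rintegral => t _; case: (gpm t).
have iabs : mu.-integrable setT (EFin \o (fun t => `|clip c (g t)|)).
  apply: (@integrable_bounded_fun _ _ _ mu _ c) => [|t]; first exact: measurableT_comp.
  by rewrite normr_id.
have E3 : \int[mu]_t gp t + \int[mu]_t gm t = \int[mu]_t `|clip c (g t)|.
  rewrite -(RintegralD measurableT (ip mu) (im mu)).
  by apply: eq_Rintegral => t _; case: (gpm t).
have V1a : V1 <= eta * \int[mu]_t `|clip c (g t)| + 2 * kap.
  rewrite E1 !E2 -E3; rewrite distrC in Hm.
  by move: (ler_normlW Hp) (ler_normlW Hm); lra.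
(* Arithmetic-geometric mean inequality followed by [clip c g ^+ 2 <= g * clip c g]; half of [V1] is
   then absorbed in [V1le]. *)
have V1b : eta * \int[mu]_t `|clip c (g t)| <= 2^-1 * eta ^+ 2 + 2^-1 * V1.
  rewrite -(RintegralZl eta measurableT iabs).
  rewrite -(Rintegral_probability_cst mu (2^-1 * eta ^+ 2)).
  rewrite /V1 -(RintegralZl 2^-1 measurableT i1).
  rewrite -(RintegralD measurableT (ci _) (integrable_EFinZl 2^-1 i1)).
  apply: (le_Rintegral measurableT (integrable_EFinZl eta iabs)
    (integrable_EFinD (ci _) (integrable_EFinZl 2^-1 i1))) => t _.
  rewrite -[X in _ <= X + _]/(2^-1 * eta ^+ 2).
  have : `|clip c (g t)| ^+ 2 <= g t * clip c (g t).
    by rewrite real_normK ?num_real// expr2 -subr_ge0 -mulrBl clip_sub_ge0.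
  have := sqr_ge0 (eta - `|clip c (g t)|); rewrite sqrrB /g.
  set a := `|_|; set u := (phi t - 1) * _; rewrite !expr2; lra.
have V1le : V1 <= eta ^+ 2 + 4 * kap by lra.
have [c_lt1|c_ge1] := ltP c 1; last first.
  have -> : V = V1.
    by apply: eq_Rintegral => t _; rewrite (_ : c = 1)//; lra.
  by rewrite addr0.
apply: (@le_trans _ _ (V1 + (c ^+ r)^-1 * \int[mu]_t (g t * clip 1 (g t) ^+ r.+1))); last first.
  by rewrite lerD// mulrC ler_wpM2r ?invr_ge0 ?exprn_ge0// HM.
have wpow t : `|clip 1 (g t) ^+ r.+1| <= 1.
  by rewrite normrX exprn_ile1// clip_norm.
have [i2 _] := Rintegral_excess (measurable_funX r.+1 (measurable_clip 1)) wpow.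
have [iV _] := Rintegral_excess (measurable_clip 1) (fun t => clip_norm _ ler01).
rewrite -(RintegralZl _ measurableT i2).
rewrite -(RintegralD measurableT i1 (integrable_EFinZl _ i2)).
apply: (le_Rintegral measurableT iV (integrable_EFinD i1 (integrable_EFinZl _ i2))) => t _.
by apply: clip_split => //; rewrite c0.
Qed.

End affinity.

(** * Affinity of the transcript laws of one server *)

Section server.
Context (R : realType) d d' (X : measurableType d) (Y : measurableType d').
Context (n : nat) (P Q : probability X R) (l : X -> R).
Hypotheses (ml : measurable_fun setT l) (l0 : forall x, 0 <= l x).
Hypothesis PQ : is_density P Q l.
Variable k : n.-tuple X -> probability Y R.
Hypothesis mk : forall U, measurable U -> measurable_fun setT (fun z => k z U).

Let Pn : probability _ R := tuple_prob (fun _ : 'I_n => P).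
Let Qn : probability _ R := tuple_prob (fun _ : 'I_n => Q).
Let mu : probability Y R := mixture Pn mk.
Let nu : probability Y R := mixture Qn mk.
Let L := @likelihood R d X l n.
Let mL : measurable_fun setT L .
Proof. exact: measurable_likelihood. Qed.
Let L0 : forall z, 0 <= L z .
Proof. by move=> z; exact: likelihood_ge0. Qed.

Let PQn : is_density Pn Qn L.
Proof. exact: (@tuple_prob_density _ _ _ n _ _ (fun=> l)). Qed.

Lemma server_density : exists phi : Y -> R,
  [/\ measurable_fun setT phi, forall y, 0 <= phi y & is_density mu nu phi].
Proof. exact: (mixture_density mL L0 PQn mk). Qed.

Section private.
Variables (tau e delta : R).
Hypothesis l_tau : (\int[P]_x `|l x - 1|%:E <= tau%:E)%E.
Hypotheses (e1 : 1 <= e) (delta0 : 0 <= delta).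
Hypothesis kDP : forall i z z', (forall j, j != i -> tnth z j = tnth z' j) ->
  forall A, measurable A -> (k z A <= e%:E * k z' A + delta%:E)%E.
Hypothesis small : n%:R * (tau * (e - 1)) <= 2^-1.

Lemma server_approx (c : R) (w : Y -> R) : 0 <= c -> measurable_fun setT w ->
  (forall y, 0 <= w y <= c) ->
  `|\int[nu]_y w y - \int[mu]_y w y| <=
  2 * (n%:R * (tau * (e - 1))) * \int[mu]_y w y + 2 * n%:R * tau * delta * c.
Proof.
move=> c0 mw wc.
have wc' y : `|w y| <= c by case/andP: (wc y) => w0 wyc; rewrite ger0_norm.
have [mG Gc muE] := Rintegral_mixture Pn mk mw wc'.
have [_ _ nuE] := Rintegral_mixture Qn mk mw wc'.
have G0 z : 0 <= \int[k z]_y w y <= c by exact: Rintegral_bounds.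
have Gdp : one_change (fun z => \int[k z]_y w y) e (delta * c).
  move=> i z z' zz'; apply: approx_dominated_integral => //.
    by rewrite (le_trans _ e1).
  exact: kDP zz'.
have dc0 : 0 <= delta * c by exact: mulr_ge0.
have := tuple_comparison ml l0 PQ l_tau e1 dc0 mG G0 Gdp small.
rewrite -/Pn -/Qn -muE -nuE -/mu -/nu => /le_trans; apply.
by rewrite le_eqVlt; apply/orP; left; apply/eqP; ring.
Qed.

End private.

Section moments.
Variables (r : nat) (M : R).
Hypothesis odr : ~~ odd r.
Hypothesis LM : (\int[Pn]_z ((L z - 1) ^+ r.+2)%:E <= M%:E)%E.

(** Young's inequality is applied for a fixed data set [z] and a fixed transcript [y], to [L z - 1]
    and [w y], then averaged over the transcript and over the data. Only expectations of functions
    of the transcript remain on the other side, which is the dual form in which a moment of [L]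
    passes to the transcript. *)
Lemma server_young (w : Y -> R) : measurable_fun setT w ->
  (forall y, `|w y| <= 1) ->
  r.+2%:R * (\int[nu]_y w y ^+ r.+1 - \int[mu]_y w y ^+ r.+1) <=
  M + r.+1%:R * \int[mu]_y w y ^+ r.+2.
Proof.
move=> mw w1.
have wpow j y : `|w y ^+ j| <= 1 by rewrite normrX exprn_ile1.
have mwp j : measurable_fun setT (fun y => w y ^+ j) by exact: measurable_funX.
have [mu1 u1 muE1] := Rintegral_mixture Pn mk (mwp r.+1) (wpow r.+1).
have [_ _ nuE1] := Rintegral_mixture Qn mk (mwp r.+1) (wpow r.+1).
have [mu2 u2 muE2] := Rintegral_mixture Pn mk (mwp r.+2) (wpow r.+2).
set U1 := fun z => \int[k z]_y w y ^+ r.+1 in mu1 u1 muE1 nuE1.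
set U2 := fun z => \int[k z]_y w y ^+ r.+2 in mu2 u2 muE2.
have [i1 E1] := Rintegral_excess mL L0 PQn mu1 u1.
rewrite /mu /nu muE1 nuE1 muE2 -E1.
have LM0 z : 0 <= (L z - 1) ^+ r.+2 by rewrite exprn_even_ge0//= negbK.
have i2 : Pn.-integrable setT (EFin \o U2).
  exact: (@integrable_bounded_fun _ _ _ Pn _ 1).
have i3 : Pn.-integrable setT (EFin \o (fun z => (L z - 1) ^+ r.+2)).
  apply/integrableP; split.
    by apply/measurable_EFinP; apply: measurable_funX; exact: measurable_funB.
  rewrite (eq_integral (fun z => ((L z - 1) ^+ r.+2)%:E)); last first.
    by move=> z _; rewrite /= ger0_norm.
  by rewrite (le_lt_trans LM)// ltry.
rewrite -(RintegralZl r.+2%:R measurableT i1).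
apply: (@le_trans _ _ (\int[Pn]_z ((L z - 1) ^+ r.+2 + r.+1%:R * U2 z))).
  apply: (le_Rintegral measurableT (integrable_EFinZl _ i1)
    (integrable_EFinD i3 (integrable_EFinZl _ i2))) => z _.
  have iw j : (k z).-integrable setT (EFin \o (fun y => w y ^+ j)).
    exact: (@integrable_bounded_fun _ _ _ _ _ 1).
  have ci a : (k z).-integrable setT (EFin \o cst a).
    exact: (@integrable_bounded_fun _ _ _ (k z) (cst a) `|a|).
  rewrite /U1 /U2 -(RintegralZl (L z - 1) measurableT (iw r.+1)).
  have i4 := integrable_EFinZl (L z - 1) (iw r.+1).
  rewrite -(RintegralZl r.+2%:R measurableT i4).
  rewrite -(RintegralZl r.+1%:R measurableT (iw r.+2)).
  rewrite -[X in _ <= X + _](Rintegral_probability_cst (k z)).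
  have i5 := integrable_EFinZl r.+1%:R (iw r.+2).
  rewrite -(RintegralD measurableT (ci _) i5).
  apply: (le_Rintegral measurableT (integrable_EFinZl _ i4)
    (integrable_EFinD (ci _) i5)) => y _.
  exact: young_pow.
rewrite (RintegralD measurableT i3 (integrable_EFinZl _ i2)).
rewrite (RintegralZl _ measurableT i2) lerD2r -lee_fin EFin_Rintegral//.
Qed.

End moments.

(** The case [r = 0] of the duality: [M] bounds the chi-square divergence of the data laws, and no
    privacy is involved. *)
Lemma server_affinity_information (M : R) (phi : Y -> R) :
  measurable_fun setT phi -> (forall y, 0 <= phi y) -> is_density mu nu phi ->
  (\int[Pn]_z ((L z - 1) ^+ 2)%:E <= M%:E)%E ->
  1 - 2^-1 * M <= \int[mu]_y Num.sqrt (phi y).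
Proof.
move=> mphi phi0 dphi LM; apply: le_trans (affinity_ge mphi phi0 dphi).
rewrite lerD2l lerN2 ler_wpM2l//.
exact: (excess_moment_le mphi phi0 dphi (r := 0) isT (@server_young 0 M isT LM)).
Qed.

Lemma server_affinity_private (tau e delta c M : R) (r : nat) (phi : Y -> R) :
  measurable_fun setT phi -> (forall y, 0 <= phi y) -> is_density mu nu phi ->
  (\int[P]_x `|l x - 1|%:E <= tau%:E)%E -> 1 <= e -> 0 <= delta ->
  (forall i z z', (forall j, j != i -> tnth z j = tnth z' j) ->
    forall A, measurable A -> (k z A <= e%:E * k z' A + delta%:E)%E) ->
  n%:R * (tau * (e - 1)) <= 2^-1 ->
  0 < c <= 1 -> ~~ odd r ->
  (c < 1 -> (\int[Pn]_z ((L z - 1) ^+ r.+2)%:E <= M%:E)%E) ->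
  1 - 2^-1 * (4 * (n%:R * (tau * (e - 1))) ^+ 2 + 8 * n%:R * tau * delta * c +
    (if c < 1 then M / c ^+ r else 0)) <= \int[mu]_y Num.sqrt (phi y).
Proof.
move=> mphi phi0 dphi l_tau e1 d0 kDP small c01 odr LM.
have c0 : 0 <= c by case/andP: c01 => /ltW.
have tau0 : 0 <= tau by rewrite -lee_fin (le_trans _ l_tau)// integral_ge0.
apply: le_trans (affinity_ge mphi phi0 dphi).
rewrite lerD2l lerN2 ler_wpM2l//.
apply: le_trans (excess_le_clip mphi phi0 dphi (eta := 2 * (n%:R * (tau * (e - 1))))
  (kap := 2 * n%:R * tau * delta * c) (M := M) odr c01 _ _ _) _.
- by rewrite mulr_ge0// mulr_ge0// mulr_ge0// subr_ge0.
- by move=> w mw wc; exact: server_approx.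
- move=> c1; apply: (excess_moment_le mphi phi0 dphi odr).
  by apply: server_young => //; exact: LM.
rewrite lerD2r le_eqVlt; apply/orP; left; apply/eqP; ring.
Qed.

End server.

Section clip_data.
Context (R : realType) d d' (X : measurableType d) (Y : measurableType d').
Context (n : nat) (P : probability X R) (cl : X -> X).
Hypothesis mcl : measurable_fun setT cl.
Hypothesis Pcl : forall A, measurable A -> P (cl @^-1` A) = P A.
Variable k : n.-tuple X -> probability Y R.
Hypothesis mk : forall U, measurable U -> measurable_fun setT (fun z => k z U).

Definition clip_tuple (z : n.-tuple X) : n.-tuple X :=
  [tuple cl (tnth z i) | i < n].

Lemma measurable_clip_tuple : measurable_fun setT clip_tuple.
Proof.
apply/measurable_fun_tnthP => i.
rewrite (_ : _ \o _ = cl \o (fun z : n.-tuple X => tnth z i)).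
  exact: (measurableT_comp mcl (@measurable_tnth _ X n i)).
by apply/funext => z /=; rewrite tnth_mktuple.
Qed.

Lemma measurable_clip_kernel U : measurable U ->
  measurable_fun setT (fun z => k (clip_tuple z) U).
Proof. by move=> mU; exact: (measurableT_comp (mk mU) measurable_clip_tuple). Qed.

(** [clip_tuple] preserves the product law, as is seen on rectangles, so composing the kernel with
    it leaves the law of its output unchanged. *)
Lemma mixture_clip A : measurable A ->
  mixture (tuple_prob (fun _ : 'I_n => P)) measurable_clip_kernel A =
  mixture (tuple_prob (fun _ : 'I_n => P)) mk A.
Proof.
move=> mA; rewrite /mixture.
apply: (integral_mfun_image measurable_clip_tuple _ (mk mA)) => // B mB.
apply: image_tuple_prob => //; first exact: measurable_clip_tuple.
move=> C mC.
transitivity (\int[tuple_prob (fun _ : 'I_n => P)]_z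
    (\prod_i (\1_(C i) \o cl) (tnth z i))%:E)%E.
  by apply: eq_integral => z _; congr EFin; apply: eq_bigr => i _; rewrite tnth_mktuple.
rewrite (@integral_tuple_prob_prod _ _ _ _ _ (fun i => \1_(C i) \o cl))//; last first.
  by move=> i; apply: measurableT_comp => //; exact: measurable_indic.
apply: eq_bigr => i _; rewrite -Pcl//.
have mcC : measurable (cl @^-1` C i) by rewrite -[X in measurable X]setTI; exact: mcl.
transitivity (\int[P]_x (\1_(cl @^-1` C i) x)%:E)%E.
  by apply: eq_integral.
by rewrite integral_indic// setIT.
Qed.

End clip_data.

(** * Testing between product laws and averaging over a hypercube *)

Lemma prod_subr_ge (R : realFieldType) (m : nat) (v : 'I_m -> R) :
  (forall j, 0 <= v j <= 1) -> 1 - \sum_j v j <= \prod_j (1 - v j).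
Proof.
elim: m v => [|m ih] v v01; first by rewrite !big_ord0 subr0.
rewrite !big_ord_recl; have /andP[v0 v1] := v01 ord0.
have /= := ih (fun j => v (lift ord0 j)) (fun j => v01 _).
set S := \sum_j _; set p := \prod_j _ => Sp.
have S0 : 0 <= S by apply: sumr_ge0 => j _; case/andP: (v01 (lift ord0 j)).
apply: (@le_trans _ _ ((1 - v ord0) * (1 - S))); last by rewrite ler_wpM2l// subr_ge0.
have : 0 <= v ord0 * S by exact: mulr_ge0.
lra.
Qed.

Lemma sqrt_prod (R : rcfType) (m : nat) (x : 'I_m -> R) :
  (forall j, 0 <= x j) -> Num.sqrt (\prod_j x j) = \prod_j Num.sqrt (x j).
Proof.
elim: m x => [|m ih] x x0; first by rewrite !big_ord0 sqrtr1.
by rewrite !big_ord_recl sqrtrM// ih.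
Qed.

(** A linearized form of Le Cam's inequality between affinity and overlap: the square root of [x] is
    the geometric mean of min(1, x) and max(1, x), and max(1, x) <= 1 + x. For a density, the last
    term has mean 1/4, which is half of the affinity guaranteed below. *)
Lemma sqrt_le_min (R : realType) (x : R) : 0 <= x ->
  Num.sqrt x <= 2 * Num.min 1 x + 8^-1 * (1 + x).
Proof.
move=> x0; have := sqrtr_ge0 x; have : x = Num.sqrt x ^+ 2 by rewrite sqr_sqrtr.
move: (Num.sqrt x : R) => s xE s0.
have [x1|x1] := leP 1 x.
  by have := sqr_ge0 (s - 4); rewrite xE !expr2; lra.
by have := sqr_ge0 (4 * s - 1); rewrite xE !expr2; nra.
Qed.

Section product_testing.
Context (R : realType) d (T : measurableType d) (m : nat).
Variables (mu nu : 'I_m -> probability T R) (phi : 'I_m -> T -> R) (v : 'I_m -> R).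
Hypotheses (mphi : forall j, measurable_fun setT (phi j))
  (phi0 : forall j t, 0 <= phi j t)
  (dphi : forall j, is_density (mu j) (nu j) (phi j)).
Hypotheses (v0 : forall j, 0 <= v j) (v_sum : \sum_j v j <= 2^-1).
Hypothesis affinity : forall j, 1 - v j <= \int[mu j]_t Num.sqrt (phi j t).

Let M : probability (m.-tuple T) R := tuple_prob mu.
Let N : probability (m.-tuple T) R := tuple_prob nu.
Let Phi (t : m.-tuple T) := \prod_j phi j (tnth t j).

Let mPhi : measurable_fun setT Phi.
Proof. exact: measurable_prod_tnth. Qed.

Let Phi0 t : 0 <= Phi t.
Proof. exact: prodr_ge0. Qed.

Let dPhi : is_density M N Phi.
Proof. exact: tuple_prob_density. Qed.

Lemma integrable_sqrt_density d' (Z : measurableType d')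
    (P Q : probability Z R) (g : Z -> R) : measurable_fun setT g ->
  (forall z, 0 <= g z) -> is_density P Q g ->
  P.-integrable setT (EFin \o (fun z => Num.sqrt (g z))).
Proof.
move=> mg g0 PQ.
have ci : P.-integrable setT (EFin \o cst 1).
  exact: (@integrable_bounded_fun _ _ _ P (cst 1) `|1|).
apply: (le_integrable measurableT _ _
  (integrable_EFinD ci (integrable_likelihood mg g0 PQ))).
  apply/measurable_EFinP; apply: (measurableT_comp _ mg).
  exact: measurable_sqrt.
move=> t _ /=; rewrite lee_fin ger0_norm ?sqrtr_ge0// ger0_norm ?addr_ge0//.
have s0 := sqrtr_ge0 (g t); rewrite -[in leRHS](sqr_sqrtr (g0 t)) expr2.
by have := sqr_ge0 (Num.sqrt (g t) - 2^-1); rewrite expr2; lra.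
Qed.

(** The affinity is the product of those of the servers, hence at least 1 minus the sum of the
    [v j], that is 1/2. By [sqrt_le_min], twice the overlap is at least 1/2 - 1/4. *)
Lemma overlap_ge : 8^-1 <= \int[M]_t Num.min 1 (Phi t).
Proof.
have sqrtE : \int[M]_t Num.sqrt (Phi t) =
    \prod_j \int[mu j]_t Num.sqrt (phi j t).
  apply: EFin_inj; rewrite EFin_Rintegral; last first.
    exact: integrable_sqrt_density mPhi Phi0 dPhi.
  rewrite -prodEFin; rewrite [RHS](_ : _ =
      (\prod_j \int[mu j]_t (Num.sqrt (phi j t))%:E)%E); last first.
    apply: eq_bigr => j _; rewrite EFin_Rintegral//.
    exact: integrable_sqrt_density (mphi j) (phi0 j) (dphi j).
  rewrite -(@integral_tuple_prob_prod _ _ _ _ mu (fun j t => Num.sqrt (phi j t))).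
  - by apply: eq_integral => t _; rewrite /Phi sqrt_prod.
  - move=> j; apply: (measurableT_comp _ (mphi j)); exact: measurable_sqrt.
  - by move=> j t; exact: sqrtr_ge0.
have half : 2^-1 <= \int[M]_t Num.sqrt (Phi t).
  have v1 j : v j <= 2^-1.
    apply: le_trans v_sum; rewrite (bigD1 j)//= lerDl.
    exact: sumr_ge0.
  rewrite sqrtE; apply: (@le_trans _ _ (\prod_j (1 - v j))).
    apply: le_trans (prod_subr_ge _).
      by rewrite lerBrDr (le_trans (lerD (lexx _) v_sum))//; lra.
    by move=> j; have := v1 j; have := v0 j; lra.
  apply: ler_prod => j _; rewrite affinity andbT.
  by have := v1 j; lra.
have iP := integrable_likelihood mPhi Phi0 dPhi.
have i1 : M.-integrable setT (EFin \o cst 1).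
  exact: (@integrable_bounded_fun _ _ _ M (cst 1) `|1|).
have im : M.-integrable setT (EFin \o (fun t => Num.min 1 (Phi t))).
  apply: (@integrable_bounded_fun _ _ _ M _ 1) => [|t].
    by apply: measurable_minr => //; exact: measurable_cst.
  by rewrite ger0_norm ?le_min ?ler01//= ge_min lexx.
have i2 := integrable_EFinD (integrable_EFinZl 2 im)
  (integrable_EFinZl 8^-1 (integrable_EFinD i1 iP)).
have : \int[M]_t Num.sqrt (Phi t) <=
    \int[M]_t (2 * Num.min 1 (Phi t) + 8^-1 * (1 + Phi t)).
  apply: (le_Rintegral measurableT (integrable_sqrt_density mPhi Phi0 dPhi) i2) => t _.
  exact: sqrt_le_min.
rewrite (RintegralD measurableT (integrable_EFinZl 2 im)
  (integrable_EFinZl 8^-1 (integrable_EFinD i1 iP))).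
rewrite (RintegralZl 2 measurableT im)
  (RintegralZl 8^-1 measurableT (integrable_EFinD i1 iP)).
rewrite (RintegralD measurableT i1 iP) Rintegral_probability_cst.
rewrite (Rintegral_likelihood mPhi Phi0 dPhi); lra.
Qed.

(** After the change of density both integrals are over [M], and [lp + Phi * lm] is at least
    [min(1, Phi)] times [lp + lm]. The losses are extended reals because the risk of an estimator
    may be infinite. *)
Lemma product_testing (a : R) (lp lm : m.-tuple T -> \bar R) : 0 <= a ->
  measurable_fun setT lp -> measurable_fun setT lm ->
  (forall t, 0 <= lp t)%E -> (forall t, 0 <= lm t)%E ->
  (forall t, a%:E <= lp t + lm t)%E ->
  ((a / 8)%:E <= \int[M]_t lp t + \int[N]_t lm t)%E.
Proof.
move=> a0 mlp mlm lp0 lm0 lpm.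
have mPl : measurable_fun setT (fun t => (Phi t)%:E * lm t)%E.
  by apply: emeasurable_funM => //; exact/measurable_EFinP.
rewrite dPhi// -ge0_integralD//; last by move=> t _; rewrite mule_ge0// lee_fin.
have mmin : measurable_fun setT (fun t => a * Num.min 1 (Phi t)).
  apply: measurable_funM; first exact: measurable_cst.
  by apply: measurable_minr => //; exact: measurable_cst.
have m01 t : 0 <= Num.min 1 (Phi t) by rewrite le_min ler01/=.
apply: (@le_trans _ _ (\int[M]_t (a * Num.min 1 (Phi t))%:E)%E); last first.
  apply: ge0_le_integral => //.
  - by move=> t _; rewrite lee_fin mulr_ge0.
  - exact/measurable_EFinP.
  - exact: emeasurable_funD.
  move=> t _; apply: (@le_trans _ _ ((Num.min 1 (Phi t))%:E * (lp t + lm t))%E).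
    by rewrite mulrC EFinM lee_wpmul2l// lee_fin.
  rewrite ge0_muleDr// leeD//.
    by rewrite -[leRHS]mul1e lee_wpmul2r// lee_fin ge_min lexx.
  by rewrite lee_wpmul2r// lee_fin ge_min lexx orbT.
have im : M.-integrable setT (EFin \o (fun t => Num.min 1 (Phi t))).
  apply: (@integrable_bounded_fun _ _ _ M _ 1) => [|t].
    by apply: measurable_minr => //; exact: measurable_cst.
  by rewrite ger0_norm// ge_min lexx.
rewrite -EFin_Rintegral; last exact: integrable_EFinZl.
by rewrite lee_fin (RintegralZl a measurableT im) ler_wpM2l// overlap_ge.
Qed.

End product_testing.

Section assouad.
Context (R : realType) (K : nat).
Local Notation cube := {ffun 'I_K -> bool}.

Definition flip (k : 'I_K) (s : cube) : cube :=
  [ffun i => if i == k then ~~ s i else s i].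

Lemma flipK k : involutive (flip k).
Proof.
by move=> s; apply/ffunP => i; rewrite !ffunE; case: eqP => // _; rewrite negbK.
Qed.

(** The sum over all vertices and coordinates is at most the number of vertices times [r]; pairing
    each vertex with its flip in coordinate [k] bounds twice that sum from below. *)
Lemma assouad_average (x : cube -> 'I_K -> \bar R) (c : R) (r : \bar R) :
  (forall s k, 0 <= x s k)%E ->
  (forall s k, c%:E <= x s k + x (flip k s) k)%E ->
  (forall s, \sum_k x s k <= r)%E ->
  ((K%:R * c / 2)%:E <= r)%E.
Proof.
move=> x0 xc xr.
have r0 : (0 <= r)%E.
  apply: le_trans (xr [ffun=> true]); exact: sume_ge0.
case: r r0 xr => [r| |] // r0 xr; last by rewrite leey.
have xfin s k : x s k \is a fin_num.
  rewrite ge0_fin_numE// (le_lt_trans _ (ltry r))//.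
  apply: le_trans (xr s); rewrite (bigD1 k)//= leeDl//.
  by apply: sume_ge0.
pose y s k := fine (x s k).
have yE s k : x s k = (y s k)%:E by rewrite fineK.
have yc s k : c <= y s k + y (flip k s) k.
  by rewrite -lee_fin EFinD -!yE.
have yr s : \sum_k y s k <= r.
  by rewrite -lee_fin -sumEFin; under eq_bigr do rewrite -yE.
rewrite lee_fin.
pose S := \sum_(s : cube) \sum_k y s k.
have S1 : S <= #|{: cube}|%:R * r.
  rewrite /S -sum1_card natr_sum mulr_suml; apply: ler_sum => s _.
  by rewrite mul1r.
have S2 : #|{: cube}|%:R * (K%:R * c) <= S + S.
  have -> : S + S = \sum_k \sum_(s : cube) (y s k + y (flip k s) k).
    rewrite /S exchange_big -big_split; apply: eq_bigr => k _.
    rewrite big_split; congr (_ + _).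
    by rewrite [LHS](reindex_inj (inv_inj (flipK k))).
  have -> : #|{: cube}|%:R * (K%:R * c) = \sum_(k < K) \sum_(s : cube) c.
    rewrite !sumr_const card_ord -[c *+ _]mulr_natl -[RHS]mulr_natl.
    by rewrite mulrCA.
  by apply: ler_sum => k _; apply: ler_sum => s _.
have cpos : 0 < #|{: cube}|%:R :> R.
  by rewrite ltr0n card_ffun card_bool expn_gt0.
rewrite ler_pdivrMr// -(ler_pM2l cpos) mulrA; lra.
Qed.

End assouad.

(** * Gaussian regression *)

Section normal_shift.
Context (R : realType).
Local Notation leb := (@lebesgue_measure R).
Local Notation RT := (measurableTypeR R).

Lemma lebesgue_measure_translate (a : R) (A : set RT) : measurable A ->
  pushforward leb (fun x : RT => a + x : RT) A = leb A.
Proof.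
move=> mA.
have mt : measurable_fun setT (fun x : RT => a + x : RT) by exact: measurable_funD.
pose t : {mfun RT >-> RT} := HB.pack (fun x : RT => a + x : RT)
  (isMeasurableFun.Build _ _ _ _ _ mt).
apply/esym; apply: (@lebesgue_measure_unique _ (pushforward leb t)) => //= _ [[b c]] _ <-.
rewrite /pushforward (_ : _ @^-1` _ = `]b - a, c - a]%classic); last first.
  by apply/seteqP; split => x /=; rewrite !in_itv/= ltrBlDl lerBrDl.
rewrite !lebesgue_measure_itv/= !lte_fin ltrD2r; case: ifP => // _.
by rewrite -!EFinB; congr EFin; ring.
Qed.

Lemma integral_translate (a : R) (F : RT -> \bar R) :
  measurable_fun setT F -> (forall x, 0 <= F x)%E ->
  (\int[leb]_x F (a + x)%R = \int[leb]_x F x)%E.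
Proof.
move=> mF F0.
have mt : measurable_fun setT (fun x : RT => a + x : RT) by exact: measurable_funD.
have := @ge0_integral_pushforward _ _ _ _ _ _ mt leb setT F measurableT mF (fun y _ => F0 y).
rewrite preimage_setT /= => <-.
pose t : {mfun RT >-> RT} := HB.pack (fun x : RT => a + x : RT)
  (isMeasurableFun.Build _ _ _ _ _ mt).
apply: (@eq_measure_integral _ _ _ _ leb (pushforward leb t)) => A mA _.
exact: lebesgue_measure_translate.
Qed.

(** The Radon-Nikodym derivative of the normal law and the Gaussian density have equal integrals
    over all measurable sets, so they agree almost everywhere. *)
Lemma integral_normal (F : RT -> \bar R) :
  measurable_fun setT F -> (forall x, 0 <= F x)%E ->
  (\int[normal_prob 0 1]_x F x = \int[leb]_x (F x * (normal_pdf 0 1 x)%:E))%E.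
Proof.
move=> mF F0.
have dom := normal_prob_dominates (0 : R) 1.
rewrite -(Radon_Nikodym_SigmaFinite.change_of_variables dom)//.
have mpdf : measurable_fun setT (fun x : RT => (normal_pdf 0 1 x)%:E).
  by apply/measurable_EFinP; exact: measurable_normal_pdf.
have mRN := measurable_int _ (Radon_Nikodym_SigmaFinite.f_integrable dom).
apply: ge0_ae_eq_integral => //.
- exact: emeasurable_funM.
- exact: emeasurable_funM.
- by move=> x _; rewrite mule_ge0//; exact: Radon_Nikodym_SigmaFinite.f_ge0.
- by move=> x _; rewrite mule_ge0// lee_fin normal_pdf_ge0.
have : ae_eq leb setT
   (Radon_Nikodym_SigmaFinite.f (normal_prob 0 1) leb)
   (fun x : RT => (normal_pdf 0 1 x)%:E).
  apply: integral_ae_eq => //.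
    exact: (Radon_Nikodym_SigmaFinite.f_integrable dom).
  by move=> E _ mE; rewrite -Radon_Nikodym_SigmaFinite.f_integral.
by apply: filterS => x /= /[apply] ->.
Qed.

Lemma normal_pdf_shift (a y : R) :
  normal_pdf 0 1 (- a + y) = expR (a * y - a ^+ 2 / 2) * normal_pdf 0 1 y.
Proof.
rewrite !normal_pdfE ?oner_neq0// /normal_fun.
rewrite mulrCA -expRD; congr (_ * expR _).
by rewrite expr1n; field.
Qed.

(** Cameron-Martin formula in dimension one, from the translation invariance of the Lebesgue
    measure. *)
Lemma integral_normal_shift (a : R) (F : RT -> \bar R) :
  measurable_fun setT F -> (forall x, 0 <= F x)%E ->
  (\int[normal_prob 0 1]_x F (a + x)%R =
   \int[normal_prob 0 1]_x ((expR (a * x - a ^+ 2 / 2))%:E * F x))%E.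
Proof.
move=> mF F0.
have mt (b : R) : measurable_fun setT (fun x : RT => b + x : RT).
  exact: measurable_funD.
have mexp : measurable_fun setT (fun x : RT => expR (a * x - a ^+ 2 / 2)).
  apply: measurableT_comp; first exact: measurable_expR.
  by apply: measurable_funB => //; exact: measurable_funM.
have mF1 : measurable_fun setT (fun x : RT => F (a + x)).
  exact: (measurableT_comp mF (mt a)).
have mF2 : measurable_fun setT
    (fun x : RT => ((expR (a * x - a ^+ 2 / 2))%:E * F x)%E).
  by apply: emeasurable_funM => //; exact/measurable_EFinP.
rewrite (integral_normal mF1 (fun x => F0 _)) (integral_normal mF2); last first.
  by move=> x; rewrite mule_ge0// lee_fin expR_ge0.
rewrite -(integral_translate (- a)); last 2 first.
- apply: emeasurable_funM; first exact: (measurableT_comp mF (mt a)).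
  by apply/measurable_EFinP; exact: measurable_normal_pdf.
- by move=> x; rewrite mule_ge0// lee_fin normal_pdf_ge0.
apply: eq_integral => x _.
by rewrite addNKr normal_pdf_shift EFinM muleA (muleC (F x)).
Qed.

(** The shift formula with integrand 1 says that its exponential weight has total mass 1. *)
Lemma normal_mgf (a : R) :
  (\int[normal_prob 0 1]_x (expR (a * x))%:E = (expR (a ^+ 2 / 2))%:E)%E.
Proof.
have := @integral_normal_shift a (fun=> 1%E) (measurable_cst _) (fun _ => lee01).
rewrite integral_probability_cst => E1.
have mexp : measurable_fun setT (fun x : RT => expR (a * x - a ^+ 2 / 2)).
  apply: measurableT_comp; first exact: measurable_expR.
  by apply: measurable_funB => //; exact: measurable_funM.
transitivity (\int[normal_prob 0 1]_x
    ((expR (a ^+ 2 / 2))%:E * (expR (a * x - a ^+ 2 / 2))%:E))%E.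
  apply: eq_integral => x _; rewrite -EFinM -expRD; congr (expR _)%:E; ring.
have ee x : (0 <= (expR (a * x - a ^+ 2 / 2))%:E)%E by rewrite lee_fin expR_ge0.
have mE : measurable_fun setT (fun x : RT => (expR (a * x - a ^+ 2 / 2))%:E).
  exact/measurable_EFinP.
rewrite ge0_integralZl ?lee_fin ?expR_ge0//.
rewrite [X in (_ * X)%E = _](_ : _ = 1%E) ?mule1//.
by apply: etrans (esym E1); apply: eq_integral => x _; rewrite mule1.
Qed.

Lemma norm_expRB1 (u : R) : `|expR u - 1| <= `|u| * expR `|u|.
Proof.
have [u0|u0] := leP 0 u.
  rewrite ger0_norm; last by rewrite subr_ge0 (le_trans _ (expR_ge1Dx _))// lerDl.
  rewrite ger0_norm//.
  have := expR_ge1Dx (- u); rewrite expRN => h.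
  have e0 := expR_gt0 u.
  rewrite -(ler_pM2r e0) mulVf ?gt_eqF// in h; lra.
rewrite ler0_norm; last by rewrite subr_le0 expR_le1 ltW.
rewrite ltr0_norm//; have := expR_ge1Dx u.
have : 1 <= expR (- u) by rewrite -expR0 ler_expR; lra.
move=> h1 h2; apply: (@le_trans _ _ (- u)); first lra.
by rewrite ler_peMr//; lra.
Qed.

(** For [|t| <= 1] one has |exp(u) - 1| <= |t| exp(2(|x| + 1)) with u = t x - t^2 / 2. The [j]-th
    power gives exp(2j) and exp(2j|x|); the latter is at most exp(2jx) + exp(-2jx), and each of
    these two terms has mean exp(2j^2). *)
Definition tilt_const (j : nat) : R :=
  2 * expR (2 * j%:R + 2 * j%:R ^+ 2).

Lemma tilt_moment (t : R) (j : nat) : `|t| <= 1 ->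
  (\int[normal_prob 0 1]_x (`|expR (t * x - t ^+ 2 / 2) - 1| ^+ j)%:E <=
   (tilt_const j * `|t| ^+ j)%:E)%E.
Proof.
move=> t1.
have mexpc (b : R) : measurable_fun setT (fun x : RT => (expR (b * x))%:E).
  apply/measurable_EFinP/measurableT_comp; first exact: measurable_expR.
  exact: measurable_funM.
pose c := `|t| ^+ j * expR (2 * j%:R).
have c0 : 0 <= c by rewrite mulr_ge0 ?expR_ge0// exprn_ge0.
pose a : R := 2 * j%:R.
apply: (@le_trans _ _ (\int[normal_prob 0 1]_x
    (c%:E * ((expR (a * x))%:E + (expR (- a * x))%:E)))%E).
  apply: ge0_le_integral => //.
  - apply/measurable_EFinP; apply: measurable_funX; apply: measurableT_comp => //.
    apply: measurable_funB => //; apply: measurableT_comp; first exact: measurable_expR.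
    by apply: measurable_funB => //; exact: measurable_funM.
  - by apply: measurable_funeM; exact: emeasurable_funD.
  move=> x _; rewrite -EFinD -EFinM lee_fin.
  have u1 : `|t * x - t ^+ 2 / 2| <= `|t| * (`|x| + 1).
    rewrite (le_trans (ler_normB _ _))// mulrDr mulr1 normrM lerD2l.
    rewrite normrM normrX [X in _ * X]ger0_norm ?invr_ge0//.
    by have := normr_ge0 t; move: t1; move: `|t| => s; rewrite expr2; nra.
  have u2 : `|t * x - t ^+ 2 / 2| <= `|x| + 1.
    apply: (le_trans u1); rewrite ler_piMl// addr_ge0//.
  have x1 : `|x| + 1 <= expR (`|x| + 1).
    by apply: le_trans (expR_ge1Dx _); rewrite lerDr.
  have e1 : `|expR (t * x - t ^+ 2 / 2) - 1| <= `|t| * expR (2 * (`|x| + 1)).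
    apply: (le_trans (norm_expRB1 _)).
    have -> : 2 * (`|x| + 1) = (`|x| + 1) + (`|x| + 1) by ring.
    rewrite expRD mulrA; apply: ler_pM; rewrite ?expR_ge0// ?ler_expR//.
    by apply: (le_trans u1); rewrite ler_wpM2l.
  apply: (@le_trans _ _ ((`|t| * expR (2 * (`|x| + 1))) ^+ j)).
    by rewrite lerXn2r ?nnegrE ?mulr_ge0 ?expR_ge0.
  rewrite exprMn -expRM_natl /c -mulrA ler_wpM2l ?exprn_ge0//.
  have -> : j%:R * (2 * (`|x| + 1)) = 2 * j%:R + a * `|x| by rewrite /a; ring.
  rewrite expRD ler_wpM2l ?expR_ge0//.
  have [x0|/ltW x0] := leP 0 x.
    by rewrite ger0_norm// lerDl expR_ge0.
  by rewrite ler0_norm// mulrN -mulNr lerDr expR_ge0.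
rewrite ge0_integralZl//; last 2 first.
- exact: emeasurable_funD.
- by move=> x _; rewrite -EFinD lee_fin addr_ge0 ?expR_ge0.
rewrite ge0_integralD//.
rewrite !normal_mgf -EFinD -EFinM lee_fin sqrrN /tilt_const /c /a.
rewrite expRD le_eqVlt; apply/orP; left; apply/eqP.
have -> : (2 * j%:R) ^+ 2 / 2 = 2 * j%:R ^+ 2 :> R by field.
by ring.
Qed.

End normal_shift.

Section regression_likelihood.
Context (R : realType).
Local Notation RT := (measurableTypeR R).
Implicit Types f g : {mfun RT >-> RT}.

Lemma integral_obs_law f (F : obs R -> \bar R) :
  measurable_fun setT F -> (forall z, 0 <= F z)%E ->
  (\int[obs_law f]_z F z =
   \int[uniform_prob (@ltr01 R)]_x \int[normal_prob 0 1]_xi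
     F ((f x + xi)%R, x))%E.
Proof.
move=> mF F0; rewrite ge0_integral_distribution//.
have mFo : measurable_fun setT (F \o mk_obs f).
  by apply: measurableT_comp => //; exact: measurable_mk_obs.
by rewrite (fubini_tonelli1 _ mFo)// => z; exact: F0.
Qed.

(** The likelihood ratio of one observation, [obs_law g] against [obs_law f]: a Gaussian shift by
    [g - f] at the covariate, evaluated at the residual [z.1 - f z.2]. *)
Definition tilt f g (z : obs R) : R :=
  expR ((g z.2 - f z.2) * (z.1 - f z.2) - (g z.2 - f z.2) ^+ 2 / 2).

Lemma measurable_tilt f g : measurable_fun setT (tilt f g).
Proof.
have m1 (h : {mfun RT >-> RT}) : measurable_fun setT (fun z : obs R => h z.2 : RT).
  exact: (measurableT_comp (measurable_funP h) measurable_snd).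
have m2 : measurable_fun setT (fun z : obs R => z.1 : RT) by exact: measurable_fst.
have md : measurable_fun setT (fun z : obs R => g z.2 - f z.2 : RT).
  by apply: measurable_funB; exact: m1.
apply: measurableT_comp; first exact: measurable_expR.
apply: measurable_funB.
  apply: measurable_funM; first exact: md.
  by apply: measurable_funB; [exact: m2|exact: m1].
by apply: measurable_funM; [apply: measurable_funX; exact: md|exact: measurable_cst].
Qed.

Lemma tilt_ge0 f g z : 0 <= tilt f g z.
Proof. exact: expR_ge0. Qed.

Lemma measurable_obs_section (F : obs R -> \bar R) (x c : R) :
  measurable_fun setT F ->
  measurable_fun setT (fun xi : RT => F ((c + xi)%R, x)).
Proof.
move=> mF; apply: (measurableT_comp mF).
by apply: measurable_fun_pair => //; exact: measurable_funD.
Qed.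

Lemma obs_density f g : is_density (obs_law f) (obs_law g) (tilt f g).
Proof.
move=> F mF F0.
have mG : measurable_fun setT (fun z => (tilt f g z)%:E * F z)%E.
  by apply: emeasurable_funM => //; apply/measurable_EFinP; exact: measurable_tilt.
have G0 z : (0 <= (tilt f g z)%:E * F z)%E by rewrite mule_ge0// lee_fin tilt_ge0.
rewrite [LHS](integral_obs_law g mF F0) [RHS](integral_obs_law f mG G0).
apply: eq_integral => x _.
rewrite (eq_integral (fun xi : RT =>
    F ((f x + ((g x - f x) + xi))%R, x))); last first.
  by move=> xi _; rewrite addrA addrCA subrr addr0.
have mFx : measurable_fun setT (fun xi : RT => F ((f x + xi)%R, x)).
  exact: measurable_obs_section.
have := integral_normal_shift (g x - f x) mFx (fun xi => F0 _).
move=> ->.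
apply: eq_integral => xi _; congr (_%:E * _)%E.
by rewrite /tilt/= [f x + xi]addrC addrK.
Qed.

(** The noise is integrated first, at a fixed covariate. Off [I] the ratio is 1; as [j] is positive,
    the power of the indicator is the indicator, whose mean is at most [pi0]. *)
Lemma obs_moment f g (I : set RT) (beta pi0 : R) (j : nat) : measurable I ->
  0 <= beta <= 1 -> (0 < j)%N ->
  (forall x, `|g x - f x| <= beta * \1_I x) ->
  (uniform_prob (@ltr01 R) I <= pi0%:E)%E ->
  (\int[obs_law f]_z (`|tilt f g z - 1| ^+ j)%:E <=
   (tilt_const R j * beta ^+ j * pi0)%:E)%E.
Proof.
move=> mI /andP[b0 b1] j0 fg Ipi.
have tc0 : 0 <= tilt_const R j by rewrite mulr_ge0 ?expR_ge0.
have mF : measurable_fun setT (fun z => (`|tilt f g z - 1| ^+ j)%:E).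
  apply/measurable_EFinP; apply: measurable_funX; apply: measurableT_comp => //.
  by apply: measurable_funB => //; exact: measurable_tilt.
have F0 z : (0 <= (`|tilt f g z - 1| ^+ j)%:E)%E by rewrite lee_fin exprn_ge0.
rewrite integral_obs_law//.
apply: (@le_trans _ _ (\int[uniform_prob (@ltr01 R)]_x
   ((tilt_const R j * beta ^+ j)%:E * (\1_I x)%:E))%E).
  apply: ge0_le_integral => //.
  - by move=> x _; exact: integral_ge0.
  - have mc : measurable_fun setT
        (fun w : RT * RT => (`|tilt f g (mk_obs f w) - 1| ^+ j)%:E).
      by apply: (measurableT_comp mF); exact: measurable_mk_obs.
    exact: (measurable_fun_fubini_tonelli_F _ mc).
  - by apply: measurable_funeM; apply/measurable_EFinP; exact: measurable_indic.
  move=> x _; rewrite (eq_integral (fun xi : RT =>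
      (`|expR ((g x - f x) * xi - (g x - f x) ^+ 2 / 2) - 1| ^+ j)%:E)); last first.
    by move=> xi _; rewrite /tilt/= [f x + xi]addrC addrK.
  have gf1 : `|g x - f x| <= 1.
    apply: (le_trans (fg x)); rewrite mulr_ile1// indicE; by case: (_ \in _).
  apply: (le_trans (tilt_moment _ gf1)); rewrite -EFinM lee_fin -[leRHS]mulrA ler_wpM2l//.
  apply: (@le_trans _ _ ((beta * \1_I x) ^+ j)).
    by rewrite lerXn2r ?nnegrE// mulr_ge0.
  rewrite exprMn ler_wpM2l ?exprn_ge0// indicE.
  by case: (_ \in _); rewrite ?expr1n// expr0n gtn_eqF.
rewrite ge0_integralZl//; last 2 first.
- by apply/measurable_EFinP; exact: measurable_indic.
- by rewrite lee_fin mulr_ge0// exprn_ge0.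
rewrite integral_indic// setIT [leRHS]EFinM lee_wpmul2l// lee_fin mulr_ge0//.
exact: exprn_ge0.
Qed.

(* Privacy constrains a mechanism on the sample space only. Projecting the
   covariates on [0, 1] first makes the constraint hold for all datasets and
   leaves the law of the data unchanged. *)
Definition clip_obs (z : obs R) : obs R := (z.1, Num.max 0 (Num.min 1 z.2) : R).

Lemma measurable_clip_obs : measurable_fun setT clip_obs.
Proof.
apply: measurable_fun_pair; first exact: measurable_fst.
apply: measurable_maxr; first exact: measurable_cst.
by apply: measurable_minr; [exact: measurable_cst|exact: measurable_snd].
Qed.

Lemma clip_obs_sample z : in_sample_space (clip_obs z).
Proof.
by rewrite /in_sample_space/= le_max lexx/= ge_max ler01 ge_min lexx.
Qed.

Lemma obs_law_clip f A : measurable A ->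
  obs_law f (clip_obs @^-1` A) = obs_law f A.
Proof.
move=> mA.
have mcA : measurable (clip_obs @^-1` A).
  by rewrite -[X in measurable X]setTI; exact: measurable_clip_obs.
have E B : measurable B ->
    obs_law f B = (\int[obs_law f]_z (\1_B z)%:E)%E.
  by move: (obs_law f) => P mB; rewrite integral_indic// setIT.
have i0 (B : set (obs R)) z : (0 <= (\1_B z : R)%:E)%E by rewrite lee_fin.
have mi B : measurable B -> measurable_fun setT (fun z : obs R => (\1_B z : R)%:E).
  by move=> mB; apply/measurable_EFinP; exact: measurable_indic.
rewrite [LHS](E _ mcA) [RHS](E _ mA).
rewrite [LHS](integral_obs_law f (mi _ mcA) (i0 _)).
rewrite [RHS](integral_obs_law f (mi _ mA) (i0 _)).
have mfub B : measurable B -> measurable_fun setT (fun x : RT =>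
    \int[normal_prob 0 1]_xi (\1_B ((f x + xi, x) : obs R))%:E)%E.
  move=> mB; have mc : measurable_fun setT
      (fun w : RT * RT => (\1_B (mk_obs f w) : R)%:E).
    by apply: (measurableT_comp (mi _ mB)); exact: measurable_mk_obs.
  by apply: (measurable_fun_fubini_tonelli_F _ mc) => z; rewrite lee_fin.
have fub0 B x : (0 <= \int[normal_prob 0 1]_xi (\1_B ((f x + xi, x) : obs R))%:E)%E.
  by apply: integral_ge0 => xi _; rewrite lee_fin.
rewrite [LHS](integral_uniform _ (mfub _ mcA) (fub0 _)).
rewrite [RHS](integral_uniform _ (mfub _ mA) (fub0 _)).
congr (_ * _)%E; apply: eq_integral => x; rewrite inE/= in_itv/= => /andP[x0 x1].
apply: eq_integral => xi _; congr (_%:E).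
rewrite !indicE; congr (_%:R); congr nat_of_bool.
apply/idP/idP; rewrite !inE /= /clip_obs /= (min_idPr x1) (max_idPr x0)//.
Qed.

End regression_likelihood.

(** * Wavelet perturbations *)

Section sequence_norm.
Context (R : realType).

Lemma eseries_finite_support (F : nat -> \bar R) (M : nat) :
  (forall k, (M <= k)%N -> F k = 0%E) ->
  (\sum_(k <oo) F k = \sum_(0 <= k < M) F k)%E.
Proof.
move=> F0; apply/cvg_lim => //; apply: cvg_near_cst; near=> n.
have Mn : (M <= n)%N by near: n; exact: nbhs_infty_ge.
rewrite (big_cat_nat _ Mn)//= [X in (_ + X)%E]big1_seq ?adde0// => k /=.
by rewrite mem_index_iota => /andP[Mk _]; exact: F0.
Unshelve. all: by end_near. Qed.

(** [S] marks the entries that may be nonzero. It is used with all the indices of one level, and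
    with a single level. Writing the exponent as [fine (p^-1)] also covers [p = +oo], where it is
    0. *)
Lemma Lnorm_counting_le (p : \bar R) (a : R) (f : nat -> \bar R)
    (S : pred nat) (M : nat) : (1 <= p)%E -> 0 <= a ->
  (forall k, `|f k| <= a%:E)%E -> (forall k, ~~ S k || (M <= k)%N -> f k = 0%E) ->
  (0 < \sum_(0 <= k < M) S k)%N ->
  ('N[counting]_p[f] <=
   ((\sum_(0 <= k < M) S k)%N%:R `^ (fine (p^-1)%E) * a)%:E)%E.
Proof.
move=> p1 a0 fa f0 M0; set c := (\sum_(0 <= k < M) S k)%N in M0 *.
case: p p1 => [r| |] //=; last first.
  move=> _; rewrite powRr0 mul1r.
  rewrite unlock; case: ifPn => _; last by rewrite lee_fin.
  by apply/ess_sup_inf.ess_supP; apply: aeW => k /=; exact: fa.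
rewrite lee_fin => r1; have r0 : 0 < r by apply: lt_le_trans r1.
rewrite inver gt_eqF//= Lnorm_counting//.
rewrite (@eseries_finite_support _ M); last first.
  by move=> k Mk; rewrite f0 ?Mk ?orbT// abse0 poweR0r ?gt_eqF.
apply: (@le_trans _ _ (((c%:R * a `^ r)%:E) `^ r^-1)%E).
  apply: gt0_ler_poweR.
  - by rewrite invr_ge0 ltW.
  - by rewrite in_itv/= leey andbT; apply: sume_ge0 => k _; exact: poweR_ge0.
  - by rewrite in_itv/= leey andbT lee_fin mulr_ge0// powR_ge0.
  rewrite /c natr_sum mulr_suml -sumEFin; apply: lee_sum => k _.
  case: (boolP (S k)) => Sk; last first.
    by rewrite f0 ?Sk// abse0 poweR0r ?gt_eqF// mul0r.
  rewrite mul1r -poweR_EFin; apply: gt0_ler_poweR; rewrite ?(ltW r0)//.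
  - by rewrite in_itv/= leey andbT.
  - by rewrite in_itv/= leey andbT lee_fin.
rewrite poweR_EFin lee_fin powRM ?powR_ge0//.
by rewrite -powRrM mulfV ?gt_eqF// powRr1.
Qed.

End sequence_norm.

Section continuous_wavelets.
Context (R : realType).

Lemma classC_continuous (A : nat) (g : R -> R) : (0 < A)%N ->
  classC A g -> continuous g.
Proof.
move=> A0 [dg _] x; apply: differentiable_continuous.
by apply/derivable1_diffP; exact: (dg 0%N).
Qed.

Lemma continuous_affine_comp (g : R -> R) (s c b : R) : continuous g ->
  continuous (fun x => s * g (c * x + b)).
Proof.
move=> cg x; apply: cvgM; first exact: cvg_cst.
apply: (@continuous_comp _ _ _ (fun x : R => c * x + b) g); last exact: cg.
by apply: cvgD; [apply: cvgM; [exact: cvg_cst|exact: cvg_id]|exact: cvg_cst].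
Qed.

Lemma continuous_cdv_level (N : nat) (g : R -> R) (gl gr : 'I_N -> R -> R) j k :
  continuous g -> (forall i, continuous (gl i)) ->
  (forall i, continuous (gr i)) -> continuous (cdv_level g gl gr j k).
Proof.
move=> cg cl cr; rewrite /cdv_level.
set s := Num.sqrt _.
case: insub => [i|].
  rewrite (_ : (fun x => _) = (fun x => s * gl i (2 ^+ j * x + 0))).
    exact: continuous_affine_comp.
  by apply/funext => x; rewrite addr0.
case: insub => [i|]; last exact: continuous_affine_comp.
rewrite (_ : (fun x => _) = (fun x => s * gr i (- (2 ^+ j) * x + 2 ^+ j))).
  exact: continuous_affine_comp.
by apply/funext => x; congr (_ * gr i _); ring.
Qed.

Lemma bounded_of_compact_support (g : R -> R) (u v : R) : u <= v -> continuous g ->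
  (forall x, ~~ (u <= x <= v) -> g x = 0) ->
  exists2 B, 0 < B & forall x, `|g x| <= B.
Proof.
move=> uv cg g0.
have cn : {within `[u, v], continuous (fun x => `|g x|)}.
  apply: continuous_subspaceT => x.
  apply: (@continuous_comp _ _ _ g (fun y : R => `|y|)); first exact: cg.
  exact: norm_continuous.
have [c _ gc] := EVT_max uv cn.
exists (1 + `|g c|) => [|x]; first by rewrite ltr_pwDl.
have [xuv|xuv] := boolP (u <= x <= v).
  by apply: (le_trans (gc x _)); [rewrite in_itv|rewrite lerDr].
by rewrite g0// normr0 addr_ge0.
Qed.

End continuous_wavelets.

Section cell_wavelets.
Context (R : realType) (A l0 : nat) (W : cdv_system R).
Hypothesis A0 : (0 < A)%N.
Hypothesis W_cdv : is_cdv_basis A l0 W.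
Local Notation N := (cdv_N W).
Local Notation leb := (@lebesgue_measure R).
Local Notation RT := (measurableTypeR R).

Lemma cdv_N_gt0 : (0 < N)%N.
Proof. by case: (cdv_regularity W_cdv) => AN _; exact: leq_trans AN. Qed.

Lemma continuous_cdv_wavelet l k : continuous (cdv_wavelet W l0 l k).
Proof.
have [_ [cphi cpsi cb]] := cdv_regularity W_cdv.
rewrite /cdv_wavelet; case: eqP => _; apply: continuous_cdv_level.
- exact: classC_continuous cphi.
- by move=> i; case: (cb i) => + _ _ _; exact: classC_continuous.
- by move=> i; case: (cb i) => _ + _ _; exact: classC_continuous.
- exact: classC_continuous cpsi.
- by move=> i; case: (cb i) => _ _ + _; exact: classC_continuous.
- by move=> i; case: (cb i) => _ _ _ +; exact: classC_continuous.
Qed.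

Lemma cdv_psi_bounded : exists2 B, 0 < B & forall x, `|cdv_psi W x| <= B.
Proof.
have [_ [_ cpsi _]] := cdv_regularity W_cdv.
have [supp _ _ _ _] := cdv_daubechies W_cdv.
apply: (@bounded_of_compact_support _ _ (- N%:R + 1) N%:R).
- have : 1 <= N%:R :> R by rewrite ler1n cdv_N_gt0.
  lra.
- exact: classC_continuous cpsi.
- by move=> x /supp[].
Qed.

Variable L : nat.
Hypotheses (l0L : (l0 < L)%N) (NL : (4 * N <= 2 ^ L)%N).

(** Cells have length 2N / 2^L; counting only 2^L / (4N) of them keeps the indices away from the N
    boundary wavelets at each end, at the price of a constant factor. *)
Definition cell_count : nat := 2 ^ L %/ (4 * N).

(* Interior wavelets spaced by [2 * N] have disjoint supports. *)
Definition cell_index (i : nat) : nat := N + 2 * N * i.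

Lemma cell_index_bound i : (i < cell_count)%N -> (cell_index i + N < 2 ^ L)%N.
Proof.
rewrite /cell_count /cell_index => iK.
have N0 := cdv_N_gt0.
have h1 : (i.+1 * (4 * N) <= 2 ^ L)%N.
  by apply: leq_trans (leq_divM (2 ^ L) (4 * N)); rewrite leq_mul2r iK orbT.
nia.
Qed.

Definition cell_wavelet (i : nat) : R -> R := cdv_wavelet W l0 L (cell_index i).

(** [cdv_psi] vanishes off [-N + 1, N], so the wavelet of index N + 2Ni lives on
    [(2Ni + 1) / 2^L, 2N(i + 1) / 2^L]. The half-open interval contains it and makes the cells
    disjoint. *)
Definition cell (i : nat) : set RT :=
  `](2 * N * i)%:R / 2 ^+ L, (2 * N * i.+1)%:R / 2 ^+ L].

Lemma cell_waveletE i x : (i < cell_count)%N ->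
  cell_wavelet i x = Num.sqrt (2 ^+ L) * cdv_psi W (2 ^+ L * x - (cell_index i)%:R).
Proof.
move=> iK; have := cell_index_bound iK; have N0 := cdv_N_gt0 => b.
rewrite /cell_wavelet /cdv_wavelet gtn_eqF// /cdv_detail /cdv_level.
rewrite insubF; last by rewrite /cell_index; apply/negbTE; lia.
by rewrite insubF//; apply/negbTE; lia.
Qed.

Lemma cell_wavelet_support i x : (i < cell_count)%N -> ~ cell i x -> cell_wavelet i x = 0.
Proof.
move=> iK xi; rewrite cell_waveletE//.
have [supp _ _ _ _] := cdv_daubechies W_cdv.
have p0 : 0 < 2 ^+ L :> R by rewrite exprn_gt0.
suff ns : ~~ (- N%:R + 1 <= 2 ^+ L * x - (cell_index i)%:R <= N%:R).
  by have [_ ->] := supp _ ns; rewrite mulr0.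
apply/negP => /andP[h1 h2]; apply: xi.
rewrite /cell /= in_itv/= ltr_pdivrMr// ler_pdivlMr// ![x * _]mulrC.
move: h1 h2; rewrite /cell_index mulnS !natrD.
set t := 2 ^+ L * x; set k := (2 * N * i)%:R.
move=> h1 h2; apply/andP; split; lra.
Qed.

Lemma cell_wavelet_bound (B : R) i x : (forall x, `|cdv_psi W x| <= B) ->
  (i < cell_count)%N -> `|cell_wavelet i x| <= Num.sqrt (2 ^+ L) * B * \1_(cell i) x.
Proof.
move=> psiB iK; rewrite indicE; case: (asboolP (cell i x)) => xi.
  rewrite mem_set// mulr1 cell_waveletE// normrM ger0_norm ?sqrtr_ge0//.
  by rewrite ler_wpM2l ?sqrtr_ge0.
by rewrite memNset// mulr0 cell_wavelet_support// normr0.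
Qed.

Lemma continuous_cell_wavelet i : continuous (cell_wavelet i).
Proof. exact: continuous_cdv_wavelet. Qed.

Lemma measurable_cell i : measurable (cell i).
Proof. exact: measurable_itv. Qed.

Lemma cell_sub i : (i < cell_count)%N -> cell i `<=` `[0, 1]%classic.
Proof.
move=> iK x; rewrite /cell /= !in_itv/= => /andP[h1 h2].
have p0 : 0 < 2 ^+ L :> R by rewrite exprn_gt0.
apply/andP; split.
  by apply/ltW; apply: le_lt_trans h1; rewrite divr_ge0// ltW.
apply: (le_trans h2); rewrite ler_pdivrMr// mul1r -natrX ler_nat.
have := cell_index_bound iK; rewrite /cell_index; lia.
Qed.

Lemma cell_disjoint i j x : cell i x -> cell j x -> i = j.
Proof.
have p0 : 0 < 2 ^+ L :> R by rewrite exprn_gt0.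
rewrite /cell /= !in_itv/= !ltr_pdivrMr// !ler_pdivlMr//.
move=> /andP[h1 h2] /andP[h3 h4].
have := lt_le_trans h1 h4; have := lt_le_trans h3 h2; rewrite !ltr_nat.
have N0 := cdv_N_gt0; rewrite !ltn_mul2l; lia.
Qed.

Lemma lebesgue_cell i : leb (cell i) = ((2 * N)%:R / 2 ^+ L)%:E.
Proof.
have p0 : 0 < 2 ^+ L :> R by rewrite exprn_gt0.
have N0 := cdv_N_gt0.
rewrite /cell lebesgue_measure_itv/= lte_fin ltr_pM2r ?invr_gt0//.
rewrite ltr_nat ltn_mul2l ifT; last by lia.
by rewrite -EFinB -mulrBl mulnS natrD addrK.
Qed.

Lemma uniform_cell i : (i < cell_count)%N ->
  (uniform_prob (@ltr01 R) (cell i) <= ((2 * N)%:R / 2 ^+ L)%:E)%E.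
Proof.
move=> iK; rewrite -(lebesgue_cell i).
have mc := measurable_cell i.
have -> : uniform_prob (@ltr01 R) (cell i) =
    (\int[uniform_prob (@ltr01 R)]_x (\1_(cell i) x)%:E)%E.
  by rewrite integral_indic// setIT.
rewrite integral_uniform//; last first.
  by apply/measurable_EFinP; exact: measurable_indic.
rewrite subr0 invr1 mul1e integral_indic//.
by apply: le_measure; rewrite ?inE//; exact: measurableI.
Qed.

Lemma integrable_continuous01 (f : R -> R) : continuous f ->
  leb.-integrable `[0, 1]%classic (EFin \o f).
Proof.
move=> cf; apply: continuous_compact_integrable; first exact: segment_compact.
exact: continuous_subspaceT.
Qed.

(** Orthonormality gives norm 1 on [0, 1], and the wavelet vanishes off its cell. *)
Lemma integral_cell_wavelet_sq i : (i < cell_count)%N ->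
  (\int[leb]_(x in cell i) (cell_wavelet i x ^+ 2)%:E = 1)%E.
Proof.
move=> iK.
have cb : continuous (fun x => cell_wavelet i x * cell_wavelet i x).
  by move=> x; apply: cvgM; exact: continuous_cell_wavelet.
have iL : (cell_index i < level_size l0 L)%N.
  by rewrite /level_size gtn_eqF// (leq_ltn_trans _ (cell_index_bound iK))// leq_addr.
have orth := cdv_ortho W_cdv (ltnW l0L) iL (ltnW l0L) iL.
have := congr1 (@EFin R) orth.
rewrite !eqxx /= /dotL2 /Rintegral fineK; last first.
  exact: (integrable_fin_num _ (integrable_continuous01 cb)).
move=> <-; rewrite -(setIidl (cell_sub iK)) integral_mkcondl.
apply: eq_integral => x _; rewrite patchE; case: ifPn => // xi.
rewrite -/(cell_wavelet i) cell_wavelet_support ?mul0r//.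
by move: xi; rewrite notin_setE.
Qed.

End cell_wavelets.

Section dotL2_linear.
Context (R : realType).

Lemma dotL2_linear (u v : R) (g1 g2 h : R -> R) :
  continuous g1 -> continuous g2 -> continuous h ->
  dotL2 (fun x => u * g1 x + v * g2 x) h = u * dotL2 g1 h + v * dotL2 g2 h.
Proof.
move=> c1 c2 ch.
have mI : measurable (`[0, 1]%classic : set (measurableTypeR R)) by exact: measurable_itv.
have i1 : lebesgue_measure.-integrable `[0, 1]%classic (EFin \o (fun x => g1 x * h x)).
  by apply: integrable_continuous01 => x; apply: cvgM; [exact: c1|exact: ch].
have i2 : lebesgue_measure.-integrable `[0, 1]%classic (EFin \o (fun x => g2 x * h x)).
  by apply: integrable_continuous01 => x; apply: cvgM; [exact: c2|exact: ch].
have j1 : lebesgue_measure.-integrable `[0, 1]%classic (EFin \o (fun x => u * (g1 x * h x))).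
  exact: (integrableZl mI u i1).
have j2 : lebesgue_measure.-integrable `[0, 1]%classic (EFin \o (fun x => v * (g2 x * h x))).
  exact: (integrableZl mI v i2).
rewrite /dotL2 -(RintegralZl u mI i1) -(RintegralZl v mI i2).
rewrite -(RintegralD mI j1 j2).
by apply: eq_Rintegral => x _; ring.
Qed.

(** Continuity of the partial sums is proved in the same induction, since it provides the
    integrability needed to split the next integral. *)
Lemma dotL2_sum (I : Type) (r : seq I) (e : I -> R) (g : I -> R -> R) (h : R -> R) :
  (forall i, continuous (g i)) -> continuous h ->
  continuous (fun x => \sum_(i <- r) e i * g i x) /\
  dotL2 (fun x => \sum_(i <- r) e i * g i x) h = \sum_(i <- r) e i * dotL2 (g i) h.
Proof.
move=> cg ch; elim: r => [|i r [ihc ihd]].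
  rewrite (_ : (fun x => _) = cst 0); last by apply/funext => x; rewrite big_nil.
  split; first exact: cst_continuous.
  rewrite big_nil /dotL2 (_ : Rintegral _ _ _ =
    \int[lebesgue_measure]_(x in `[0, 1]%classic) (0 : R)).
    by rewrite Rintegral_cst ?mul0r//; exact: measurable_itv.
  by apply: eq_Rintegral => x _; rewrite mul0r.
have E : (fun x => \sum_(j <- i :: r) e j * g j x) =
   (fun x => e i * g i x + 1 * \sum_(j <- r) e j * g j x).
  by apply/funext => x; rewrite big_cons mul1r.
split.
  rewrite E => x; apply: cvgD; apply: cvgM; try exact: cvg_cst.
  - exact: cg.
  - exact: ihc.
by rewrite E dotL2_linear// ihd big_cons mul1r.
Qed.

End dotL2_linear.

Section perturbation.
Context (R : realType) (A l0 : nat) (W : cdv_system R).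
Hypothesis A0 : (0 < A)%N.
Hypothesis W_cdv : is_cdv_basis A l0 W.
Local Notation leb := (@lebesgue_measure R).
Local Notation RT := (measurableTypeR R).
Variable L : nat.
Hypotheses (l0L : (l0 < L)%N) (NL : (4 * cdv_N W <= 2 ^ L)%N).
Local Notation K := (cell_count W L).
Local Notation wav := (cell_wavelet l0 W L).
Local Notation cell := (cell W L).
Variable a : R.

Definition pert_fun (s : {ffun 'I_K -> bool}) (x : RT) : RT :=
  a * \sum_(i < K) (-1) ^+ s i * wav i x.

Let sum_props (s : {ffun 'I_K -> bool}) h :=
  @dotL2_sum R 'I_K (index_enum 'I_K) (fun i => (-1) ^+ s i)
    (fun i => wav i) h (fun i => @continuous_cell_wavelet _ _ _ _ A0 W_cdv L i).

Lemma continuous_pert_fun s : continuous (pert_fun s).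
Proof.
have [cs _] := sum_props s (@cst_continuous R R 0).
by move=> x; apply: cvgM; [exact: cvg_cst|exact: cs].
Qed.

Lemma measurable_pert_fun s : measurable_fun setT (pert_fun s).
Proof. by apply: continuous_measurable_fun; exact: continuous_pert_fun. Qed.

Definition pert (s : {ffun 'I_K -> bool}) : {mfun RT >-> RT} :=
  HB.pack (pert_fun s) (isMeasurableFun.Build _ _ _ _ _ (measurable_pert_fun s)).

Lemma pert_cell s (i : 'I_K) x : cell i x ->
  pert s x = a * ((-1) ^+ s i * wav i x).
Proof.
move=> xi; rewrite /= /pert_fun (bigD1 i)//= big1 ?addr0// => j ji.
rewrite (cell_wavelet_support A0 W_cdv l0L NL)// ?mulr0// => xj.
by move: ji; rewrite -val_eqE /= (cell_disjoint A0 W_cdv l0L NL xj xi) eqxx.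
Qed.

Lemma pert_flip (B : R) s (i : 'I_K) x : 0 <= a -> (forall x, `|cdv_psi W x| <= B) ->
  `|pert (flip i s) x - pert s x| <=
  2 * a * (Num.sqrt (2 ^+ L) * B) * \1_(cell i) x.
Proof.
move=> a0 psiB; rewrite /= /pert_fun -mulrBr -sumrB (bigD1 i)//= big1; last first.
  by move=> j ji; rewrite ffunE (negbTE ji) subrr.
rewrite addr0 ffunE eqxx -mulrBl normrM (ger0_norm a0) normrM.
have -> : `|(-1) ^+ (~~ s i) - (-1) ^+ s i| = 2 :> R.
  case: (s i); rewrite !expr0 !expr1.
    by rewrite opprK ger0_norm//; lra.
  by rewrite ler0_norm; lra.
have := cell_wavelet_bound A0 W_cdv l0L NL x psiB (ltn_ord i).
move=> /(ler_wpM2l (_ : 0 <= a * 2)) h.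
have -> : 2 * a * (Num.sqrt (2 ^+ L) * B) * \1_(cell i) x =
  a * 2 * (Num.sqrt (2 ^+ L) * B * \1_(cell i) x) by ring.
by rewrite mulrA h// mulr_ge0.
Qed.

Lemma wavelet_coef_pert s l k : (l0 <= l)%N -> (k < level_size l0 l)%N -> 0 <= a ->
  `|wavelet_coef W l0 (pert s) l k| <= a * (l == L)%:R.
Proof.
move=> l0l kl a0; rewrite /wavelet_coef.
have cw := @continuous_cdv_wavelet _ _ _ _ A0 W_cdv l k.
have [cs ds] := sum_props s cw.
have -> : dotL2 (pert s) (cdv_wavelet W l0 l k) =
    a * \sum_(i < K) (-1) ^+ s i * ((L == l) && (cell_index W i == k))%:R.
  transitivity (dotL2 (fun x => a * (\sum_(i < K) (-1) ^+ s i * wav i x) + 0 * cst 0 x)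
     (cdv_wavelet W l0 l k)).
    by apply: eq_Rintegral => x _; rewrite /= /pert_fun mul0r addr0.
  rewrite dotL2_linear//; last exact: cst_continuous.
  rewrite mul0r addr0 ds; congr (_ * _); apply: eq_bigr => i _; congr (_ * _).
  apply: (cdv_ortho W_cdv) => //; first exact: ltnW.
  rewrite /level_size gtn_eqF//.
  by rewrite (leq_ltn_trans _ (cell_index_bound A0 W_cdv l0L NL (ltn_ord i)))// leq_addr.
rewrite normrM (ger0_norm a0) ler_wpM2l//.
case: (eqVneq l L) => lL /=; last by rewrite big1 ?normr0// => i _; rewrite mulr0.
case: (pickP (fun i : 'I_K => cell_index W i == k)) => [i ik|ik].
  rewrite (bigD1 i)//= big1 ?addr0.
    by rewrite ik mulr1 normrX normrN1 expr1n.
  move=> j ji; case: eqP => [jk|]; last by rewrite mulr0.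
  case/negP: ji; rewrite -val_eqE /=; move: ik jk => /eqP <-.
  rewrite /cell_index => /eqP; rewrite eqn_add2l eqn_mul2l muln_eq0/=.
  by rewrite gtn_eqF ?(cdv_N_gt0 A0 W_cdv).
by rewrite big1 ?normr0// => i _; rewrite ik mulr0.
Qed.

(** Only level [L] is present, with norm at most 2^(L/p) [a]. The factor 2^(L/p) cancels the -1/p in
    the Besov weight, so the condition on [a] involves neither [p] nor [q]. *)
Lemma pert_in_besov_ball s (alpha rad : R) (p q : \bar R) :
  (1 <= p)%E -> (1 <= q)%E -> 0 <= a ->
  2 `^ (L%:R * (alpha + 2^-1)) * a <= rad ->
  besov_ball W l0 alpha p q rad (pert s).
Proof.
move=> p1 q1 a0 arad; split.
  have i1 : leb.-integrable `[0, 1]%classic (EFin \o (fun x => pert_fun s x ^+ 2)).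
    apply: integrable_continuous01 => x; apply: cvgM; exact: continuous_pert_fun.
  have /integrableP[_] := i1; rewrite /sqnormL2; congr (_ < _)%E.
  by apply: eq_integral => x _; rewrite /= ger0_norm// sqr_ge0.
have rad0 : 0 <= rad by apply: le_trans arad; rewrite mulr_ge0// powR_ge0.
pose gam := fine (p^-1)%E.
have lev l : (l0 <= l)%N ->
    (level_norm W l0 p (pert s) l <=
     ((level_size l0 l)%:R `^ gam * (a * (l == L)%:R))%:E)%E.
  move=> l0l; rewrite /level_norm.
  have ls : (\sum_(0 <= k < level_size l0 l) predT k = level_size l0 l)%N.
    by rewrite sum_nat_const_nat subn0 muln1.
  rewrite -{2}ls; apply: Lnorm_counting_le => //.
  - by rewrite mulr_ge0.
  - move=> k; case: ifPn => kl; last by rewrite abse0 lee_fin mulr_ge0.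
    by rewrite lee_fin; exact: wavelet_coef_pert.
  - by move=> k /=; rewrite ltnNge => ->.
  - by rewrite ls /level_size; case: ifP => _; rewrite expn_gt0.
rewrite /besov_norm.
have sL : (\sum_(0 <= k < L.+1) (pred1 L k : nat) = 1)%N.
  rewrite big_nat_recr//= eqxx big_nat_cond big1// => k /andP[/andP[_ kL] _].
  by rewrite ltn_eqF.
have -> : rad%:E = (((\sum_(0 <= k < L.+1) (pred1 L k : nat))%N%:R `^ (fine (q^-1)%E)) * rad)%:E.
  by rewrite sL powR1 mul1r.
apply: Lnorm_counting_le => //.
- move=> l; case: ifPn => l0l; last by rewrite abse0 lee_fin.
  have w0 : (0 <= (2 `^ (l%:R * (alpha + 2^-1 - fine p^-1)))%:E :> \bar R)%E.
    by rewrite lee_fin powR_ge0.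
  rewrite gee0_abs; last by rewrite mule_ge0//; exact: Lnorm_ge0.
  have h := lev l l0l.
  apply: (le_trans (lee_wpmul2l _ h)); first by rewrite lee_fin powR_ge0.
  rewrite -EFinM lee_fin; case: (eqVneq l L) => [->|_]; last by rewrite !mulr0.
  rewrite mulr1 /level_size gtn_eqF// natrX -powR_mulrn// -powRrM.
  rewrite mulrA -powRD ?pnatr_eq0 ?implybT//.
  apply: le_trans arad; rewrite ler_wpM2r// le_eqVlt; apply/orP; left; apply/eqP.
  by congr (_ `^ _); rewrite /gam; ring.
- move=> l /=; case: (eqVneq l L) => [->|lL _] /=; first by rewrite ltnn.
  case: ifPn => // l0l; have := lev l l0l.
  rewrite (negbTE lL) !mulr0 => h.
  have -> : level_norm W l0 p (pert s) l = 0%E.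
    by apply/eqP; rewrite eq_le h; exact: Lnorm_ge0.
  by rewrite mule0.
- by rewrite sL.
Qed.

Section losses.
Context d (T : measurableType d) (est : {mfun (T * RT)%type >-> RT}).

Definition cell_loss (i : 'I_K) (b : bool) (t : T) : \bar R :=
  (\int[leb]_(x in cell i) (((est (t, x) : R) - a * ((-1) ^+ b * wav i x)) ^+ 2)%:E)%E.

Let measurable_cell_wavelet i : measurable_fun setT (wav i : RT -> RT).
Proof.
by apply: continuous_measurable_fun => x; exact: (continuous_cell_wavelet A0 W_cdv).
Qed.

Let measurable_resid (t : T) (g : RT -> R) : measurable_fun setT g ->
  measurable_fun setT (fun x : RT => (((est (t, x) : R) - g x) ^+ 2)%:E).
Proof.
move=> mg; apply/measurable_EFinP; apply: measurable_funX.
apply: measurable_funB => //.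
exact: (measurableT_comp (measurable_funP est) (@measurable_pair1 _ _ T RT t)).
Qed.

Let measurable_target i b : measurable_fun setT (fun x : RT => a * ((-1) ^+ b * wav i x)).
Proof.
by apply: measurable_funM; [exact: measurable_cst|apply: measurable_funM;
  [exact: measurable_cst|exact: measurable_cell_wavelet]].
Qed.

Lemma cell_loss_ge0 i b t : (0 <= cell_loss i b t)%E.
Proof. by apply: integral_ge0 => x _; rewrite lee_fin sqr_ge0. Qed.

Lemma measurable_cell_loss i b : measurable_fun setT (cell_loss i b).
Proof.
pose F (w : T * RT) : \bar R :=
  ((((est w : R) - a * ((-1) ^+ b * wav i w.2)) ^+ 2) * \1_(cell i) w.2)%:E.
have mF : measurable_fun setT F.
  apply/measurable_EFinP; apply: measurable_funM.
    apply: measurable_funX; apply: measurable_funB; first exact: (measurable_funP est).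
    exact: (measurableT_comp (measurable_target i b) measurable_snd).
  apply: (measurableT_comp _ measurable_snd); apply: measurable_indic.
  exact: measurable_cell.
have F0 w : (0 <= F w)%E by rewrite lee_fin mulr_ge0// sqr_ge0.
rewrite (_ : cell_loss i b = fubini_F leb F); first exact: measurable_fun_fubini_tonelli_F.
apply/funext => t; rewrite /cell_loss /fubini_F [LHS]integral_mkcond.
apply: eq_integral => x _; rewrite patchE /F /= indicE.
by case: ifP => _; rewrite ?mulr1// mulr0.
Qed.

(** Pointwise, (u - v)^2 + (u + v)^2 >= 2 v^2, with v the wavelet times [a], whose square integrates
    to [a ^+ 2] over the cell. *)
Lemma cell_loss_sum_ge i t :
  ((2 * a ^+ 2)%:E <= cell_loss i false t + cell_loss i true t)%E.
Proof.
have mc := measurable_cell W L i.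
have mr b : measurable_fun (cell i) (fun x : RT =>
    (((est (t, x) : R) - a * ((-1) ^+ b * wav i x)) ^+ 2)%:E).
  by apply: measurable_funTS; apply: measurable_resid; exact: measurable_target.
rewrite /cell_loss -ge0_integralD//; [|by move=> x _; rewrite lee_fin sqr_ge0..].
have -> : (2 * a ^+ 2)%:E =
    (\int[leb]_(x in cell i) ((2 * a ^+ 2)%:E * (wav i x ^+ 2)%:E))%E.
  rewrite ge0_integralZl//.
  - by rewrite (integral_cell_wavelet_sq A0 W_cdv l0L NL)// mule1.
  - apply/measurable_EFinP; apply: measurable_funTS; apply: measurable_funX.
    exact: measurable_cell_wavelet.
  - by move=> x _; rewrite lee_fin sqr_ge0.
  - by rewrite lee_fin mulr_ge0// sqr_ge0.
apply: ge0_le_integral => //.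
- move=> x _; rewrite -EFinM lee_fin; apply: mulr_ge0; last exact: sqr_ge0.
  by apply: mulr_ge0 => //; exact: sqr_ge0.
- apply: measurable_funeM; apply/measurable_EFinP; apply: measurable_funTS.
  by apply: measurable_funX; exact: measurable_cell_wavelet.
- exact: emeasurable_funD.
move=> x _; rewrite -EFinD -EFinM lee_fin expr0 expr1.
have := sqr_ge0 (est (t, x) : R); rewrite !expr2; nra.
Qed.

(** The cells are disjoint subsets of [0, 1], and on each of them the perturbation reduces to its
    own wavelet. *)
Lemma cell_loss_le (s : {ffun 'I_K -> bool}) t :
  (\sum_(i < K) cell_loss i (s i) t <=
   sqnormL2 (fun x => (est (t, x) : R) - pert s x)%R)%E.
Proof.
have mr : measurable_fun setT (fun x : RT =>
    (((est (t, x) : R) - pert s x) ^+ 2)%:E).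
  by apply: measurable_resid; exact: measurable_pert_fun.
have r0 x : (0 <= (((est (t, x) : R) - pert s x) ^+ 2)%:E)%E.
  by rewrite lee_fin sqr_ge0.
pose U : set RT := \big[setU/set0]_(i < K) cell i.
have mU : measurable U by apply: bigsetU_measurable => i _; exact: measurable_cell.
apply: (@le_trans _ _ (\int[leb]_(x in U) (((est (t, x) : R) - pert s x) ^+ 2)%:E)%E).
  rewrite ge0_integral_bigsetU//=.
  - apply: lee_sum => i _; rewrite /cell_loss le_eqVlt; apply/orP; left; apply/eqP.
    apply: eq_integral => x; rewrite inE => xi; congr (_%:E).
    by have := pert_cell s xi; rewrite /= => ->.
  - by move=> i; exact: measurable_cell.
  - exact: index_enum_uniq.
  - move=> i j _ _ [x [xi xj]]; apply: val_inj => /=.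
    exact: (cell_disjoint A0 W_cdv l0L NL xi xj).
  - exact: measurable_funTS.
apply: ge0_subset_integral => //.
- exact: measurable_funTS.
move=> x; rewrite /U -bigcup_seq => -[i _]; exact: (cell_sub A0 W_cdv l0L NL (ltn_ord i)).
Qed.

End losses.

End perturbation.

(** * Information budget of a server *)

Section budget_inequalities.
Context (R : realType).

Lemma expRB1_le (x c : R) : 0 <= x <= c -> expR x - 1 <= x * expR c.
Proof.
move=> /andP[x0 xc]; have := norm_expRB1 x; rewrite (ger0_norm x0).
move=> /(le_trans (ler_norm _)) /le_trans; apply.
by rewrite ler_wpM2l// ler_expR.
Qed.

Lemma exprB1_le (n : nat) (x : R) : 0 <= x -> n%:R * x <= 1 ->
  (1 + x) ^+ n - 1 <= expR 1 * (n%:R * x).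
Proof.
move=> x0 nx; have nx0 : 0 <= n%:R * x by rewrite mulr_ge0.
have := @expRB1_le (n%:R * x) 1; rewrite nx0 nx => /(_ isT).
rewrite [n%:R * x * _]mulrC => h; apply: le_trans h; rewrite lerD2r.
rewrite expRM_natl; apply: lerXn2r; rewrite ?nnegrE ?expR_ge0//.
  by rewrite addr_ge0.
exact: expR_ge1Dx.
Qed.

Lemma tilt_const_le (i j : nat) : (i <= j)%N -> tilt_const R i <= tilt_const R j.
Proof.
move=> ij; rewrite /tilt_const ler_wpM2l// ler_expR lerD// ler_wpM2l ?ler_nat//.
by rewrite lerXn2r ?nnegrE ?ler_nat.
Qed.

Lemma tilt_const_gt0 (j : nat) : 0 < tilt_const R j.
Proof. by rewrite mulr_gt0// expR_gt0. Qed.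

(* The assumption on [delta], where [rho / y] is the n^(1/2) eps^2 / D of the
   theorem, is used through [rho^(-1/r)], the factor by which the clipping
   level exceeds the size of the fluctuations of the likelihood ratio. *)
Lemma delta_budget (kappa rho y delta : R) (r : nat) :
  0 < rho <= 1 -> 1 <= y -> (0 < r)%N -> r%:R^-1 <= kappa ->
  0 <= delta <= (rho / y) `^ (1 + kappa) ->
  delta * rho `^ (- r%:R^-1) <= rho / y.
Proof.
move=> /andP[r0 r1] y1 rn rk /andP[d0 dle].
have y0 : 0 < y by exact: lt_le_trans y1.
have ry0 : 0 < rho / y by rewrite divr_gt0.
have ryr : rho / y <= rho by rewrite ler_pdivrMr// ler_peMr// ltW.
have k0 : 0 <= kappa by apply: le_trans rk; rewrite invr_ge0.
apply: (le_trans (ler_wpM2r (powR_ge0 _ _) dle)).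
rewrite powRD ?(gt_eqF ry0) ?implybT// powRr1 ?(ltW ry0)// -(mulrA (rho / y)).
rewrite -[leRHS]mulr1 ler_wpM2l ?(ltW ry0)//.
apply: (@le_trans _ _ (rho `^ (r%:R^-1) * rho `^ (- r%:R^-1))).
  rewrite ler_wpM2r ?powR_ge0//.
  apply: (@le_trans _ _ (rho `^ kappa)).
    by rewrite ge0_ler_powR ?nnegrE ?(ltW ry0) ?(ltW r0).
  by rewrite ger_powR// r0.
by rewrite -powRD ?(gt_eqF r0) ?implybT// subrr powRr0.
Qed.

End budget_inequalities.

Section moments_of_tilt.
Context (R : realType).
Local Notation RT := (measurableTypeR R).
Variables (f g : {mfun RT >-> RT}) (I : set RT) (beta pi0 : R) (n r : nat).
Hypotheses (mI : measurable I) (beta01 : 0 <= beta <= 1) (odr : ~~ odd r).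
Hypothesis fg : forall x, `|g x - f x| <= beta * \1_I x.
Hypothesis Ipi : (uniform_prob (@ltr01 R) I <= pi0%:E)%E.

Let C0 := tilt_const R r.+2.

(** The last hypothesis says that [n] times the growth rate of the moment recursion is at most 1, so
    that its solution is linear in [n] up to the factor [expR 1]. *)
Lemma tilt_likelihood_moment (b : R) : 0 < b <= 1 -> beta <= b ->
  2 * 4 ^+ r.+2 * C0 * (n%:R * (beta ^+ 2 * pi0)) <= b ^+ 2 ->
  (\int[tuple_prob (fun _ : 'I_n => obs_law f)]_z
     ((likelihood (tilt f g) z - 1) ^+ r.+2)%:E <=
   (expR 1 * (2 * 4 ^+ r.+2 * C0) * (n%:R * (beta ^+ 2 * pi0)) * b ^+ r)%:E)%E.
Proof.
move=> b01 betab qb.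
have /andP[b0 b1] := b01; have /andP[beta0 beta1] := beta01.
have bn0 : b != 0 by rewrite gt_eqF.
have pi00 : 0 <= pi0 by rewrite -lee_fin (le_trans _ Ipi).
have C00 : 0 <= C0 by rewrite ltW// tilt_const_gt0.
(* Two equal contributions: the second moment, and the moment of order [r.+2] divided by [b ^+ r],
   which is no larger because [beta <= b]. *)
pose kap := 2 * C0 * (beta ^+ 2 * pi0).
have kap0 : 0 <= kap by rewrite !mulr_ge0// sqr_ge0.
have mt := @measurable_tilt _ f g.
have mB j : measurable_fun setT (fun z : obs R => `|tilt f g z - 1| ^+ j).
  by apply: measurable_funX; apply: measurableT_comp => //; exact: measurable_funB.
have mom j : (0 < j)%N -> (j <= r.+2)%N ->
    (\int[obs_law f]_z (`|tilt f g z - 1| ^+ j)%:E <= (C0 * beta ^+ j * pi0)%:E)%E.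
  move=> j0 jr; apply: (le_trans (obs_moment mI beta01 j0 fg Ipi)).
  by rewrite lee_fin ler_wpM2r// ler_wpM2r ?exprn_ge0// tilt_const_le.
have kapP : (\int[obs_law f]_z
  ((tilt f g z - 1) ^+ 2 + b ^+ 2 * ((tilt f g z - 1) / b) ^+ r.+2)%:E <= kap%:E)%E.
  have E z : ((tilt f g z - 1) ^+ 2 + b ^+ 2 * ((tilt f g z - 1) / b) ^+ r.+2)%:E =
      ((`|tilt f g z - 1| ^+ 2)%:E + (b ^- r)%:E * (`|tilt f g z - 1| ^+ r.+2)%:E)%E.
    rewrite -EFinM -EFinD; congr (_%:E).
    rewrite -!normrX ger0_norm ?sqr_ge0// ger0_norm ?even_pow_ge0//.
    congr (_ + _); rewrite exprMn exprVn -(addn2 r) (exprD b) invfM.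
    by move: (b ^- r) => w; move: (_ ^+ (r + 2)) => u; field.
  under eq_integral do rewrite E.
  rewrite ge0_integralD//; last 3 first.
  - by apply/measurable_EFinP; exact: mB.
  - by move=> z _; rewrite mule_ge0// lee_fin ?invr_ge0 ?exprn_ge0// ltW.
  - by apply: measurable_funeM; apply/measurable_EFinP; exact: mB.
  rewrite ge0_integralZl//; last 2 first.
  - by apply/measurable_EFinP; exact: mB.
  - by rewrite lee_fin invr_ge0 exprn_ge0// ltW.
  apply: (le_trans (leeD (mom 2 isT isT)
    (lee_wpmul2l _ (mom r.+2 isT (leqnn _))))).
    by rewrite lee_fin invr_ge0 exprn_ge0// ltW.
  rewrite -EFinM -EFinD lee_fin /kap.
  have h : b ^- r * beta ^+ r <= 1.
    by rewrite mulrC ler_pdivrMr ?exprn_gt0// mul1r lerXn2r// nnegrE// ltW.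
  have -> : b ^- r * (C0 * beta ^+ r.+2 * pi0) =
    (b ^- r * beta ^+ r) * (C0 * beta ^+ 2 * pi0).
    by rewrite -addn2 exprD; ring.
  have := ler_wpM2r (_ : 0 <= C0 * beta ^+ 2 * pi0) h.
  rewrite !mulr_ge0 ?sqr_ge0// => /(_ isT); lra.
have th0 : 0 <= 4 ^+ r.+2 / b ^+ 2 * kap by rewrite mulr_ge0// divr_ge0 ?sqr_ge0// exprn_ge0.
apply: (le_trans (likelihood_moments mt (@tilt_ge0 _ f g) (obs_density f g) odr b01 kap0 kapP n)).
rewrite lee_fin.
have thE : n%:R * (4 ^+ r.+2 / b ^+ 2 * kap) =
   2 * 4 ^+ r.+2 * C0 * (n%:R * (beta ^+ 2 * pi0)) / b ^+ 2.
  by rewrite /kap; ring.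
have th1 : n%:R * (4 ^+ r.+2 / b ^+ 2 * kap) <= 1.
  by rewrite thE ler_pdivrMr ?exprn_gt0// mul1r.
have := exprB1_le th0 th1; rewrite thE => /(ler_wpM2l (exprn_ge0 r.+2 (ltW b0))).
move=> /le_trans; apply; rewrite le_eqVlt; apply/orP; left; apply/eqP.
by rewrite -(addn2 r) (exprD b); field.
Qed.

End moments_of_tilt.

Section budget_terms.
Context (R : realType).
Variables (b1 b2 C0 K a eps y D : R).
Hypotheses (b10 : 0 < b1) (b20 : 0 < b2) (C00 : 0 < C0) (K1 : 1 <= K)
  (a0 : 0 < a) (eps0 : 0 < eps) (y1 : 1 <= y) (D1 : 1 <= D) (DK : D <= K ^+ 2).

Let K0 : 0 < K. Proof. exact: lt_le_trans K1. Qed.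
Let y0 : 0 < y. Proof. exact: lt_le_trans y1. Qed.
Let D0 : 0 < D. Proof. exact: lt_le_trans D1. Qed.
(** In this section [y] stands for the square root of the number of observations and [K] for that of
    2^L. Then [b1 * a * K] bounds the perturbation, [b2 / K ^+ 2] the mass of its cell, and [tau]
    the L1 distance between the laws of one observation. *)
Let tau := C0 * (b1 * a * K) * (b2 / K ^+ 2).
Let rho := y ^+ 2 * eps ^+ 2 / D.
Let w := a ^+ 2 / D * ((y ^+ 2) ^+ 2 * eps ^+ 2).

Let tauE : tau = C0 * b1 * b2 * a / K.
Proof. by rewrite /tau; field; rewrite gt_eqF. Qed.

Let rho0 : 0 < rho.
Proof. by rewrite divr_gt0// mulr_gt0// exprn_gt0. Qed.

Let rhoE : a ^+ 2 * y ^+ 2 * rho = w.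
Proof. by rewrite /rho /w; field; rewrite gt_eqF. Qed.

(** Up to constants, [tau] is a / K and [g] is [eps]; one factor 1 / K^2 becomes 1 / D by [DK]. *)
Lemma budget_privacy (E g : R) : 0 <= g <= eps * E ->
  (y ^+ 2 * (tau * g)) ^+ 2 <= (E * C0 * b1 * b2) ^+ 2 * w.
Proof.
move=> /andP[g0 gE].
have tau0 : 0 < tau by rewrite tauE divr_gt0// !mulr_gt0.
apply: (@le_trans _ _ ((y ^+ 2 * (tau * (eps * E))) ^+ 2)).
  have t0 : 0 <= y ^+ 2 * (tau * g).
    by apply: mulr_ge0; [exact: sqr_ge0|apply: mulr_ge0 => //; exact: ltW].
  have tE : y ^+ 2 * (tau * g) <= y ^+ 2 * (tau * (eps * E)).
    by apply: ler_wpM2l; [exact: sqr_ge0|apply: ler_wpM2l => //; exact: ltW].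
  by apply: lerXn2r => //; rewrite nnegrE//; exact: le_trans tE.
have -> : (y ^+ 2 * (tau * (eps * E))) ^+ 2 =
    (E * C0 * b1 * b2 * a * y ^+ 2 * eps) ^+ 2 * (K ^+ 2)^-1.
  by rewrite tauE; field; rewrite gt_eqF.
have -> : (E * C0 * b1 * b2) ^+ 2 * w = (E * C0 * b1 * b2 * a * y ^+ 2 * eps) ^+ 2 * D^-1.
  by rewrite /w; field; rewrite gt_eqF.
by rewrite ler_wpM2l ?sqr_ge0// lef_pV2 ?posrE ?exprn_gt0.
Qed.

(** The inflation [lam] of the clipping level is paid by [delta], leaving [y * tau * rho * b]. As
    [w] is a^2 y^2 rho and [tau] is of order a / K, the part of [b] of order a K costs a^2 y rho and
    the part of order a y costs a^2 y^2 rho / K; use [y >= 1] and [K >= 1]. *)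
Lemma budget_delta (S lam b delta c : R) : 0 <= S -> 0 <= delta -> delta * lam <= rho / y ->
  0 <= b <= b1 * a * K + S * (b1 * a * y) -> c <= lam * b ->
  y ^+ 2 * tau * delta * c <= C0 * b1 ^+ 2 * b2 * (1 + S) * w.
Proof.
move=> S0 d0 dl /andP[bb0 bS] clb.
have tau0 : 0 < tau by rewrite tauE divr_gt0// !mulr_gt0.
apply: (@le_trans _ _ (y * tau * rho * b)).
  have -> : y * tau * rho * b = y ^+ 2 * tau * (rho / y * b).
    by field; rewrite gt_eqF.
  rewrite -mulrA; apply: ler_wpM2l.
    by apply: mulr_ge0; [exact: sqr_ge0|exact: ltW].
  apply: (le_trans (ler_wpM2l d0 clb)); rewrite mulrA.
  exact: ler_wpM2r.
apply: (@le_trans _ _ (y * tau * rho * (b1 * a * K + S * (b1 * a * y)))).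
  apply: ler_wpM2l => //.
  by apply: mulr_ge0; [apply: mulr_ge0|]; exact: ltW.
rewrite mulrDr mulrDr mulr1 mulrDl; apply: lerD.
  rewrite tauE -rhoE.
  have -> : y * (C0 * b1 * b2 * a / K) * rho * (b1 * a * K) =
    (C0 * b1 ^+ 2 * b2 * a ^+ 2 * rho) * y by field; rewrite gt_eqF.
  have -> : C0 * b1 ^+ 2 * b2 * (a ^+ 2 * y ^+ 2 * rho) =
    (C0 * b1 ^+ 2 * b2 * a ^+ 2 * rho) * y ^+ 2 by ring.
  apply: ler_wpM2l; first by rewrite ltW// (pmulr_lgt0 _ rho0) !mulr_gt0.
  by rewrite expr2 ler_peMr// ltW.
rewrite tauE -rhoE.
have -> : y * (C0 * b1 * b2 * a / K) * rho * (S * (b1 * a * y)) =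
  (C0 * b1 ^+ 2 * b2 * S * (a ^+ 2 * y ^+ 2 * rho)) / K by field; rewrite gt_eqF.
rewrite ler_pdivrMr// ler_peMr//; apply: mulr_ge0; last first.
  by rewrite ltW// (pmulr_lgt0 _ rho0) !mulr_gt0.
by apply: mulr_ge0 => //; rewrite ltW// !mulr_gt0.
Qed.

End budget_terms.

Section private_kernels.
Context (R : realType) d (T : measurableType d) (n : nat) (eps delta : R).
Variable k : R.-pker n.-tuple (obs R) ~> T.
Hypothesis kDP : diff_private eps delta k.

(** Privacy at the empty event, for two equal data sets. *)
Lemma diff_private_ge0 : 0 <= delta.
Proof.
pose z := [tuple of nseq n ((0, 0) : obs R)].
have zi i : in_sample_space (tnth z i).
  by rewrite tnth_nseq /in_sample_space/= lexx ler01.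
have := kDP zi zi _ measurable0.
rewrite !measure0 mule0 add0e lee_fin; apply.
by rewrite eq_card0// => i; rewrite !inE eqxx.
Qed.

Lemma diff_private_clip i (z z' : n.-tuple (obs R)) :
  (forall j, j != i -> tnth z j = tnth z' j) ->
  forall A, measurable A ->
  (kernel_law k (clip_tuple (@clip_obs R) z) A <=
   (expR eps)%:E * kernel_law k (clip_tuple (@clip_obs R) z') A + delta%:E)%E.
Proof.
move=> zz' A mA; apply: kDP => //.
- by move=> j; rewrite tnth_mktuple; exact: clip_obs_sample.
- by move=> j; rewrite tnth_mktuple; exact: clip_obs_sample.
apply: leq_trans (subset_leq_card _) (eq_leq (card1 i)).
apply/fintype.subsetP => j; rewrite !inE !tnth_mktuple; apply: contraNT => /zz' ->.
exact/eqP.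
Qed.

End private_kernels.

Section server_budget.
Context (R : realType).
Local Notation RT := (measurableTypeR R).
Variables (kappa Ceps b1 b2 : R) (r : nat).
Hypotheses (kappa0 : 0 < kappa) (b10 : 0 < b1) (b20 : 0 < b2).
Hypotheses (odr : ~~ odd r) (r0 : (0 < r)%N) (rk : r%:R^-1 <= kappa).

Let C0 := tilt_const R r.+2.
Let C1 := 2 * 4 ^+ r.+2 * C0.
Let S := Num.sqrt (C1 * b2).
Let E := expR Ceps.

(** Contributions of [eps], of [delta] and of the tail; the coefficients 2, 4 and 1/2 are half of
    the 4, 8 and 1 in [server_affinity_private]. *)
Definition budget_const : R :=
  2 * (E * C0 * b1 * b2) ^+ 2 + 4 * (C0 * b1 ^+ 2 * b2 * (1 + S)) +
  2^-1 * (expR 1 * C1) * (b1 ^+ 2 * b2).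

Let C00 : 0 < C0. Proof. exact: tilt_const_gt0. Qed.
Let C10 : 0 < C1. Proof. by rewrite mulr_gt0// mulr_gt0// exprn_gt0. Qed.
Let S0 : 0 <= S. Proof. exact: sqrtr_ge0. Qed.
Let E0 : 0 < E. Proof. exact: expR_gt0. Qed.

Let t1 : 0 < (E * C0 * b1 * b2) ^+ 2.
Proof. by rewrite exprn_gt0// !mulr_gt0. Qed.
Let t2 : 0 < C0 * b1 ^+ 2 * b2 * (1 + S).
Proof. by rewrite mulr_gt0 ?ltr_wpDr// !mulr_gt0. Qed.
Let t3 : 0 < C1 * (b1 ^+ 2 * b2).
Proof. by rewrite mulr_gt0// mulr_gt0// exprn_gt0. Qed.

Let e1 : 1 <= expR 1 :> R.
Proof. by apply: le_trans (expR_ge1Dx 1); rewrite lerDl. Qed.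

Let p1 : 0 < 2 * (E * C0 * b1 * b2) ^+ 2.
Proof. exact: mulr_gt0 t1. Qed.
Let p2 : 0 < 4 * (C0 * b1 ^+ 2 * b2 * (1 + S)).
Proof. exact: mulr_gt0 t2. Qed.
Let p3 : 0 < 2^-1 * (expR 1 * C1) * (b1 ^+ 2 * b2).
Proof. by rewrite -mulrA -[expR 1 * _ * _]mulrA; do 2 apply: mulr_gt0 => //; exact: expR_gt0. Qed.

Lemma budget_const_gt0 : 0 < budget_const.
Proof. exact: addr_gt0 (addr_gt0 p1 p2) p3. Qed.

Section one_server.
Context d (T : measurableType d) (n : nat) (k : R.-pker n.-tuple (obs R) ~> T).
Hypothesis mk : forall U, measurable U -> measurable_fun setT (fun z => kernel_law k z U).
Variables (f g : {mfun RT >-> RT}) (I : set RT) (eps delta D K a : R) (phi : T -> R).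
Hypotheses (mI : measurable I) (K1 : 1 <= K) (a0 : 0 < a) (D1 : 1 <= D)
  (DK : D <= K ^+ 2) (beta1 : b1 * a * K <= 1)
  (fg : forall x, `|g x - f x| <= b1 * a * K * \1_I x)
  (Ipi : (uniform_prob (@ltr01 R) I <= (b2 / K ^+ 2)%:E)%E)
  (eps0 : 0 < eps) (epsC : eps <= Ceps)
  (delta_small : delta < (Num.sqrt n%:R * eps ^+ 2 * D^-1) `^ (1 + kappa))
  (kDP : diff_private eps delta k).
Hypotheses (mphi : measurable_fun setT phi) (phi0 : forall y, 0 <= phi y)
  (dphi : is_density (mixture (data_law f n) mk) (mixture (data_law g n) mk) phi).

Let w := a ^+ 2 / D * Num.min (n%:R ^+ 2 * eps ^+ 2) (n%:R * D).
Hypothesis w_small : budget_const * w <= 2^-1.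

Let D0 : 0 < D. Proof. exact: lt_le_trans D1. Qed.
Let K0 : 0 < K. Proof. exact: lt_le_trans K1. Qed.
Let beta := b1 * a * K.
Let pi0 := b2 / K ^+ 2.
Let q := n%:R * (beta ^+ 2 * pi0).
Let qE : q = b1 ^+ 2 * b2 * (n%:R * a ^+ 2).
Proof. by rewrite /q /beta /pi0; field; rewrite gt_eqF. Qed.
Let beta01 : 0 <= beta <= 1.
Proof. by rewrite beta1 andbT ltW// !mulr_gt0. Qed.
Let mt := @measurable_tilt _ f g.
Let w0 : 0 <= w.
Proof.
rewrite mulr_ge0// ?divr_ge0 ?sqr_ge0 ?(ltW D0)// le_min !mulr_ge0 ?(ltW eps0) ?(ltW D0)//.
Qed.

Let bc_le (x : R) : x <= budget_const -> x * w <= 2^-1.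
Proof. by move=> xb; apply: le_trans w_small; exact: ler_wpM2r. Qed.

(** Here [w] is [n%:R * a ^+ 2], the information in the data themselves, so data processing
    suffices. *)
Lemma budget_many_observations : D <= n%:R * eps ^+ 2 ->
  1 - budget_const * w <= \int[mixture (data_law f n) mk]_y Num.sqrt (phi y).
Proof.
move=> De.
have wE : w = n%:R * a ^+ 2.
  rewrite /w min_r; first by field; rewrite gt_eqF.
  by rewrite expr2 -mulrA ler_wpM2l.
(* The second moment is the case of exponent 0; its constant is dominated by the one for [r]. *)
have C32 : 2 * 4 ^+ 2 * tilt_const R 2 <= C1.
  apply: ler_pM.
  - by apply: mulr_ge0 => //; exact: exprn_ge0.
  - by rewrite ltW// tilt_const_gt0.
  - by apply: ler_wpM2l => //; rewrite ler_eXn2l// ltr1n.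
  - exact: tilt_const_le.
have q0 : 0 <= q by rewrite qE -wE mulr_ge0// ltW// mulr_gt0// exprn_gt0.
have q1 : 2 * 4 ^+ 2 * tilt_const R 2 * q <= 1 ^+ 2.
  apply: (le_trans (ler_wpM2r q0 C32)); rewrite qE -wE mulrA expr1n.
  have : 2^-1 * (expR 1 * C1) * (b1 ^+ 2 * b2) <= budget_const.
    by rewrite /budget_const lerDr ltW// (addr_gt0 p1 p2).
  move=> /bc_le.
  have -> : 2^-1 * (expR 1 * C1) * (b1 ^+ 2 * b2) * w =
    2^-1 * (expR 1 * (C1 * (b1 ^+ 2 * b2) * w)) by ring.
  have : C1 * (b1 ^+ 2 * b2) * w <= expR 1 * (C1 * (b1 ^+ 2 * b2) * w).
    by rewrite ler_peMl// mulr_ge0// ltW.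
  lra.
have one01 : (0 : R) < 1 <= (1 : R) by apply/andP; split.
have b1' : beta <= 1 by case/andP: beta01.
have LM := @tilt_likelihood_moment _ f g I beta pi0 n 0 mI beta01 isT fg Ipi 1 one01 b1' q1.
have := server_affinity_information mt (@tilt_ge0 _ f g) (obs_density f g) mphi phi0 dphi LM.
apply: le_trans; rewrite lerD2l lerN2 expr0 mulr1.
apply: (@le_trans _ _ (2^-1 * (expR 1 * C1) * (b1 ^+ 2 * b2) * w)).
  have -> : 2^-1 * (expR 1 * C1) * (b1 ^+ 2 * b2) * w = 2^-1 * (expR 1 * (C1 * q)).
    by rewrite wE qE; ring.
  apply: ler_wpM2l => //; rewrite -(mulrA (expR 1)).
  by apply: ler_wpM2l; [exact: expR_ge0|exact: (ler_wpM2r q0 C32)].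
by rewrite ler_wpM2r// /budget_const lerDr ltW// (addr_gt0 p1 p2).
Qed.

Lemma budget_few_observations : n%:R * eps ^+ 2 < D ->
  1 - budget_const * w <= \int[mixture (data_law f n) mk]_y Num.sqrt (phi y).
Proof.
move=> eD; have delta0 := diff_private_ge0 kDP.
(* Without observations the bound on [delta] would be 0, whereas [delta] is nonnegative. *)
have n0 : (0 < n)%N.
  rewrite lt0n; apply/negP => /eqP n00; move: delta_small.
  rewrite n00 sqrtr0 !mul0r powR0 ?ltNge ?delta0//.
  by rewrite gt_eqF// addr_gt0.
pose y := Num.sqrt (n%:R : R).
have y2 : y ^+ 2 = n%:R by rewrite sqr_sqrtr.
have y1 : 1 <= y by rewrite -sqrtr1 ler_sqrt// ler1n.
have y0 : 0 < y by exact: lt_le_trans y1.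
have wE : w = a ^+ 2 / D * ((y ^+ 2) ^+ 2 * eps ^+ 2).
  by rewrite y2 /w min_l// expr2 -mulrA ler_wpM2l// ltW.
pose rho := y ^+ 2 * eps ^+ 2 / D.
have rho01 : 0 < rho <= 1.
  rewrite /rho y2 ler_pdivrMr// mul1r ltW// andbT divr_gt0// mulr_gt0 ?exprn_gt0//.
  by rewrite ltr0n.
have /andP[rho0 rho1] := rho01.
pose lam := rho `^ (- r%:R^-1).
have dlam : delta * lam <= rho / y.
  apply: (delta_budget (kappa := kappa)) => //.
  rewrite delta0 ltW//; move: delta_small.
  by rewrite (_ : _ * D^-1 = rho / y)// /rho -/y; field; rewrite !gt_eqF.
have lam1 : 1 <= lam.
  rewrite -[leLHS](powRr0 rho) ger_powR// ?rho0// oppr_le0 invr_ge0//.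
have lamr : lam ^+ r = rho^-1.
  rewrite -powR_mulrn ?powR_ge0// -powRrM mulNr mulVf ?pnatr_eq0 ?gtn_eqF//.
  by rewrite powR_inv1// ltW.
(* The fluctuation scale of the likelihood ratio: [beta] for a single factor, the square root for
   the product of [n] factors. Both are imposed by [tilt_likelihood_moment]. *)
pose b := Num.max beta (Num.sqrt (C1 * q)).
have beta0 : 0 < beta by rewrite /beta !mulr_gt0.
have bb : beta <= b by rewrite le_max lexx.
have b0 : 0 < b by exact: lt_le_trans bb.
have bS : 0 <= b <= b1 * a * K + S * (b1 * a * y).
  rewrite (ltW b0)/=; have bay : 0 <= b1 * a * y by rewrite ltW// !mulr_gt0.
  have sqE : Num.sqrt (C1 * q) = S * (b1 * a * y).
    rewrite qE -y2 (_ : C1 * _ = C1 * b2 * (b1 * a * y) ^+ 2); last by ring.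
    rewrite sqrtrM; last by rewrite mulr_ge0// ltW.
    by rewrite sqrtr_sqr ger0_norm.
  rewrite /b ge_max sqE; apply/andP; split.
    by rewrite lerDl mulr_ge0.
  by rewrite lerDr ltW.
have qb : C1 * q <= b ^+ 2.
  have q0 : 0 <= C1 * q.
    by rewrite mulr_ge0// ?(ltW C10)// qE mulr_ge0 ?mulr_ge0 ?sqr_ge0// ltW.
  rewrite -(sqr_sqrtr q0) lerXn2r ?nnegrE ?sqrtr_ge0 ?(ltW b0)//.
  by rewrite le_max lexx orbT.
(* The clipping level exceeds the fluctuations by the factor [lam], unless it reaches 1. *)
pose c := Num.min 1 (lam * b).
have c01 : 0 < c <= 1.
  by rewrite lt_min ltr01 mulr_gt0 ?(lt_le_trans _ lam1)//= ge_min lexx.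
have clam : c <= lam * b by rewrite ge_min lexx orbT.
pose tau := C0 * beta * pi0.
have tauE : tau = C0 * (b1 * a * K) * (b2 / K ^+ 2) by [].
have l_tau : (\int[obs_law f]_z `|tilt f g z - 1|%:E <= tau%:E)%E.
  have := obs_moment mI beta01 (ltn0Sn 0) fg Ipi.
  under eq_integral do rewrite expr1.
  move=> /le_trans; apply; rewrite lee_fin expr1.
  have p0 : 0 <= pi0 by rewrite divr_ge0 ?sqr_ge0// ltW.
  by rewrite ler_wpM2r// ler_wpM2r ?(ltW beta0)// tilt_const_le.
pose M := expR 1 * C1 * q * b ^+ r.
(* If [c < 1] then [lam * b < 1], hence [b <= 1] because [lam >= 1]. *)
have LM : c < 1 -> (\int[data_law f n]_z
    ((likelihood (tilt f g) z - 1) ^+ r.+2)%:E <= M%:E)%E.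
  rewrite /c gt_min ltxx/= => lb1.
  apply: (tilt_likelihood_moment mI) => //.
  rewrite b0 ltW//; apply: le_lt_trans lb1.
  by rewrite ler_peMl// ltW.
have gE : 0 <= expR eps - 1 <= eps * E.
  rewrite expRB1_le ?(ltW eps0) ?epsC// andbT subr_ge0.
  by apply: le_trans (expR_ge1Dx eps); rewrite lerDl ltW.
have B1 := budget_privacy y b10 b20 C00 K1 a0 D1 DK gE.
have B2 := budget_delta b10 b20 C00 K1 a0 eps0 y1 D1 S0 delta0 dlam bS clam.
move: B1 B2; rewrite -tauE -wE y2 => B1 B2.
have small : n%:R * (tau * (expR eps - 1)) <= 2^-1.
  have : 2 * (E * C0 * b1 * b2) ^+ 2 <= budget_const.
    by rewrite /budget_const -addrA lerDl ltW// (addr_gt0 p2 p3).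
  move=> /bc_le.
  move: B1; set u := n%:R * _; move=> B1 B3.
  have : u ^+ 2 <= 4^-1 by lra.
  move=> u4; rewrite leNgt; apply/negP => u2; move: u4; rewrite leNgt => /negP; apply.
  rewrite expr2; nra.
(* Replacing the data by their clipped version leaves the transcript laws unchanged and makes the
   privacy inequality valid for all data sets. *)
have clip_mk := measurable_clip_kernel (@measurable_clip_obs R) mk.
have clipE h U : measurable U ->
   mixture (data_law h n) clip_mk U = mixture (data_law h n) mk U.
  by move=> mU; exact: (mixture_clip (@measurable_clip_obs R) (@obs_law_clip R h) mk mU).
have clip_int h (F : T -> \bar R) :
  (\int[mixture (data_law h n) clip_mk]_t F t = \int[mixture (data_law h n) mk]_t F t)%E.
  by apply: eq_measure_integral => U mU _; exact: clipE.
have dphi' : is_density (mixture (data_law f n) clip_mk) (mixture (data_law g n) clip_mk) phi.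
  by move=> F mF F0; rewrite !clip_int; exact: dphi.
have ge1 : 1 <= expR eps by rewrite -subr_ge0; case/andP: gE.
have <- : \int[mixture (data_law f n) clip_mk]_y Num.sqrt (phi y) =
    \int[mixture (data_law f n) mk]_y Num.sqrt (phi y) by rewrite /Rintegral clip_int.
have := server_affinity_private mt (@tilt_ge0 _ f g) (obs_density f g) mphi phi0 dphi'
   l_tau ge1 delta0 (diff_private_clip kDP) small c01 odr LM.
apply: le_trans; rewrite lerD2l lerN2.
(* In the tail [b ^+ r] cancels and [lam ^+ r] is the inverse of [rho], so what remains is
   [q * rho], a constant times [w]. *)
have B3 : (if c < 1 then M / c ^+ r else 0) <= expR 1 * C1 * (b1 ^+ 2 * b2) * w.
  have r3 : 0 <= expR 1 * C1 * (b1 ^+ 2 * b2) * w.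
    by rewrite mulr_ge0// -mulrA mulr_ge0// ?expR_ge0// ltW.
  case: ifPn => // c1; move: (c1); rewrite gt_min ltxx/= => lb1.
  rewrite /c min_r; last exact: ltW.
  rewrite exprMn lamr le_eqVlt; apply/orP; left; apply/eqP.
  rewrite /M qE wE /rho -y2; move: (b ^+ r) (exprn_gt0 r b0) => br br0.
  by field; rewrite !gt_eqF.
rewrite /budget_const; move: B1 B2 B3.
have -> : 8 * n%:R * tau * delta * c = 8 * (n%:R * tau * delta * c) by ring.
set X1 := (n%:R * _) ^+ 2; set X2 := n%:R * tau * delta * c; set X3 := (if _ then _ else _).
have -> : (2 * (E * C0 * b1 * b2) ^+ 2 + 4 * (C0 * b1 ^+ 2 * b2 * (1 + S)) +
 2^-1 * (expR 1 * C1) * (b1 ^+ 2 * b2)) * w =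
 2 * ((E * C0 * b1 * b2) ^+ 2 * w) + 4 * (C0 * b1 ^+ 2 * b2 * (1 + S) * w) +
 2^-1 * (expR 1 * C1 * (b1 ^+ 2 * b2) * w) by ring.
lra.
Qed.

Lemma server_budget :
  1 - budget_const * w <= \int[mixture (data_law f n) mk]_y Num.sqrt (phi y).
Proof.
have [|] := leP D (n%:R * eps ^+ 2).
  exact: budget_many_observations.
exact: budget_few_observations.
Qed.

End one_server.

End server_budget.

(** * Risk over the hypercube *)

Section hypercube_risk.
Context (R : realType) (A l0 : nat) (W : cdv_system R).
Hypotheses (A0 : (0 < A)%N) (W_cdv : is_cdv_basis A l0 W).
Local Notation leb := (@lebesgue_measure R).
Local Notation RT := (measurableTypeR R).
Variable L : nat.
Hypotheses (l0L : (l0 < L)%N) (NL : (4 * cdv_N W <= 2 ^ L)%N).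
Local Notation K := (cell_count W L).
Context (m : nat) (n : 'I_m -> nat) (Pi : protocol R n) (a : R).
Local Notation pert := (@pert _ _ _ _ A0 W_cdv L a).
Local Notation cube := {ffun 'I_K -> bool}.

Lemma measurable_loss (f : {mfun RT >-> RT}) :
  measurable_fun setT (fun t => sqnormL2 (fun x => (prot_est Pi (t, x) : R) - f x)).
Proof.
pose T := (m.-tuple (prot_space Pi))%type.
pose F (w : T * RT) : \bar R :=
  ((((prot_est Pi w : R) - f w.2) ^+ 2) * \1_(`[0, 1] : set RT) w.2)%:E.
have mF : measurable_fun setT F.
  apply/measurable_EFinP; apply: measurable_funM.
    apply: measurable_funX; apply: measurable_funB; first exact: (measurable_funP (prot_est Pi)).
    exact: (measurableT_comp (measurable_funP f) measurable_snd).
  by apply: (measurableT_comp _ measurable_snd); exact: measurable_indic.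
have F0 w : (0 <= F w)%E by rewrite lee_fin mulr_ge0// sqr_ge0.
rewrite (_ : (fun t => _) = fubini_F leb F); first exact: measurable_fun_fubini_tonelli_F.
apply/funext => t; rewrite /sqnormL2 /fubini_F [LHS]integral_mkcond.
apply: eq_integral => x _; rewrite patchE /F /= indicE.
by case: ifP => _; rewrite ?mulr1// mulr0.
Qed.

(** Flipping coordinate [k] costs [2 * a ^+ 2] on its cell; testing keeps an eighth of it, and
    averaging over the cube half of the total over the cells. *)
Lemma hypercube_risk (F : set {mfun RT >-> RT}) : 0 <= a ->
  (forall s, F (pert s)) ->
  (forall s k, exists (phi : 'I_m -> prot_space Pi -> R) (v : 'I_m -> R),
    [/\ forall j, [/\ measurable_fun setT (phi j), forall t, 0 <= phi j t &
          is_density (server_law Pi (pert s) j) (server_law Pi (pert (flip k s)) j) (phi j)],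
        forall j, 0 <= v j, \sum_j v j <= 2^-1 &
        forall j, 1 - v j <= \int[server_law Pi (pert s) j]_t Num.sqrt (phi j t)]) ->
  ((K%:R * (2 * a ^+ 2 / 8) / 2)%:E <= ereal_sup [set risk f Pi | f in F])%E.
Proof.
move=> a0 Fs aff.
pose loss k b (t : m.-tuple (prot_space Pi)) : \bar R :=
  cell_loss l0 a (prot_est Pi) (k : 'I_K) b t.
have mloss k b : measurable_fun setT (loss k b).
  exact: (measurable_cell_loss A0 W_cdv).
have loss0 k b t : (0 <= loss k b t)%E by exact: cell_loss_ge0.
pose x s k : \bar R := (\int[tuple_prob (server_law Pi (pert s))]_t loss k (s k) t)%E.
apply: (@assouad_average _ _ x).
- by move=> s k; exact: integral_ge0.
- move=> s k; have [phi [v [phiP v0 vs affP]]] := aff s k.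
  have mphi j : measurable_fun setT (phi j) by have [] := phiP j.
  have phi0 j t : 0 <= phi j t by have [_ + _] := phiP j.
  have dphi j := (let: And3 _ _ h := phiP j in h).
  rewrite /x ffunE eqxx.
  apply: (product_testing mphi phi0 dphi v0 vs affP) => //.
    by rewrite mulr_ge0// sqr_ge0.
  move=> t; have := cell_loss_sum_ge A0 W_cdv l0L NL a (prot_est Pi) k t.
  by rewrite /loss; case: (s k) => //=; rewrite addeC.
move=> s.
apply: (@le_trans _ _ (risk (pert s) Pi)); last first.
  by apply: ereal_sup_ubound; exists (pert s).
rewrite /risk (@integral_transcripts _ _ _ Pi); last 2 first.
- exact: measurable_loss.
- by move=> t; apply: integral_ge0 => y _; rewrite lee_fin sqr_ge0.
rewrite /x -ge0_integral_sum//.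
apply: ge0_le_integral => //.
- by move=> t _; exact: sume_ge0.
- exact: emeasurable_sum.
- exact: measurable_loss.
move=> t _; exact: (cell_loss_le A0 W_cdv l0L NL).
Qed.

End hypercube_risk.

(** * Resolution level and amplitude of the perturbations *)

Lemma leq_double_divn (x d : nat) : (0 < d)%N -> (d <= x)%N -> (x <= 2 * (x %/ d * d))%N.
Proof.
move=> d0 dx; rewrite {1}(divn_eq x d) mul2n -addnn leq_add2l.
apply: (leq_trans (ltnW (ltn_pmod x d0))).
by rewrite leq_pmull// divn_gt0.
Qed.

Section scaling.
Context (R : realType).
Implicit Types (x D alpha : R).

Lemma dyadic_between x : 1 <= x -> exists u : nat, x <= 2 ^+ u <= 2 * x.
Proof.
move=> x1.
have ex : exists u : nat, x <= 2 ^+ u.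
  exists (Num.Def.archi_bound x); apply: ltW.
  apply: (lt_trans (archi_boundP (le_trans ler01 x1))).
  by rewrite -natrX ltr_nat ltn_expl.
case: (ex_minnP ex) => u xu umin; exists u; rewrite xu/=.
case: u xu umin => [|u] xu umin; first by rewrite expr0; lra.
have : 2 ^+ u <= x.
  by rewrite leNgt; apply/negP => /ltW /umin; rewrite ltnn.
by move=> h; rewrite exprS ler_wpM2l.
Qed.

Lemma powR_anti x y alpha : 0 <= alpha -> 0 < x -> x <= y -> y `^ (- alpha) <= x `^ (- alpha).
Proof.
move=> al0 x0 xy; have y0 : 0 < y by exact: lt_le_trans xy.
rewrite !powRN lef_pV2 ?posrE ?powR_gt0//.
by apply: ge0_ler_powR; rewrite ?nnegrE// ltW.
Qed.

Lemma min_powR_le D alpha c K : 0 <= alpha -> 0 < D -> 0 < c -> 0 < K ->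
  K <= c * Num.max D 1 ->
  Num.min (D `^ (- alpha)) 1 <= c `^ alpha * K `^ (- alpha).
Proof.
move=> al0 D0 c0 K0 Kc; have M0 : 0 < Num.max D 1 by rewrite lt_max D0.
apply: (@le_trans _ _ (Num.max D 1 `^ (- alpha))).
  have [D1|D1] := leP 1 D; last by rewrite powR1 ge_min lexx orbT.
  by rewrite ge_min lexx.
have -> : Num.max D 1 `^ (- alpha) =
    c `^ alpha * (c * Num.max D 1) `^ (- alpha).
  rewrite powRM ?(ltW c0) ?(ltW M0)// mulrA -powRD ?(gt_eqF c0) ?implybT//.
  by rewrite subrr powRr0 mul1r.
by rewrite ler_wpM2l ?powR_ge0// powR_anti.
Qed.

(* Replacing [D] by [D \/ 1] loses nothing: when [D < 1] each summand at level
   1 is at most [1 / D] times the one at level [D]. *)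
Lemma budget_sum_le (m : nat) (x e : 'I_m -> R) D alpha :
  0 <= alpha -> 0 < D -> (forall j, 0 <= x j) -> (forall j, 0 <= e j) ->
  D `^ (alpha + 1) = \sum_j Num.min (e j) (x j * D) ->
  \sum_j Num.min (e j) (x j * Num.max D 1) <= Num.max D 1 `^ (alpha + 1).
Proof.
move=> al0 D0 x0 e0 DE; have [D1|D1] := leP 1 D.
  by rewrite DE.
rewrite powR1; have : D * \sum_j Num.min (e j) (x j * 1) <= D `^ (alpha + 1).
  rewrite DE mulr_sumr; apply: ler_sum => j _; rewrite mulr1.
  rewrite le_min; apply/andP; split.
    apply: (@le_trans _ _ (D * e j)).
      by rewrite ler_wpM2l ?(ltW D0)// ge_min lexx.
    by rewrite ler_piMl// ltW.
  by rewrite mulrC ler_wpM2r ?(ltW D0)// ge_min lexx orbT.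
rewrite powRD ?(gt_eqF D0) ?implybT// powRr1 ?(ltW D0)// [_ * D]mulrC.
rewrite ler_pM2l// => /le_trans; apply.
have <- : 1 `^ alpha = 1 :> R by rewrite powR1.
by apply: ge0_ler_powR; rewrite ?nnegrE//; exact: ltW.
Qed.

End scaling.

Lemma inve_fine_ge0 (R : realType) (p : \bar R) : (1 <= p)%E -> 0 <= fine (p^-1)%E.
Proof.
case: p => [r| |]//; rewrite lee_fin => r1.
have r0 : 0 < r by exact: lt_le_trans r1.
by rewrite inver gt_eqF//= invr_ge0 ltW.
Qed.

Section private_hypercube.
Context (R : realType) (A l0 : nat) (W : cdv_system R).
Hypotheses (A0 : (0 < A)%N) (W_cdv : is_cdv_basis A l0 W).
Local Notation RT := (measurableTypeR R).
Variables (kappa Ceps B alpha : R) (r : nat).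
Hypotheses (kappa0 : 0 < kappa) (odr : ~~ odd r) (r0 : (0 < r)%N) (rk : r%:R^-1 <= kappa).
Hypotheses (B0 : 0 < B) (psiB : forall x, `|cdv_psi W x| <= B).
Hypothesis alpha0 : 0 <= alpha.
Let b1 : R := 2 * B.
Let b2 : R := (2 * cdv_N W)%:R.
Let Cb : R := budget_const Ceps b1 b2 r.

Variables (L : nat) (s D : R).
Hypotheses (l0L : (l0 < L)%N) (NL : (4 * cdv_N W <= 2 ^ L)%N).
Hypotheses (s0 : 0 < s) (s1 : b1 * s <= 1) (sC : Cb * s ^+ 2 <= 2^-1).
Let K : R := 2 ^+ L.
Let D1 : R := Num.max D 1.
Hypotheses (D0 : 0 < D) (DK : D1 <= K).
(** The largest order of magnitude allowed by the Besov ball at level [L]; the constant factor [s]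
    is left free for the other constraints. *)
Definition amplitude : R := s * K `^ (- (alpha + 2^-1)).
Let a := amplitude.

Let K0 : 0 < K. Proof. exact: exprn_gt0. Qed.
Let M1 : 1 <= D1. Proof. by rewrite le_max lexx orbT. Qed.
Let M0 : 0 < D1. Proof. exact: lt_le_trans M1. Qed.
Let K1 : 1 <= K. Proof. exact: le_trans DK. Qed.
Let b10 : 0 < b1. Proof. exact: mulr_gt0. Qed.
Let b20 : 0 < b2.
Proof. by rewrite ltr0n muln_gt0/= (cdv_N_gt0 A0 W_cdv). Qed.

Lemma amplitude_gt0 : 0 < a.
Proof. by rewrite mulr_gt0// powR_gt0. Qed.

Lemma amplitude_sq : a ^+ 2 = s ^+ 2 * K `^ (- (2 * alpha + 1)).
Proof.
rewrite /a /amplitude exprMn -[X in _ * X]powR_mulrn ?powR_ge0// -powRrM.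
by congr (_ * _ `^ _); field.
Qed.

Lemma amplitude_besov : 2 `^ (L%:R * (alpha + 2^-1)) * a = s.
Proof.
rewrite powRrM powR_mulrn// -/K /a /amplitude mulrCA -powRD ?(gt_eqF K0) ?implybT//.
by rewrite subrr powRr0 mulr1.
Qed.

Lemma amplitude_likelihood : b1 * a * Num.sqrt K <= 1.
Proof.
rewrite -powR12_sqrt ?(ltW K0)// /a /amplitude.
rewrite (_ : _ * _ = b1 * s * (K `^ (- (alpha + 2^-1)) * K `^ 2^-1)); last by ring.
rewrite -powRD ?(gt_eqF K0) ?implybT//.
rewrite (_ : - (alpha + 2^-1) + 2^-1 = - alpha); last by ring.
apply: le_trans s1; apply: ler_piMr; first by rewrite mulr_ge0// ltW.
by rewrite -(powRr0 K) ler_powR// oppr_le0.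
Qed.

(** After division by [D1], the sum is at most D1^(2 alpha + 1), which is compensated by [a ^+ 2],
    that is s^2 K^(-(2 alpha + 1)), because [D1 <= K]. *)
Lemma amplitude_budget (S : R) : S <= D1 `^ (2 * alpha + 1 + 1) ->
  Cb * (a ^+ 2 / D1 * S) <= 2^-1.
Proof.
move=> SD; apply: le_trans sC; rewrite ler_wpM2l//.
  by rewrite ltW// budget_const_gt0.
apply: (@le_trans _ _ (a ^+ 2 / D1 * D1 `^ (2 * alpha + 1 + 1))).
  by rewrite ler_wpM2l// divr_ge0 ?sqr_ge0// ltW.
rewrite powRD ?(gt_eqF M0) ?implybT// powRr1 ?(ltW M0)//.
rewrite (_ : _ / D1 * _ = a ^+ 2 * D1 `^ (2 * alpha + 1)); last first.
  by field; rewrite gt_eqF.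
rewrite amplitude_sq -mulrA ler_piMr ?sqr_ge0//.
rewrite mulrC powRN ler_pdivrMr ?powR_gt0// mul1r.
have h0 : 0 <= 2 * alpha + 1 by rewrite addr_ge0// mulr_ge0.
by apply: ge0_ler_powR; rewrite ?nnegrE// ltW.
Qed.

Section servers.
Context (m : nat) (n : 'I_m -> nat) (eps delta : 'I_m -> R) (Pi : protocol R n).
Hypotheses (epsC : forall j, 0 < eps j <= Ceps)
  (DE : D `^ (2 * alpha + 2) =
     \sum_(j < m) Num.min ((n j)%:R ^+ 2 * eps j ^+ 2) ((n j)%:R * D))
  (delta_small : forall j, delta j <
     (Num.sqrt (n j)%:R * eps j ^+ 2 * D1^-1) `^ (1 + kappa))
  (DP : forall j, diff_private (eps j) (delta j) (prot_mech Pi j)).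

Let v j : R := Cb * (a ^+ 2 / D1 * Num.min ((n j)%:R ^+ 2 * eps j ^+ 2) ((n j)%:R * D1)).

Let v0 j : 0 <= v j.
Proof.
have e0 : 0 <= eps j by case/andP: (epsC j) => /ltW.
rewrite mulr_ge0// ?(ltW (budget_const_gt0 _ _ _ _))// mulr_ge0//.
  by rewrite divr_ge0 ?sqr_ge0// ltW.
by rewrite le_min !mulr_ge0 ?(ltW M0).
Qed.

Let v_sum : \sum_j v j <= 2^-1.
Proof.
rewrite /v -mulr_sumr -mulr_sumr; apply: amplitude_budget.
apply: budget_sum_le => //.
- by rewrite addr_ge0// mulr_ge0.
- by move=> j; rewrite mulr_ge0 ?sqr_ge0.
- by rewrite -DE; congr (_ `^ _); ring.
Qed.

Lemma hypercube_affinity (c : {ffun 'I_(cell_count W L) -> bool}) k :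
  exists (phi : 'I_m -> prot_space Pi -> R) (v : 'I_m -> R),
    [/\ forall j, [/\ measurable_fun setT (phi j), forall t, 0 <= phi j t &
          is_density (server_law Pi (pert A0 W_cdv a c) j)
            (server_law Pi (pert A0 W_cdv a (flip k c)) j) (phi j)],
        forall j, 0 <= v j, \sum_j v j <= 2^-1 &
        forall j, 1 - v j <=
          \int[server_law Pi (pert A0 W_cdv a c) j]_t Num.sqrt (phi j t)].
Proof.
set f := pert A0 W_cdv a c; set g := pert A0 W_cdv a (flip k c).
have dens j := server_density (@measurable_tilt _ f g) (@tilt_ge0 _ f g)
  (obs_density f g) (@measurable_kernel_law _ _ _ Pi j).
have [phi phiP] := choice dens.
exists phi, v; split => //.
move=> j; have [mphi phi0 dphi] := phiP j.
have /andP[eps0 epsCj] := epsC j.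
have v_half : v j <= 2^-1.
  by apply: le_trans v_sum; rewrite (bigD1 j)//= lerDl sumr_ge0.
apply: (server_budget (Ceps := Ceps) (b1 := b1) (b2 := b2) (K := Num.sqrt K)
  kappa0 b10 b20 odr r0 rk (measurable_cell W L k) _ amplitude_gt0 M1 _ _ _ _
  eps0 epsCj (delta_small j) (@DP j) mphi phi0 dphi v_half).
- by apply: le_trans (ler_wsqrtr K1); rewrite sqrtr1.
- by rewrite sqr_sqrtr// ltW.
- exact: amplitude_likelihood.
- move=> x; rewrite (_ : b1 * a * Num.sqrt K = 2 * a * (Num.sqrt K * B)).
    exact: (pert_flip A0 W_cdv l0L NL c k x (ltW amplitude_gt0) psiB).
  by rewrite /b1; ring.
- by rewrite sqr_sqrtr ?(ltW K0)//; exact: (uniform_cell A0 W_cdv l0L NL (ltn_ord k)).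
Qed.

(** There are at least K / (8N) cells, the integer division losing at most a factor 2, and each
    contributes [a ^+ 2 / 8]; this is where 64 comes from. *)
Lemma private_risk_ge (F : set {mfun RT >-> RT}) :
  (forall c, F (pert A0 W_cdv (L := L) a c)) ->
  ((s ^+ 2 / (64 * (cdv_N W)%:R) * K `^ (- (2 * alpha)))%:E <=
   ereal_sup [set risk f Pi | f in F])%E.
Proof.
move=> FP.
apply: le_trans (hypercube_risk l0L NL (ltW amplitude_gt0) FP hypercube_affinity).
have N0 : 0 < (cdv_N W)%:R :> R by rewrite ltr0n (cdv_N_gt0 A0 W_cdv).
have KE : a ^+ 2 * K = s ^+ 2 * K `^ (- (2 * alpha)).
  rewrite amplitude_sq -mulrA -{2}(powRr1 (ltW K0)) -powRD ?(gt_eqF K0) ?implybT//.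
  by congr (_ * _ `^ _); ring.
rewrite lee_fin mulrAC -KE.
have cells : K <= 8 * (cdv_N W)%:R * (cell_count W L)%:R.
  rewrite /K -natrX -!natrM ler_nat /cell_count.
  have N4 : (0 < 4 * cdv_N W)%N by rewrite muln_gt0 (cdv_N_gt0 A0 W_cdv).
  apply: (leq_trans (leq_double_divn N4 NL)); rewrite (_ : 8 = 2 * 4)%N//.
  by rewrite -!mulnA leq_mul2l/= [leqLHS]mulnC mulnA.
rewrite ler_pdivrMr ?mulr_gt0//.
have -> : (cell_count W L)%:R * (2 * a ^+ 2 / 8) / 2 * (64 * (cdv_N W)%:R) =
  a ^+ 2 * (8 * (cdv_N W)%:R * (cell_count W L)%:R) by field.
by rewrite ler_wpM2l ?sqr_ge0.
Qed.

End servers.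

End private_hypercube.

Theorem theorem4p1 (R : realType) (alpha rad kappa Ceps : R) (p q : \bar R)
    (A l0 : nat) (W : cdv_system R)
    (p_ge2 : (2%:E <= p)%E) (q_ge1 : (1%:E <= q)%E)
    (alpha_gt : 2^-1 < alpha - fine (p^-1)%E)
    (rad_gt0 : 0 < rad) (kappa_gt0 : 0 < kappa) (Ceps_gt0 : 0 < Ceps)
    (A_gt : alpha < A%:R) (W_cdv : is_cdv_basis A l0 W) :
  exists C : R, 0 < C /\ exists N0 : nat,
    forall (m : nat) (n : 'I_m -> nat) (eps delta : 'I_m -> R) (D : R),
      (N0 <= \sum_(j < m) n j)%N ->
      (forall j, 0 < eps j <= Ceps) ->
      0 < D ->
      D `^ (2 * alpha + 2) =
        \sum_(j < m) Num.min ((n j)%:R ^+ 2 * eps j ^+ 2) ((n j)%:R * D) ->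
      (forall j, delta j <
        (Num.sqrt (n j)%:R * eps j ^+ 2 * (Num.max D 1)^-1) `^ (1 + kappa)) ->
      ((Num.min (D `^ (- (2 * alpha))) 1)%:E <=
        C%:E * minimax_risk n eps delta
                 (besov_ball W l0 alpha p q rad))%E.
Proof.
have p1 : (1 <= p)%E by apply: le_trans p_ge2; rewrite lee_fin ler1n.
have alpha_half : 2^-1 < alpha.
  by apply: (lt_le_trans alpha_gt); rewrite gerBl inve_fine_ge0.
have alpha0 : 0 <= alpha by rewrite ltW// (lt_trans _ alpha_half).
have A0 : (0 < A)%N by rewrite -(ltr0n R) (le_lt_trans _ A_gt).
have [B B0 psiB] := cdv_psi_bounded A0 W_cdv.
(* The moment order must be even, for positivity, and at least 1 / kappa, for [delta_budget]. *)
pose h := Num.Def.archi_bound kappa^-1.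
have hk : kappa^-1 < h%:R by apply: archi_boundP; rewrite invr_ge0 ltW.
have h0 : (0 < h)%N by rewrite -(ltr0n R) (lt_trans _ hk)// invr_gt0.
pose r := h.*2.
have odr : ~~ odd r by rewrite odd_double.
have r0 : (0 < r)%N by rewrite double_gt0.
have rk : r%:R^-1 <= kappa.
  rewrite -[leRHS]invrK lef_pV2 ?posrE ?invr_gt0 ?ltr0n//.
  by apply: (le_trans (ltW hk)); rewrite ler_nat /r -addnn leq_addr.
have N0 : 0 < (cdv_N W)%:R :> R by rewrite ltr0n (cdv_N_gt0 A0 W_cdv).
pose Cb := budget_const Ceps (2 * B) (2 * cdv_N W)%:R r.
have Cb0 : 0 < Cb.
  apply: budget_const_gt0; first exact: mulr_gt0.
  by rewrite ltr0n muln_gt0 (cdv_N_gt0 A0 W_cdv).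
(* The constraints on the amplitude: [rad] for the Besov ball, [(2 * B)^-1] to keep the perturbation
   below 1, the other two for the information budget. *)
pose s := Num.min (Num.min rad (2 * B)^-1) (Num.min 1 (2 * Cb)^-1).
have s0 : 0 < s by rewrite !lt_min rad_gt0 ltr01 !invr_gt0 !mulr_gt0.
have s_rad : s <= rad by rewrite !ge_min lexx.
have s1 : 2 * B * s <= 1.
  by rewrite mulrC -ler_pdivlMr ?mulr_gt0// mul1r !ge_min lexx orbT.
have sC : Cb * s ^+ 2 <= 2^-1.
  have s_le1 : s <= 1 by rewrite !ge_min lexx !orbT.
  have sCb : s <= (2 * Cb)^-1 by rewrite !ge_min lexx !orbT.
  apply: (@le_trans _ _ (Cb * (2 * Cb)^-1)); last first.
    by rewrite invfM mulrCA mulfV ?mulr1// gt_eqF.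
  rewrite ler_pM2l//; apply: le_trans sCb.
  by rewrite expr2 ler_piMr// ltW.
(* The offset [l0 + 2] of the level chosen below, plus one for rounding up to a power of 2. *)
pose c : R := 2 ^+ (l0 + 3).
have c0 : 0 < c by rewrite exprn_gt0.
pose low := s ^+ 2 / (64 * (cdv_N W)%:R).
have low0 : 0 < low by rewrite divr_gt0 ?exprn_gt0// mulr_gt0.
exists (c `^ (2 * alpha) / low); split; first by rewrite divr_gt0// powR_gt0.
(* The bound is non-asymptotic: it holds for every total sample size. *)
exists 0 => m n eps delta D _ epsC D0 DE delta_small.
have M1 : 1 <= Num.max D 1 by rewrite le_max lexx orbT.
have [u /andP[Du uD]] := dyadic_between M1.
(* The offset puts [L] above [l0] and gives [4 * cdv_N W <= 2 ^ L], since
   [2 * cdv_N W <= 2 ^ l0.+1]. *)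
pose L := (l0 + 2 + u)%N.
have l0L : (l0 < L)%N by rewrite /L -addnA -[ltnLHS]addn0 ltn_add2l.
have NL : (4 * cdv_N W <= 2 ^ L)%N.
  apply: (@leq_trans (2 ^ (l0 + 2))); last by rewrite leq_exp2l// leq_addr.
  rewrite (_ : 4 = 2 * 2)%N// -mulnA addn2 expnS leq_mul2l/=.
  exact: cdv_coarsest_scale W_cdv.
pose K : R := 2 ^+ L.
have DK : Num.max D 1 <= K.
  apply: (le_trans Du); rewrite ler_eXn2l ?ltr1n// /L leq_addl//.
have Kc : K <= c * Num.max D 1.
  have -> : c * Num.max D 1 = 2 ^+ (l0 + 2) * (2 * Num.max D 1).
    by rewrite mulrA -exprSr -addnS.
  by rewrite /K /L exprD; apply: ler_wpM2l => //; exact: exprn_ge0.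
have K0 : 0 < K by exact: exprn_gt0.
have lowE : ((low * K `^ (- (2 * alpha)))%:E <=
    minimax_risk n eps delta (besov_ball W l0 alpha p q rad))%E.
  apply: le_ereal_inf_tmp => _ [Pi [_ DP] ->].
  apply: (private_risk_ge (W_cdv := W_cdv) kappa_gt0 odr r0 rk B0 psiB alpha0 l0L NL s0 s1 sC D0 DK
    epsC DE delta_small DP) => cube.
  apply: (pert_in_besov_ball A0 W_cdv l0L) => //.
    by rewrite ltW// amplitude_gt0.
  by rewrite amplitude_besov.
have alpha20 : 0 <= 2 * alpha by rewrite mulr_ge0.
have coef0 : 0 <= c `^ (2 * alpha) / low by rewrite divr_ge0 ?powR_ge0// ltW.
apply: le_trans (lee_wpmul2l _ lowE); last by rewrite lee_fin.
rewrite -EFinM lee_fin; apply: (le_trans (min_powR_le alpha20 D0 c0 K0 Kc)).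
by rewrite mulrA divfK// gt_eqF.
Qed.
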